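(* Let $d\in\mathbb{N}$, $R\in(0,+\infty]$, and let $J\subseteq\mathcal{O}_d(R)$ be a finitely generated right ideal. Then $J$ is closed in $\mathcal{O}_d(R)$ and $J=I(\mathcal{Z}(J))$.
   Context: Let $\mathbb{W}_d$ be the free monoid of all words in the letters $\{1,\dots,d\}$, including the empty word; $|\omega|$ is the length of $\omega$. For non-commuting formal variables $z=(z_1,\dots,z_d)$ put $z^\omega=z_{i_1}\cdots z_{i_n}$ if $\omega=i_1\cdots i_n$, and $z^\emptyset=1$. The radius of convergence $R_f$ of a formal power series $f=\sum_{\omega}\hat f_\omega z^\omega\in\mathbb{C}\langle\langle z\rangle\rangle$ is given by $\frac1{R_f}=\limsup_{\ell\to\infty}\big(\sum_{|\omega|=\ell}|\hat f_\omega|^2\big)^{1/(2\ell)}$, and $\mathcal{O}_d(R)$ is the ring of all such $f$ with $R_f\ge R$. For a $d$-tuple $X=(X_1,\dots,X_d)$ of bounded operators on a Hilbert space, $\|X\|_{\rm row}=\|\sum_jX_jX_j^*\|^{1/2}$. If $f\in\mathcal{O}_d(R)$ and $\|X\|_{\rm row}<R$, then $f(X)=\sum_{\ell\ge0}\sum_{|\omega|=\ell}\hat f_\omega X^\omega$ converges in operator norm. The topology of $\mathcal{O}_d(R)$ is given by the semi-norms $\rho_r(f)=\sup\{\|f(X)\| : X\in(\mathbb{C}^{n\times n})^d,\ n\in\mathbb{N},\ \|X\|_{\rm row}\le r\}$, $0<r<R$. For $n\in\mathbb{N}$ let $R\cdot\mathbb{B}^{(n\times n)\cdot d}$ be the set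 of $d$-tuples $X$ of $n\times n$ complex matrices with $\|X\|_{\rm row}<R$; for $n=\aleph_0$ put $\mathbb{C}^{\aleph_0}:=\ell^2(\mathbb{N})$ and let $R\cdot\mathbb{B}^{(\aleph_0\times\aleph_0)\cdot d}$ be the set of $d$-tuples $X$ of bounded operators on $\ell^2(\mathbb{N})$ with $\|X\|_{\rm row}<R$ (no norm restriction if $R=+\infty$). For $S\subseteq\mathcal{O}_d(R)$ the directional variety is $$\mathcal{Z}(S)=\bigsqcup_{n\le\aleph_0}\{(X,y)\in R\cdot\mathbb{B}^{(n\times n)\cdot d}\times(\mathbb{C}^n\setminus\{0\}) : y\perp\operatorname{Ran}f(X)\ \ \forall f\in S\},$$ and for $\mathcal{Z}\subseteq\bigsqcup_{n\le\aleph_0}R\cdot\mathbb{B}^{(n\times n)\cdot d}\times(\mathbb{C}^n\setminus\{0\})$, $$I(\mathcal{Z})=\{f\in\mathcal{O}_d(R) : y\perp\operatorname{Ran}f(X)\ \ \forall (X,y)\in\mathcal{Z}\}.$$ *)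

(* Defs.v *)
From HB Require Import structures.
From mathcomp Require Import all_boot all_order all_algebra.
From mathcomp Require Import complex.
From mathcomp Require Import all_classical all_reals all_analysis.
From mathcomp Require Import ring lra.

Set Implicit Arguments.
Unset Strict Implicit.
Unset Printing Implicit Defensive.

Import Order.TTheory GRing.Theory Num.Theory.
Import numFieldNormedType.Exports.
Import ComplexField ComplexField.Normc.

Local Open Scope classical_set_scope.
Local Open Scope ring_scope.

(* Words are sequences over 'I_d, and f w is the coefficient of z^w. *)
Definition ncseries (R : realType) (d : nat) : Type := seq 'I_d -> R[i].

Section NCSeries.
Variables (R : realType) (d : nat).
Implicit Types f g h : ncseries R d.

HB.instance Definition _ := GRing.Zmodule.copy (ncseries R d) (seq 'I_d -> R[i]).

Definition ncone : ncseries R d := fun w => (w == [::])%:R.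

Definition ncmul f g : ncseries R d :=
  fun w => \sum_(i < (size w).+1) f (take i w) * g (drop i w).

Fact ncmulA : associative ncmul.
Proof.
move=> f g h; apply/funext => w; rewrite /ncmul.
transitivity (\sum_(0 <= j < (size w).+1) \sum_(0 <= i < (size w).+1 | (j <= i)%N)
   f (take j w) * (g (take (i - j) (drop j w)) * h (drop i w))).
  rewrite big_mkord; apply: eq_bigr => -[j /=]; rewrite ltnS => jw _.
  rewrite big_distrr /= -(big_mkord xpredT (fun i => f (take j w) *
    (g (take i (drop j w)) * h (drop i (drop j w))))).
  rewrite size_drop -subSn // -[X in \sum_(X <= _ < _) _]/(0%N).
  rewrite [RHS](big_cat_nat (n := j)) //=; last exact: leqW.
  rewrite [X in X + _]big_nat_cond [X in X + _]big1 ?add0r; last first.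
    by move=> i /andP[/andP[_ ij]]; rewrite leqNgt ij.
  rewrite -[X in _ = \big[_/_]_(X <= _ < _ | _) _]add0n big_addn [RHS]big_mkcond /=; apply: eq_bigr => i _.
  by rewrite leq_addl addnK drop_drop.
rewrite (exchange_big_dep_nat xpredT) //= big_mkord; apply: eq_bigr => -[i /=].
rewrite ltnS => iw _; rewrite big_distrl /= size_takel //.
rewrite -(big_mkord xpredT (fun j =>
  f (take j (take i w)) * g (drop j (take i w)) * h (drop i w))).
rewrite (big_cat_nat (n := i.+1)) //= [X in _ + X]big_nat_cond [X in _ + X]big1 ?addr0; last first.
  by move=> j /andP[/andP[ij _]]; rewrite leqNgt ij.
rewrite big_nat_cond [RHS]big_nat_cond; apply: eq_big => [j|j].
  by rewrite andbT andbC /= ltnS; case: (j <= i)%N.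
rewrite leq0n /= ltnS => /andP[ji _]; rewrite mulrA take_takel //.
by rewrite take_drop subnK.
Qed.

Fact ncmul1f : left_id ncone ncmul.
Proof.
move=> f; apply/funext => w; rewrite /ncmul big_ord_recl take0 drop0 /ncone.
rewrite eqxx mul1r big1 ?addr0 // => i _; case: w i => [|a w] [i //= iw] /=.
by rewrite mul0r.
Qed.

Fact ncmulf1 : right_id ncone ncmul.
Proof.
move=> f; apply/funext => w; rewrite /ncmul big_ord_recr /= take_size drop_size /ncone.
rewrite eqxx mulr1 big1 ?add0r // => i _.
by rewrite -size_eq0 size_drop subn_eq0 leqNgt ltn_ord mulr0.
Qed.

Fact ncmulDl : left_distributive ncmul +%R.
Proof.
move=> f g h; apply/funext => w.
rewrite -[RHS]/(ncmul f h w + ncmul g h w) /ncmul -big_split /=.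
by apply: eq_bigr => i _; rewrite -mulrDl.
Qed.

Fact ncmulDr : right_distributive ncmul +%R.
Proof.
move=> f g h; apply/funext => w.
rewrite -[RHS]/(ncmul f g w + ncmul f h w) /ncmul -big_split /=.
by apply: eq_bigr => i _; rewrite -mulrDr.
Qed.

Fact ncone_neq0 : ncone != 0.
Proof.
apply/eqP => /(congr1 (fun f : ncseries R d => f [::])) /eqP.
by rewrite /ncone eqxx oner_eq0.
Qed.

HB.instance Definition _ := GRing.Zmodule_isNzRing.Build (ncseries R d)
  ncmulA ncmul1f ncmulf1 ncmulDl ncmulDr ncone_neq0.

Definition hom_sqnorm f (l : nat) : R :=
  \sum_(w : l.-tuple 'I_d) normc (f w) ^+ 2.

(* In \bar R the library's inverse satisfies 0^-1 = +oo and +oo^-1 = 0. *)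
Definition radius f : \bar R :=
  ((limn_esup (fun l : nat => (hom_sqnorm f l `^ (2 * l%:R)^-1)%:E))^-1)%E.

End NCSeries.

Section Radius.
Variables (R : realType) (d : nat).
Implicit Types f g h : ncseries R d.

Lemma hom_sqnorm_ge0 f l : 0 <= hom_sqnorm f l.
Proof. by apply: sumr_ge0 => w _; rewrite sqr_ge0. Qed.

Lemma normc_ge0 (z : R[i]) : 0 <= normc z.
Proof. by case: z => a b; rewrite sqrtr_ge0. Qed.

Lemma sqr_normcD (x y : R[i]) :
  normc (x + y) ^+ 2 <= 2 * (normc x ^+ 2 + normc y ^+ 2).
Proof.
have := @le_normcD R x y; have := normc_ge0 (x + y).
have := sqr_ge0 (normc x - normc y); have := normc_ge0 x; have := normc_ge0 y.
nra.
Qed.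

Lemma sqr_normc_sum n (F : 'I_n -> R[i]) :
  normc (\sum_i F i) ^+ 2 <= n%:R * \sum_i normc (F i) ^+ 2.
Proof.
have CS m (G : 'I_m -> R) : (\sum_i G i) ^+ 2 <= m%:R * \sum_i G i ^+ 2.
  elim: m G => [|m IH] G; first by rewrite !big_ord0 expr0n mul0r.
  rewrite !big_ord_recr /= -natr1.
  have := IH (fun i => G (widen_ord (leqnSn m) i)).
  set S := \sum_(i < m) _; set Q := \sum_(i < m) _; set a := G _ => H.
  have Q0 : 0 <= Q by apply: sumr_ge0 => i _; rewrite sqr_ge0.
  case: (posnP m) => [m0|m_gt0].
    have S0 : S = 0 by move: H; rewrite m0 mul0r => H; apply/eqP; nra.
    rewrite S0 m0; nra.
  have mp : 0 < m%:R :> R by rewrite ltr0n.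
  have : 0 <= m%:R * (Q + m%:R * a ^+ 2 - 2 * S * a).
    apply: le_trans (sqr_ge0 (S - m%:R * a)) _; nra.
  rewrite pmulr_rge0 //; nra.
apply: le_trans (CS _ _); rewrite ler_sqr ?nnegrE ?normc_ge0 //; last first.
  by apply: sumr_ge0 => i _; exact: normc_ge0.
elim: n F => [|n IH] F; first by rewrite !big_ord0 normc0.
rewrite !big_ord_recr /=; apply: le_trans (@le_normcD R _ _) _.
by rewrite lerD2r; apply: IH.
Qed.

Lemma hom_sqnormD f g l :
  hom_sqnorm (f + g) l <= 2 * (hom_sqnorm f l + hom_sqnorm g l).
Proof.
rewrite /hom_sqnorm -big_split /= mulr_sumr; apply: ler_sum => w _.
exact: sqr_normcD.
Qed.

Lemma big_split_tuple k m (F G : seq 'I_d -> R) :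
  \sum_(w : (k + m).-tuple 'I_d) F (take k w) * G (drop k w) =
  (\sum_(u : k.-tuple 'I_d) F u) * (\sum_(v : m.-tuple 'I_d) G v).
Proof.
rewrite big_distrlr pair_big /=.
pose h (p : k.-tuple 'I_d * m.-tuple 'I_d) := [tuple of p.1 ++ p.2].
rewrite (reindex h) /=.
  apply: eq_bigr => -[u v] _ /=.
  by rewrite take_cat drop_cat size_tuple ltnn subnn take0 cats0 drop0.
apply/onW_bij/inj_card_bij; last first.
  by rewrite card_prod !card_tuple expnD.
move=> [u v] [u' v'] /(congr1 val) /= /eqP.
rewrite eqseq_cat ?size_tuple // => /andP[/eqP uu' /eqP vv'].
by congr pair; apply: val_inj.
Qed.

Lemma hom_sqnormM f g l : hom_sqnorm (f * g) l <=
  l.+1%:R * \sum_(k < l.+1) hom_sqnorm f k * hom_sqnorm g (l - k).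
Proof.
apply: le_trans (_ : \sum_(w : l.-tuple 'I_d) (l.+1%:R *
   \sum_(k < l.+1) normc (f (take k w)) ^+ 2 * normc (g (drop k w)) ^+ 2) <= _).
  apply: ler_sum => w _; apply: le_trans (sqr_normc_sum _) _.
  rewrite size_tuple ler_pM2l ?ltr0n //; apply: ler_sum => k _.
  by rewrite normcM exprMn.
rewrite -mulr_sumr ler_pM2l ?ltr0n // exchange_big /=; apply: ler_sum => k _.
have kl : l = (k + (l - k))%N by rewrite subnKC // -ltnS.
by rewrite -(big_split_tuple k (l - k) (fun u => normc (f u) ^+ 2) (fun u => normc (g u) ^+ 2)) -kl.
Qed.

Lemma mulSn_expr_le (p : R) n : 0 <= p -> p < 1 ->
  n.+1%:R * p ^+ n <= (1 - p)^-1.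
Proof.
move=> p0 p1; rewrite -[leRHS]mul1r ler_pdivlMr ?subr_gt0 //.
apply: le_trans (_ : (\sum_(i < n.+1) p ^+ i) * (1 - p) <= _).
  rewrite ler_pM2r ?subr_gt0 // mulr_natl -[X in _ *+ X]card_ord -sumr_const.
  by apply: ler_sum => i _; rewrite ler_wiXn2l ?(ltW p1) ?leq_ord //.
rewrite mulrC -opprB mulNr -subrX1 opprB lerBlDr lerDl; exact: exprn_ge0.
Qed.

Lemma radiusP (rho : \bar R) f :
  (rho <= radius f)%E <->
  (forall r : R, 0 < r -> (r%:E < rho)%E ->
    exists C : R, forall l, hom_sqnorm f l * r ^+ (2 * l) <= C).
Proof.
set u := fun l : nat => (hom_sqnorm f l `^ (2 * l%:R)^-1)%:E.
have u0 l : (0 <= u l)%E by rewrite lee_fin powR_ge0.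
have L0 : (0 <= limn_esup u)%E.
  apply: le_ereal_inf_tmp => _ [V [N _ NV] <-].
  by apply: le_ereal_sup_tmp; exists (u N) => //; exists N => //; apply: NV => /=.
have R0 : (0 <= radius f)%E by rewrite /radius -/u inve_ge0.
have mid (x : R) (y : \bar R) : (x%:E < y)%E -> exists2 z : R, x < z & (z%:E < y)%E.
  case: y => [y| |//]; last by exists (x + 1); rewrite ?ltry // ltrDl.
  rewrite lte_fin => xy; exists ((x + y) / 2); rewrite ?lte_fin; lra.
split=> [rhoR r r0 rrho|H].
  have : (limn_esup u < r^-1%:E)%E.
    have := lt_le_trans rrho rhoR; rewrite /radius -/u inve_pgt ?inE ?lee_fin ?(ltW r0) //.
    by rewrite inver gt_eqF.
  move=> /ereal_inf_lt[_ [V [N _ NV] <-] Vr].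
  exists (1 + \sum_(i < N.+1) hom_sqnorm f i * r ^+ (2 * i)) => l.
  have pos i : 0 <= hom_sqnorm f i * r ^+ (2 * i).
    by rewrite mulr_ge0 ?hom_sqnorm_ge0 // exprn_ge0 // ltW.
  have [lN|Nl] := ltnP l N.+1.
    rewrite (bigD1 (Ordinal lN)) //= addrCA lerDl addr_ge0 //.
    by apply: sumr_ge0 => i _.
  apply: le_trans (_ : 1 <= _); last first.
    by rewrite lerDl; apply: sumr_ge0 => i _.
  have : (u l < r^-1%:E)%E.
    by apply: le_lt_trans Vr; apply: ereal_sup_ubound; exists l => //; apply: NV; apply: ltnW.
  rewrite lte_fin => /ltW ul.
  have l0 : (0 < l)%N by apply: leq_trans Nl.
  have : (hom_sqnorm f l `^ (2 * l%:R)^-1) ^+ (2 * l) <= r^-1 ^+ (2 * l).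
    by rewrite lerXn2r ?nnegrE ?powR_ge0 ?invr_ge0 ?(ltW r0).
  rewrite -powR_mulrn ?powR_ge0 // -powRrM natrM mulVf ?powRr1 ?hom_sqnorm_ge0 //; last first.
    by rewrite mulf_neq0 // ?pnatr_eq0 // -lt0n.
  by rewrite exprVn -[_^-1]mul1r ler_pdivlMr ?exprn_gt0.
have key (r : R) : 0 < r -> (r%:E < rho)%E -> (r%:E <= radius f)%E.
  move=> r0 /mid[s rs /H[]]; first exact: lt_trans rs.
  move=> C HC; have s0 : 0 < s by apply: lt_trans rs.
  have C0 : 0 <= C by apply: le_trans (HC 0%N); rewrite expr0 mulr1 hom_sqnorm_ge0.
  pose p := (r / s) ^+ 2.
  have p0 : 0 <= p by rewrite sqr_ge0.
  have p1 : p < 1 by rewrite expr_lt1 // ?ltr_pdivrMr ?mul1r // divr_ge0 ?ltW.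
  have K0 : 0 < 1 - p by rewrite subr_gt0.
  pose N := Num.bound (C / (1 - p)).
  rewrite /radius -/u -[leLHS]inveK lee_pV2 ?inE //; last first.
    by rewrite inve_ge0 lee_fin ltW.
  rewrite inver gt_eqF //; apply: ge_ereal_inf.
  exists (ereal_sup [set u x | x in [set n | (N < n)%N]]).
    by exists [set n | (N < n)%N] => //; exists N.+1.
  apply: ge_ereal_sup => _ [l /= Nl <-]; rewrite lee_fin.
  have l0 : (0 < l)%N by apply: leq_trans Nl.
  have ll0 : 0 < 2 * l%:R :> R by rewrite mulr_gt0 ?ltr0n.
  rewrite -[leRHS]powRr1 ?invr_ge0 ?(ltW r0) ?(ltW ll0) // -[X in _ <= _ `^ X](mulfV (lt0r_neq0 ll0)).
  rewrite powRrM ge0_ler_powR ?nnegrE ?powR_ge0 ?hom_sqnorm_ge0 ?invr_ge0 ?(ltW r0) ?(ltW ll0) //.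
  rewrite -natrM powR_mulrn ?invr_ge0 ?(ltW r0) ?(ltW ll0) // exprVn.
  rewrite -[leRHS]mul1r ler_pdivlMr ?exprn_gt0 //.
  have Hl := HC l; have sl : 0 < s ^+ (2 * l) by rewrite exprn_gt0.
  have pl : p ^+ l * s ^+ (2 * l) = r ^+ (2 * l).
    by rewrite -exprM expr_div_n mulfVK // gt_eqF.
  rewrite -pl mulrCA; apply: le_trans (_ : p ^+ l * C <= _).
    by apply: ler_wpM2l; [exact: exprn_ge0|exact: Hl].
  have lN : C / (1 - p) <= l.+1%:R.
    apply: le_trans (ltW (archi_boundP _)) _; first by rewrite divr_ge0 // ltW.
    by rewrite ler_nat -/N; apply: leqW; apply: ltnW.
  have := mulSn_expr_le l p0 p1; rewrite -[leRHS]mul1r ler_pdivlMr //.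
  move: lN; rewrite ler_pdivrMr // => lN pn.
  have pl0 : 0 <= p ^+ l by rewrite exprn_ge0.
  apply: le_trans pn; rewrite -[leRHS]mulrA [X in _ <= _ * X]mulrC mulrA.
  by rewrite [leRHS]mulrC ler_wpM2l.
rewrite leNgt; apply/negP => Rrho.
have : radius f \is a fin_num by rewrite fin_real // (lt_le_trans ltNy0 R0) (lt_le_trans Rrho) ?leey.
move=> /fineK Rf; move: Rrho R0; rewrite -Rf lee_fin => /mid[r Rr rrho] R0.
by have := key r (le_lt_trans R0 Rr) rrho; rewrite -Rf lee_fin leNgt Rr.
Qed.

End Radius.

Definition conv_pred (R : realType) (d : nat) (rho : \bar R) :
    pred (ncseries R d) :=
  fun f => (rho <= radius f)%E.

Section ConvSubring.
Variables (R : realType) (d : nat) (rho : \bar R).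

Fact conv_subring_closed : subring_closed (@conv_pred R d rho).
Proof.
split=> [|f g|f g]; rewrite ?[_ \in _]/(_ <= _)%E.
- apply/radiusP => r r0 _; exists (hom_sqnorm (1 : ncseries R d) 0) => -[|l].
    by rewrite expr0 mulr1.
  rewrite [X in X * _]big1 ?mul0r ?hom_sqnorm_ge0 // => w _.
  rewrite -[(1 : ncseries R d) w]/((val w == [::])%:R) -size_eq0 size_tuple /=.
  by rewrite !expr0n addr0 sqrtr0 expr0n.
- move=> /radiusP Hf /radiusP Hg; apply/radiusP => r r0 rrho.
  have [C HC] := Hf r r0 rrho; have [D HD] := Hg r r0 rrho.
  exists (2 * (C + D)) => l; have rl : 0 <= r ^+ (2 * l) by rewrite exprn_ge0 // ltW.
  have NE : hom_sqnorm (- g) l = hom_sqnorm g l.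
    by apply: eq_bigr => w _; rewrite normcN.
  apply: le_trans (ler_wpM2r rl (hom_sqnormD _ _ _)) _.
  by rewrite NE -mulrA ler_pM2l // mulrDl; exact: lerD.
move=> /radiusP Hf /radiusP Hg; apply/radiusP => r r0 rrho.
have [s rs srho] : exists2 s : R, r < s & (s%:E < rho)%E.
  case: (rho) rrho => [y| |//]; last by exists (r + 1); rewrite ?ltry // ltrDl.
  by rewrite lte_fin => xy; exists ((r + y) / 2); rewrite ?lte_fin; lra.
have s0 : 0 < s by apply: lt_trans rs.
have [C HC] := Hf s s0 srho; have [D HD] := Hg s s0 srho.
pose p := r / s.
have p0 : 0 <= p by rewrite divr_ge0 // ltW.
have p1 : p < 1 by rewrite ltr_pdivrMr ?mul1r.
have HC0 : 0 <= C by apply: le_trans (HC 0%N); rewrite expr0 mulr1 hom_sqnorm_ge0.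
exists (C * D * ((1 - p)^-1) ^+ 2) => l.
have rl : 0 <= r ^+ (2 * l) by rewrite exprn_ge0 // ltW.
have sl : 0 < s ^+ (2 * l) by rewrite exprn_gt0.
have pE : r ^+ (2 * l) = s ^+ (2 * l) * (p ^+ l) ^+ 2.
  by rewrite -[(p ^+ l) ^+ 2]exprM mulnC -exprMn /p mulrCA mulfV ?mulr1 ?gt_eqF // mulnC.
apply: le_trans (ler_wpM2r rl (hom_sqnormM _ _ _)) _.
rewrite pE; set T := \sum_(k < _) _.
have TCD : T * s ^+ (2 * l) <= l.+1%:R * (C * D).
  rewrite /T mulr_suml; apply: le_trans (_ : \sum_(k < l.+1) C * D <= _).
    apply: ler_sum => k _.
    have -> : (2 * l = 2 * k + 2 * (l - k))%N by rewrite -mulnDr subnKC // -ltnS.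
    rewrite exprD mulrACA.
    by apply: ler_pM => //; rewrite mulr_ge0 ?hom_sqnorm_ge0 // exprn_ge0 // ltW.
  by rewrite sumr_const card_ord mulr_natl.
have CD0 : 0 <= C * D.
  by rewrite mulr_ge0 //; apply: le_trans (HD 0%N); rewrite expr0 mulr1 hom_sqnorm_ge0.
have -> : l.+1%:R * T * (s ^+ (2 * l) * (p ^+ l) ^+ 2) =
  T * s ^+ (2 * l) * (l.+1%:R * (p ^+ l) ^+ 2) by ring.
apply: le_trans (_ : l.+1%:R * (C * D) * (l.+1%:R * (p ^+ l) ^+ 2) <= _).
  by apply: ler_wpM2r => //; rewrite mulr_ge0 ?sqr_ge0.
have -> : l.+1%:R * (C * D) * (l.+1%:R * (p ^+ l) ^+ 2) =
  C * D * (l.+1%:R * p ^+ l) ^+ 2 by ring.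
apply: ler_wpM2l => //; rewrite lerXn2r ?nnegrE ?mulSn_expr_le //.
  by rewrite mulr_ge0 // exprn_ge0.
by rewrite invr_ge0 subr_ge0 ltW.
Qed.

HB.instance Definition _ :=
  GRing.isSubringClosed.Build (ncseries R d) (@conv_pred R d rho)
    conv_subring_closed.

Record conv_series : Type := ConvSeries {
  series_of : ncseries R d;
  _ : series_of \in @conv_pred R d rho
}.

HB.instance Definition _ := [isSub for series_of].
HB.instance Definition _ := [Choice of conv_series by <:].
HB.instance Definition _ := [SubChoice_isSubNzRing of conv_series by <:].

End ConvSubring.

(* Bounded operators on a space H with inner product dot, which is linear in
   its first argument. *)
Section Operators.
Variables (R : realType) (H : lmodType R[i]) (dot : H -> H -> R[i]).
Implicit Types (T S : H -> H) (x y : H).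

Definition hnorm x : R := Num.sqrt (complex.Re (dot x x)).

Definition opnorm T : \bar R :=
  ereal_sup [set (hnorm (T x))%:E | x in [set x | hnorm x <= 1]].

Definition bounded_op T : Prop := linear T /\ (opnorm T < +oo)%E.

(* Only meaningful when T has an adjoint, e.g. for T bounded on a Hilbert
   space; the adjoint is then unique. *)
Definition adjoint T : H -> H :=
  xget 0 [set S | forall x y, dot (T x) y = dot x (S y)].

Definition perp_range T y : Prop := forall x, dot (T x) y = 0.

Variable d : nat.
Implicit Types (X : 'I_d -> H -> H) (f : ncseries R d).

Definition row_norm X : \bar R :=
  sqrte (opnorm (\sum_(j < d) (X j \o adjoint (X j)))).

Definition word_op X (w : seq 'I_d) : H -> H :=
  foldr (fun j T => X j \o T) id w.

Definition partial_eval f X (N : nat) : H -> H :=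
  \sum_(l < N) \sum_(w : l.-tuple 'I_d) f w *: word_op X w.

(* f(X) is the limit in operator norm of the partial sums. *)
Definition nceval f X : H -> H :=
  xget 0 [set T | bounded_op T /\
    opnorm (partial_eval f X N - T) @[N --> \oo] --> 0%E].

End Operators.

Section MatrixLevel.
Variables (R : realType) (n : nat).

Definition cdot (x y : 'cV[R[i]]_n) : R[i] :=
  \sum_(i < n) x i ord0 * conjc (y i ord0).

Definition mxops d (X : 'I_d -> 'M[R[i]]_n) (j : 'I_d) :
    'cV[R[i]]_n -> 'cV[R[i]]_n :=
  mulmx (X j).

End MatrixLevel.

Section L2.
Variable R : realType.

Definition square_summable : pred (nat -> R[i]) :=
  fun x => (\sum_(0 <= k <oo) (normc (x k) ^+ 2)%:E < +oo)%E.

Fact square_summable_submod : submod_closed square_summable.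
Proof.
have pos (x : nat -> R[i]) k : (0 <= (normc (x k) ^+ 2)%:E)%E.
  by rewrite lee_fin sqr_ge0.
split=> [|a x y].
  rewrite -[_ \in _]/(_ < _)%E (@eq_eseriesr _ _ (fun=> 0%E)) => [|k _].
    by rewrite eseries0 // ltry.
  by rewrite -[(0 : nat -> R[i]) k]/(0%C) normc0 expr0n.
rewrite -![_ \in _]/(_ < _)%E => sx sy.
apply: (@le_lt_trans _ _ (\sum_(0 <= k <oo)
   ((2 * normc a ^+ 2)%:E * (normc (x k) ^+ 2)%:E + 2%:E * (normc (y k) ^+ 2)%:E))%E).
  apply: lee_nneseries => // k _; rewrite -!EFinM -EFinD lee_fin.
  apply: le_trans (sqr_normcD (a * x k) (y k)) _.
  by rewrite normcM exprMn mulrDr mulrA.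
rewrite nneseriesD; last 2 first.
- by move=> k _ _; rewrite mule_ge0 // lee_fin mulr_ge0 ?sqr_ge0.
- by move=> k _ _; rewrite mule_ge0 // lee_fin.
rewrite !nneseriesZl //.
by rewrite lte_add_pinfty ?lte_mul_pinfty ?lee_fin ?mulr_ge0 ?normc_ge0.
Qed.

HB.instance Definition _ :=
  GRing.isSubmodClosed.Build R[i] (nat -> R[i]) square_summable
    square_summable_submod.

Record l2 : Type := L2 {
  l2_seq :> nat -> R[i];
  _ : l2_seq \in square_summable
}.

HB.instance Definition _ := [isSub for l2_seq].
HB.instance Definition _ := [Choice of l2 by <:].
HB.instance Definition _ := [SubChoice_isSubLmodule of l2 by <:].

(* The complex series, which converges absolutely, is summed componentwise. *)
Definition l2dot (x y : l2) : R[i] :=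
  Complex
    (limn (series (fun k => complex.Re (x k * conjc (y k)))))
    (limn (series (fun k => complex.Im (x k * conjc (y k))))).

End L2.

Section Topology.
Variables (R : realType) (d : nat) (rho : \bar R).
Local Notation O := (conv_series d rho).

Definition seminorm (r : R) (f : ncseries R d) : \bar R :=
  ereal_sup [set z | exists n (X : 'I_d -> 'M[R[i]]_n),
    (row_norm (@cdot R n) (mxops X) <= r%:E)%E /\
    z = opnorm (@cdot R n) (nceval (@cdot R n) f (mxops X))].

(* The locally convex topology generated by the seminorms with 0 < r < rho:
   the basic neighbourhoods of f are the finite intersections of balls. *)
Definition conv_open (U : set O) : Prop :=
  forall f, U f -> exists (s : seq R) (e : R),
    [/\ forall r, r \in s -> 0 < r /\ (r%:E < rho)%E, 0 < e &
      forall g : O,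
        (forall r, r \in s -> (seminorm r (series_of (g - f)%R) < e%:E)%E) -> U g].

Fact conv_openT : conv_open setT.
Proof. by move=> f _; exists [::], 1; split. Qed.

Fact conv_openI : setI_closed conv_open.
Proof.
move=> U V oU oV f [/oU[s [e [sr e0 sU]]] /oV[t [e' [tr e'0 tV]]]].
exists (s ++ t), (Order.min e e'); split; first 1 last.
- by rewrite lt_min e0.
- move=> g st; split.
    apply: sU => r rs; apply: lt_le_trans (st r _) _; first by rewrite mem_cat rs.
    by rewrite lee_fin ge_min lexx.
  apply: tV => r rt; apply: lt_le_trans (st r _) _.
    by rewrite mem_cat rt orbT.
  by rewrite lee_fin ge_min lexx orbT.
by move=> r; rewrite mem_cat => /orP[/sr|/tr].
Qed.

Fact conv_open_bigU (I : Type) (F : I -> set O) :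
  (forall i, conv_open (F i)) -> conv_open (\bigcup_i F i).
Proof.
move=> oF f [i _ /oF[s [e [sr e0 sF]]]]; exists s, e; split=> // g /sF Fg.
by exists i.
Qed.

HB.instance Definition _ := isOpenTopological.Build O
  conv_openT conv_openI conv_open_bigU.

End Topology.

Section Ideals.
Variables (R : realType) (d : nat) (rho : \bar R).
Local Notation O := (conv_series d rho).

Definition right_ideal (J : set O) : Prop :=
  [/\ J 0, forall f g, J f -> J g -> J (f + g) & forall f h, J f -> J (f * h)].

Definition finitely_generated (J : set O) : Prop :=
  exists (m : nat) (g : 'I_m -> O),
    J = [set f | exists h : 'I_m -> O, f = \sum_(k < m) g k * h k].

(* A pair (X, y) at a finite level n, or at the level aleph_0. *)
Inductive point : Type :=
| MxPoint (n : nat) of 'I_d -> 'M[R[i]]_n & 'cV[R[i]]_n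
| OpPoint of 'I_d -> l2 R -> l2 R & l2 R.

Definition admissible (p : point) : Prop :=
  match p with
  | MxPoint n X y =>
      (row_norm (@cdot R n) (mxops X) < rho)%E /\ y <> 0
  | OpPoint X y =>
      [/\ forall j, bounded_op (@l2dot R) (X j),
          (row_norm (@l2dot R) X < rho)%E & y <> 0]
  end.

Definition perp_at (f : O) (p : point) : Prop :=
  match p with
  | MxPoint n X y =>
      perp_range (@cdot R n) (nceval (@cdot R n) (series_of f) (mxops X)) y
  | OpPoint X y =>
      perp_range (@l2dot R) (nceval (@l2dot R) (series_of f) X) y
  end.

Definition dvariety (S : set O) : set point :=
  [set p | admissible p /\ forall f, S f -> perp_at f p].

Definition dideal (Z : set point) : set O :=
  [set f | forall p, Z p -> perp_at f p].

End Ideals.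

(* Main.v *)
(* Proof idea.  Write J = g_1 O + ... + g_m O, and let M_r be the closure of J in
   the Fock space of radius r, the weighted l^2 space of coefficients on which the
   letters act from the left as a row of norm r.

   If f is not in M_r for some r < R, then f(L) for this left shift L maps the
   vacuum to f, while the component y of f orthogonal to M_r is orthogonal to
   Ran h(L) for all h in J: so (L, y) separates f from J.  Moreover truncating L
   gives matrix tuples on which the seminorm rho_r dominates the Fock norm, so M_r
   also contains the closure of J.  It remains to show that f in M_r for all r < R
   implies f in J.

   The letters act from the right as multiples of isometries with orthogonal
   ranges, so M_r is generated by the finite dimensional wandering subspace, the
   orthogonal complement in M_r of the closure M0_r of the sum of the J z_j.  It has a basis
   theta congruent mod M0_r to some of the g_k, and f = theta u with u in the
   same Fock space.  Approximating theta by elements of J and inverting 1 - U for a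
   small matrix U (at the cost of shrinking r) gives theta = g B, hence f = g h
   with h convergent on a slightly smaller ball.

   To glue the solutions h for different r one approximates syzygies of g on a ball
   by syzygies on a larger one.  The number n(r) of generators theta increases with
   r and is at most m, so it is constant near R; there g = g B A and the matrix
   1 - B A is a projection onto the syzygies, also on smaller balls.  Applying it
   to polynomials gives the approximation. *)

From mathcomp Require Import all_boot all_order all_algebra.
From mathcomp Require Import complex.
From mathcomp Require Import all_classical all_reals all_analysis.
From mathcomp Require Import ring lra.
Require Import Defs.

Set Implicit Arguments.
Unset Strict Implicit.
Unset Printing Implicit Defensive.

Import Order.TTheory GRing.Theory Num.Theory.
Import numFieldNormedType.Exports.
Import ComplexField ComplexField.Normc.

Local Open Scope classical_set_scope.
Local Open Scope complex_scope.
Local Open Scope ring_scope.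

(** Two norms alternate. The Fock norm provides projections and the Wold decomposition but is not
    submultiplicative; the l^1 sum over degrees of the l^2 norms of the homogeneous parts is, and it
    serves for matrices of series. Passing from the Fock norm to the l^1 norm sums a geometric
    series, and this is what costs radius.

    The algebra is done coefficient by coefficient: products, the iterated division by the theta and
    (1 - U)^-1 are determined degreewise as formal series, and convergence enters only through
    bounds on partial sums.

    1 - B A projects onto the syzygies of g because g B has no nonzero syzygy. For this, B is built
    with a prescribed constant term: it selects the g_k that form a basis modulo M0_r. The constant
    term of a syzygy of g B is then a linear relation modulo M0_r, hence 0; stripping the last
    letter gives another syzygy, and induction on words kills every coefficient. Only independence
    on the ball where the syzygy lives is used, so the argument also covers balls smaller than that
    of B. *)

Local Notation Re := complex.Re.
Local Notation Im := complex.Im.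
Local Notation "x ^*" := (conjc x) : ring_scope.

(** * Hilbert spaces *)

Section ComplexFacts.
Variable R : realType.
Implicit Types x y : R[i].

Lemma normcE x : normc x ^+ 2 = Re x ^+ 2 + Im x ^+ 2.
Proof. by case: x => a b /=; rewrite sqr_sqrtr // addr_ge0 ?sqr_ge0. Qed.

Lemma mulcJ x : x * x^* = (normc x ^+ 2)%:C.
Proof. by rewrite normcE; case: x => a b; simpc; congr Complex; ring. Qed.

Lemma normcJ x : normc x^* = normc x.
Proof. by case: x => a b /=; rewrite sqrrN. Qed.

Lemma normc_real (a : R) : normc a%:C = `|a|.
Proof. by rewrite /= expr0n addr0 sqrtr_sqr. Qed.

Lemma normc_Re x : `|Re x| <= normc x.
Proof.
rewrite -(@ler_pXn2r _ 2) ?nnegrE ?normc_ge0 // normcE real_normK ?num_real //.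
by rewrite lerDl sqr_ge0.
Qed.

Lemma normc_Im x : `|Im x| <= normc x.
Proof.
rewrite -(@ler_pXn2r _ 2) ?nnegrE ?normc_ge0 // normcE real_normK ?num_real //.
by rewrite lerDr sqr_ge0.
Qed.

Lemma normc_sum (I : Type) (r : seq I) (P : pred I) (F : I -> R[i]) :
  normc (\sum_(i <- r | P i) F i) <= \sum_(i <- r | P i) normc (F i).
Proof.
elim/big_rec2: _ => [|i a b _ ab]; first by rewrite normc0.
by apply: le_trans (@le_normcD R _ _) _; rewrite lerD2l.
Qed.

Lemma conjc_div x (a : R) : (x / a%:C)^* = x^* / a%:C.
Proof. by rewrite -[a in RHS]/(Re a%:C) -fmorphV; case: x => b c; simpc. Qed.

Lemma real_complexM (a b : R) : (a * b)%:C = a%:C * b%:C.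
Proof. exact: rmorphM. Qed.

Lemma real_complex_neq0 (a : R) : a != 0 -> a%:C != 0.
Proof. by apply: contra_neq => /(congr1 (@complex.Re R)). Qed.

End ComplexFacts.

Section InnerProduct.
Variables (R : realType) (H : lmodType R[i]) (dot : H -> H -> R[i]).

Record inner_product : Prop := InnerProduct {
  dotPl : forall a x y z, dot (a *: x + y) z = a * dot x z + dot y z;
  dotC : forall x y, dot y x = (dot x y)^*;
  dot_ge0 : forall x, 0 <= Re (dot x x);
  dot_eq0 : forall x, Re (dot x x) = 0 -> x = 0 }.

Hypothesis ip : inner_product.
Local Notation "`[ x ]" := (hnorm dot x).
Implicit Types x y z : H.

Lemma dotDl x y z : dot (x + y) z = dot x z + dot y z.
Proof. by have := dotPl ip 1 x y z; rewrite scale1r mul1r. Qed.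

Lemma dot0l z : dot 0 z = 0.
Proof.
have := dotDl 0 0 z; rewrite addr0 => /eqP.
by rewrite -subr_eq0 opprD addNKr oppr_eq0 => /eqP.
Qed.

Lemma dotZl a x z : dot (a *: x) z = a * dot x z.
Proof. by have := dotPl ip a x 0 z; rewrite addr0 dot0l addr0. Qed.

Lemma dotNl x z : dot (- x) z = - dot x z.
Proof. by rewrite -scaleN1r dotZl mulN1r. Qed.

Lemma dotBl x y z : dot (x - y) z = dot x z - dot y z.
Proof. by rewrite dotDl dotNl. Qed.

Lemma dotDr x y z : dot x (y + z) = dot x y + dot x z.
Proof. by rewrite (dotC ip) dotDl rmorphD /= -!(dotC ip). Qed.

Lemma dotZr a x z : dot x (a *: z) = a^* * dot x z.
Proof. by rewrite (dotC ip) dotZl rmorphM /= -(dotC ip). Qed.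

Lemma dot0r x : dot x 0 = 0.
Proof. by rewrite (dotC ip) dot0l raddf0. Qed.

Lemma dotNr x z : dot x (- z) = - dot x z.
Proof. by rewrite (dotC ip) dotNl rmorphN /= -(dotC ip). Qed.

Lemma dotBr x y z : dot x (y - z) = dot x y - dot x z.
Proof. by rewrite dotDr dotNr. Qed.

Lemma dot_suml I (r : seq I) (P : pred I) (F : I -> H) z :
  dot (\sum_(i <- r | P i) F i) z = \sum_(i <- r | P i) dot (F i) z.
Proof.
by elim/big_rec2: _ => [|i a x _ <-]; rewrite ?dot0l ?dotDl.
Qed.

Lemma dot_sumr I (r : seq I) (P : pred I) (F : I -> H) z :
  dot z (\sum_(i <- r | P i) F i) = \sum_(i <- r | P i) dot z (F i).
Proof.
by elim/big_rec2: _ => [|i a x _ <-]; rewrite ?dot0r ?dotDr.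
Qed.

Lemma hnorm_ge0 x : 0 <= `[x].
Proof. exact: sqrtr_ge0. Qed.

Lemma hnorm_sqr x : `[x] ^+ 2 = Re (dot x x).
Proof. by rewrite sqr_sqrtr ?(dot_ge0 ip). Qed.

Lemma dotxx x : dot x x = (`[x] ^+ 2)%:C.
Proof.
rewrite hnorm_sqr; have := dotC ip x x; case: (dot x x) => a b [] b0.
by congr Complex => /=; lra.
Qed.

Lemma hnorm0 : `[0] = 0.
Proof. by rewrite /hnorm dot0l sqrtr0. Qed.

Lemma hnorm_eq0 x : `[x] = 0 -> x = 0.
Proof. by move=> x0; apply: (dot_eq0 ip); rewrite -hnorm_sqr x0 expr0n. Qed.

Lemma hnorm_gt0 x : x <> 0 -> 0 < `[x].
Proof.
by move=> x0; rewrite lt_neqAle hnorm_ge0 andbT eq_sym; apply/eqP => /hnorm_eq0.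
Qed.

Lemma hnorm_sqrD x y :
  `[x + y] ^+ 2 = `[x] ^+ 2 + `[y] ^+ 2 + 2 * Re (dot x y).
Proof.
rewrite !hnorm_sqr dotDl !dotDr (dotC ip x y).
by case: (dot x x) (dot x y) (dot y y) => a b [c e] [f g] /=; ring.
Qed.

Lemma hnorm_pythagoras x y : dot x y = 0 ->
  `[x + y] ^+ 2 = `[x] ^+ 2 + `[y] ^+ 2.
Proof. by move=> xy; rewrite hnorm_sqrD xy mulr0 addr0. Qed.

Lemma hnormZ a x : `[a *: x] = normc a * `[x].
Proof.
apply/eqP; rewrite -(@eqrXn2 _ 2) ?mulr_ge0 ?hnorm_ge0 ?normc_ge0 //.
rewrite exprMn !hnorm_sqr dotZl dotZr mulrA mulcJ dotxx.
by apply/eqP; simpc.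
Qed.

Lemma hnormN x : `[- x] = `[x].
Proof. by rewrite -scaleN1r hnormZ normcN normc1 mul1r. Qed.

Lemma hnormBC x y : `[x - y] = `[y - x].
Proof. by rewrite -hnormN opprB. Qed.

Lemma cauchy_schwarz x y : normc (dot x y) <= `[x] * `[y].
Proof.
have [->|y0] := pselect (y = 0); first by rewrite dot0r normc0 hnorm0 mulr0.
have Y : 0 < `[y] ^+ 2 by rewrite exprn_gt0 ?hnorm_gt0.
rewrite -(@ler_pXn2r _ 2) ?nnegrE ?mulr_ge0 ?hnorm_ge0 ?normc_ge0 // exprMn.
(* The component of [x] orthogonal to [y], scaled by the squared norm of [y] to avoid dividing. *)
pose a := dot x y; pose z := (`[y] ^+ 2)%:C *: x - a *: y.
have zy : dot z y = 0 by rewrite dotBl !dotZl dotxx mulrC subrr.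
have zx : dot z x = (`[y] ^+ 2 * `[x] ^+ 2 - normc a ^+ 2)%:C.
  by rewrite dotBl !dotZl (dotC ip x y) mulcJ dotxx rmorphB [in RHS]rmorphM.
have : 0 <= `[z] ^+ 2 by rewrite sqr_ge0.
rewrite hnorm_sqr {2}/z dotBr !dotZr zy mulr0 subr0 zx.
simpc; rewrite /= ?subr0 ?mulr0 ?mul0r ?subr0.
by rewrite pmulr_rge0 // subr_ge0 mulrC.
Qed.

Lemma hnormD x y : `[x + y] <= `[x] + `[y].
Proof.
rewrite -(@ler_pXn2r _ 2) ?nnegrE ?addr_ge0 ?hnorm_ge0 // hnorm_sqrD.
have := le_trans (ler_norm _) (le_trans (normc_Re (dot x y)) (cauchy_schwarz x y)).
by move=> ?; rewrite sqrrD; lra.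
Qed.

Lemma hnorm_sum I (r : seq I) (P : pred I) (F : I -> H) :
  `[\sum_(i <- r | P i) F i] <= \sum_(i <- r | P i) `[F i].
Proof.
elim/big_rec2: _ => [|i a b _ ab]; first by rewrite hnorm0.
by apply: le_trans (hnormD _ _) _; rewrite lerD2l.
Qed.

Lemma parallelogram x y :
  `[x + y] ^+ 2 + `[x - y] ^+ 2 = 2 * (`[x] ^+ 2 + `[y] ^+ 2).
Proof. by rewrite !hnorm_sqrD hnormN dotNr raddfN /=; ring. Qed.

End InnerProduct.

Section Hilbert.
Variables (R : realType) (H : lmodType R[i]) (dot : H -> H -> R[i]).
Local Notation "`[ x ]" := (hnorm dot x).
Implicit Types (x y z : H) (u : nat -> H) (M : set H).

Definition hcauchy u := forall e : R, 0 < e ->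
  exists N, forall i j, (N <= i)%N -> (N <= j)%N -> `[u i - u j] < e.

Definition hcvg u x := forall e : R, 0 < e ->
  exists N, forall i, (N <= i)%N -> `[u i - x] < e.

Record hilbert : Prop := Hilbert {
  hilbert_ip : inner_product dot;
  hilbert_complete : forall u, hcauchy u -> exists x, hcvg u x }.

(** Closure by approximation in [hnorm], because an [lmodType] with a form [dot] carries no topology
    of its own. *)
Definition hclosure M : set H :=
  [set x | forall e : R, 0 < e -> exists2 m, M m & `[x - m] < e].

Definition subspace M := M 0 /\ forall a x y, M x -> M y -> M (a *: x + y).

Lemma subspaceZ M a x : subspace M -> M x -> M (a *: x).
Proof. by move=> [M0 ML] Mx; rewrite -[_ *: _]addr0; apply: ML. Qed.

Lemma subspaceD M x y : subspace M -> M x -> M y -> M (x + y).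
Proof. by move=> [M0 ML] Mx My; rewrite -[x]scale1r; apply: ML. Qed.

Lemma subspaceB M x y : subspace M -> M x -> M y -> M (x - y).
Proof. by move=> [M0 ML] Mx My; rewrite addrC -scaleN1r; apply: ML. Qed.

Lemma subspace_sum M I (r : seq I) (P : pred I) (F : I -> H) : subspace M ->
  (forall i, P i -> M (F i)) -> M (\sum_(i <- r | P i) F i).
Proof.
move=> sM MF; elim/big_ind: _ => //; first by case: sM.
by move=> x y Mx My; apply: subspaceD.
Qed.

Section Theory.
Hypothesis hH : hilbert.
Let ip := hilbert_ip hH.

Lemma hclosure_sub M : M `<=` hclosure M.
Proof. by move=> x Mx e e0; exists x => //; rewrite subrr (hnorm0 ip). Qed.

Lemma hclosure_subspace M : subspace M -> subspace (hclosure M).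
Proof.
move=> sM; split=> [|a x y Mx My e e0]; first by apply: hclosure_sub; case: sM.
have a0 : 0 < normc a + 1 by rewrite ltr_wpDl ?normc_ge0.
have [m Mm xm] := Mx (e / 2 / (normc a + 1)) ltac:(by rewrite !divr_gt0).
have [n Mn yn] := My (e / 2) ltac:(by rewrite divr_gt0).
exists (a *: m + n); first by case: sM => _; apply.
have -> : a *: x + y - (a *: m + n) = a *: (x - m) + (y - n).
  by rewrite scalerBr opprD addrACA.
apply: le_lt_trans (hnormD ip _ _) _; rewrite (hnormZ ip).
move: xm; rewrite ltr_pdivlMr // => xm.
have := hnorm_ge0 dot (x - m); nra.
Qed.

Lemma hclosureK M : hclosure (hclosure M) `<=` hclosure M.
Proof.
move=> x Mx e e0; have e2 : 0 < e / 2 by rewrite divr_gt0.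
have [y My xy] := Mx _ e2; have [z Mz yz] := My _ e2; exists z => //.
rewrite -(subrKA y); apply: le_lt_trans (hnormD ip _ _) _; lra.
Qed.

Lemma hcvg_closure M u x : hcvg u x -> (forall i, M (u i)) -> hclosure M x.
Proof.
move=> ux Mu e e0; have [N uN] := ux e e0.
by exists (u N) => //; rewrite (hnormBC ip); apply: uN.
Qed.

(** A minimising sequence for the distance is Cauchy by the parallelogram law, since midpoints stay
    in [M]. Its limit is the foot of the perpendicular because no multiple of [m] brings it closer
    to [x]. *)
Lemma projection M x : subspace M -> hclosure M `<=` M ->
  exists2 p, M p & forall m, M m -> dot (x - p) m = 0.
Proof.
move=> sM cM; pose D := [set `[x - m] ^+ 2 | m in M].
have lbD : lbound D 0 by move=> _ [m _ <-]; apply: sqr_ge0.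
have hD : has_inf D.
  by split; [exists (`[x - 0] ^+ 2); exists 0 => //; case: sM|exists 0].
set dl := inf D.
have Dlb m : M m -> dl <= `[x - m] ^+ 2.
  by move=> Mm; apply: (ge_inf (proj2 hD)); exists m.
have /choice[u uP] : forall i : nat, exists m, M m /\ `[x - m] ^+ 2 < dl + i.+1%:R^-1.
  move=> i; have i0 : 0 < i.+1%:R^-1 :> R by rewrite invr_gt0.
  by have [_ [m Mm <-] ?] := inf_adherent i0 hD; exists m.
have dist i j : `[u i - u j] ^+ 2 <= 2 * (i.+1%:R^-1 + j.+1%:R^-1).
  have [[Mi ui] [Mj uj]] := (uP i, uP j).
  have := parallelogram ip (x - u i) (x - u j).
  have -> : x - u i - (x - u j) = u j - u i by rewrite opprB addrC subrKA.
  rewrite (hnormBC ip (u j)).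
  have Mm : M (2^-1 *: (u i + u j)) by apply: subspaceZ; last exact: subspaceD.
  have -> : x - u i + (x - u j) = 2 *: (x - 2^-1 *: (u i + u j)).
    rewrite scalerBr scalerA divff ?pnatr_eq0 // scale1r scaler_nat mulr2n opprD.
    by rewrite addrACA.
  have := Dlb _ Mm; rewrite (hnormZ ip) exprMn.
  have -> : normc (2 : R[i]) = 2.
    by rewrite -(rmorph_nat (real_complex R)) normc_real ger0_norm.
  by move: (i.+1%:R^-1) (j.+1%:R^-1) ui uj => a b; lra.
have small (e : R) : 0 < e -> exists N, forall i, (N <= i)%N -> i.+1%:R^-1 < e :> R.
  move=> e0; exists (Num.bound e^-1) => i iN.
  rewrite invf_plt ?posrE ?ltr0n //; apply: lt_le_trans (archi_boundP _) _.
    by rewrite invr_ge0 ltW.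
  by rewrite ler_nat; apply: leqW.
have [|p up] := hilbert_complete hH (u := u).
  move=> e e0; have [N NP] := small (e ^+ 2 / 4) ltac:(by rewrite divr_gt0 ?exprn_gt0).
  exists N => i j iN jN; rewrite -(@ltr_pXn2r _ 2) ?nnegrE ?hnorm_ge0 ?(ltW e0) //.
  move: (dist i j) (NP i iN) (NP j jN).
  by move: (i.+1%:R^-1) (j.+1%:R^-1) => a b; lra.
have Mp : M p by apply: cM; apply: hcvg_closure up _ => i; case: (uP i).
exists p => // m Mm; set z := x - p.
have zmin : `[z] ^+ 2 <= dl.
  apply/ler_addgt0Pl => e e0; pose K := 2 * `[z] + 3.
  have z0 := hnorm_ge0 dot z; have K0 : 0 < K by rewrite /K; lra.
  have [N1 NP1] := small (e / 2) ltac:(by rewrite divr_gt0).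
  have [N2 NP2] := up (Order.min 1 (e / 2 / K)) ltac:(by rewrite lt_min ltr01 !divr_gt0).
  have [_] := uP (maxn N1 N2); have := NP1 _ (leq_maxl N1 N2).
  have := NP2 _ (leq_maxr N1 N2); set w := u _.
  move: ((maxn N1 N2).+1%:R^-1) => b.
  rewrite lt_min => /andP[w1 we] bN wd; move: we; rewrite ltr_pdivlMr // => we.
  have : `[z] <= `[x - w] + `[w - p].
    by rewrite /z -(subrKA w); apply: hnormD.
  have := hnorm_ge0 dot (w - p); have := hnorm_ge0 dot (x - w).
  set A := `[x - w] in wd *; set B := `[w - p] in w1 we * => A0 B0 zAB.
  have : A <= `[z] + B.
    rewrite /A /z /B -(subrKA p) (hnormBC ip w); exact: hnormD.
  move=> AzB; have : `[z] ^+ 2 <= (A + B) ^+ 2 by rewrite lerXn2r ?nnegrE ?addr_ge0.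
  have : B * (2 * A + B) <= B * K by apply: ler_wpM2l => //; rewrite /K; lra.
  rewrite sqrrD; lra.
have zm t : `[z] ^+ 2 <= `[z + t *: m] ^+ 2.
  apply: le_trans zmin _; rewrite -[z + _](_ : x - (p - t *: m) = _).
    by apply: Dlb; apply: (subspaceB sM Mp); apply: (subspaceZ _ sM Mm).
  by rewrite opprB addrA addrAC.
(* Moving [z] by [- T a m] changes the squared norm by [- T (1 + T) |a|^2], so minimality forces
   [a = 0]. The optimal [T] would be [1 / |m|^2]; the added 1 also covers [m = 0]. *)
set a := dot z m; set T := (`[m] ^+ 2 + 1)^-1.
have m0 := sqr_ge0 `[m]; have T0 : 0 < T by rewrite invr_gt0; lra.
have T1 : T * `[m] ^+ 2 + T = 1.
  by rewrite -[X in _ + X]mulr1 -mulrDr mulVf //; apply: lt0r_neq0; lra.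
have := zm (- T%:C * a); rewrite (hnorm_sqrD ip) (hnormZ ip) (dotZr ip).
rewrite rmorphM rmorphN /= -mulrA [a^* * _]mulrC mulcJ normcM normcN normc_real.
rewrite (ger0_norm (ltW T0)) -/a.
have -> : Re (- T%:C^* * (normc a ^+ 2)%:C) = - (T * normc a ^+ 2).
  by simpc; rewrite /= ?mul0r ?oppr0 ?subr0 ?addr0 ?mulNr.
have := sqr_ge0 (normc a); rewrite !exprMn; set A := normc a ^+ 2 => A0.
have TA : T ^+ 2 * A * `[m] ^+ 2 = T * A * (1 - T).
  have -> : 1 - T = T * `[m] ^+ 2 by lra.
  by ring.
move=> zA; have : A * (T * (1 + T)) <= 0 by move: zA; rewrite TA; lra.
rewrite pmulr_lle0 ?mulr_gt0 //; last lra.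
move=> Ale; apply: eq0_normc; apply/eqP.
by rewrite -sqrf_eq0 eq_le Ale A0.
Qed.


Lemma riesz (phi : H -> R[i]) (K : R) :
  (forall a x y, phi (a *: x + y) = a * phi x + phi y) ->
  (forall x, normc (phi x) <= K * `[x]) ->
  exists y, forall x, phi x = dot x y.
Proof.
move=> lphi bphi; have phi0 : phi 0 = 0.
  have := lphi 1 0 0; rewrite scale1r mul1r addr0 => /eqP.
  by rewrite -subr_eq0 opprD addNKr oppr_eq0 => /eqP.
have phiB x y : phi (x - y) = phi x - phi y.
  by rewrite addrC -scaleN1r lphi mulN1r addrC.
have phiZ a x : phi (a *: x) = a * phi x by have := lphi a x 0; rewrite phi0 !addr0.
have [all0|/existsNP[x0 px0]] := pselect (forall x, phi x = 0).
  by exists 0 => x; rewrite all0 (dot0r ip).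
pose M : set H := [set x | phi x = 0].
have sM : subspace M.
  by split=> // a x y /= px py; rewrite /M /= lphi px py mulr0 addr0.
have cM : hclosure M `<=` M.
  move=> x Mx; apply: eq0_normc; apply/eqP; rewrite eq_le normc_ge0 andbT.
  apply/ler_addgt0Pl => e e0; rewrite addr0.
  have K0 : 0 < `|K| + 1 by rewrite ltr_wpDl.
  have [m /= Mm xm] := Mx (e / (`|K| + 1)) ltac:(by rewrite divr_gt0).
  have -> : phi x = phi (x - m) by rewrite phiB Mm subr0.
  apply: le_trans (bphi _) _; move: xm; rewrite ltr_pdivlMr // => xm.
  have := hnorm_ge0 dot (x - m); have := ler_norm K; nra.
have [p Mp pP] := projection x0 sM cM; set z := x0 - p in pP.
have pz : phi z = phi x0 by rewrite phiB Mp subr0.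
have zn : `[z] ^+ 2 != 0.
  apply/eqP => /eqP; rewrite sqrf_eq0 => /eqP /(hnorm_eq0 ip) z0.
  by apply: px0; rewrite -pz z0.
exists ((phi z)^* / (`[z] ^+ 2)%:C *: z) => x.
(* This vector lies in the kernel of [phi], hence is orthogonal to [z]; solving for [phi x] produces
   the representing multiple of [z]. *)
have /pP : M (phi z *: x - phi x *: z).
  by rewrite /M /= phiB !phiZ mulrC subrr.
rewrite (dotC ip) => /eqP; rewrite conjc_eq0 (dotBl ip) !(dotZl ip) (dotxx ip) subr_eq0 => /eqP E.
rewrite (dotZr ip) conjc_div conjcK mulrAC E mulfK //.
by rewrite -(rmorph0 (real_complex R)) (inj_eq (@complexI R)).
Qed.

Lemma adjoint_exists (T : H -> H) (K : R) : linear T ->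
  (forall x, `[T x] <= K * `[x]) ->
  exists S, forall x y, dot (T x) y = dot x (S y).
Proof.
move=> lT bT; suff /choice[S SP] y : exists z, forall x, dot (T x) y = dot x z.
  by exists S => x y; apply: SP.
apply: (@riesz _ (K * `[y])) => [a x z|x]; first by rewrite lT (dotPl ip).
apply: le_trans (cauchy_schwarz ip _ _) _; rewrite mulrAC.
by apply: ler_wpM2r (bT x); apply: hnorm_ge0.
Qed.

(** Adjoints are unique, so the choice operator in [adjoint] returns whichever one is exhibited.
    This makes [row_norm] computable for concrete tuples. *)
Lemma adjointP (T S : H -> H) : (forall x y, dot (T x) y = dot x (S y)) ->
  adjoint dot T = S.
Proof.
move=> TS; rewrite /adjoint; case: xgetP => [S' _ S'P|/(_ S)[]//].
apply/funext => y; apply/eqP; rewrite -subr_eq0; apply/eqP/(hnorm_eq0 ip).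
apply/eqP; rewrite -sqrf_eq0 (hnorm_sqr ip) (dotBr ip).
by rewrite -S'P -TS subrr.
Qed.

Lemma linear_zero (T : H -> H) : linear T -> T 0 = 0.
Proof.
move=> lT; have := lT 1 0 0; rewrite !scale1r addr0 => /eqP.
by rewrite -subr_eq0 opprD addNKr oppr_eq0 => /eqP.
Qed.

Lemma linear_scale (T : H -> H) a x : linear T -> T (a *: x) = a *: T x.
Proof.
move=> lT; have := lT a x 0; rewrite (linear_zero lT) (addr0 (a *: x)) => ->.
by rewrite addr0.
Qed.

Lemma opnorm_bound (T : H -> H) (K : R) : linear T ->
  (opnorm dot T <= K%:E)%E -> forall x, `[T x] <= K * `[x].
Proof.
move=> lT TK x; have [->|/(hnorm_gt0 ip) x0] := pselect (x = 0).
  by rewrite linear_zero // (hnorm0 ip) mulr0.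
have : ((`[T ((`[x]^-1)%:C *: x)])%:E <= K%:E)%E.
  apply: le_trans TK; apply: ereal_sup_ubound; exists ((`[x]^-1)%:C *: x) => //=.
  by rewrite (hnormZ ip) normc_real ger0_norm ?invr_ge0 ?(ltW x0) // mulVf ?gt_eqF.
rewrite lee_fin linear_scale // (hnormZ ip) normc_real ger0_norm ?invr_ge0 ?(ltW x0) //.
by rewrite mulrC ler_pdivrMr.
Qed.

Lemma bound_opnorm (T : H -> H) (K : R) : 0 <= K ->
  (forall x, `[T x] <= K * `[x]) -> (opnorm dot T <= K%:E)%E.
Proof.
move=> K0 TK; apply: ge_ereal_sup => _ [x /= x1 <-]; rewrite lee_fin.
by apply: le_trans (TK x) _; rewrite -[leRHS]mulr1 ler_wpM2l.
Qed.

Lemma opnorm_ge0 (T : H -> H) : (0 <= opnorm dot T)%E.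
Proof.
apply: (@le_trans _ _ (`[T 0])%:E); first by rewrite lee_fin hnorm_ge0.
by apply: ereal_sup_ubound; exists 0 => //=; rewrite (hnorm0 ip).
Qed.

Lemma bounded_opP (T : H -> H) : bounded_op dot T <->
  linear T /\ exists K : R, forall x, `[T x] <= K * `[x].
Proof.
split=> -[lT bT]; split=> //.
  have := opnorm_ge0 T; move: bT; case E : (opnorm dot T) => [K| |] // _ _.
  by exists K; apply: opnorm_bound => //; rewrite E.
have [K TK] := bT; apply: (@le_lt_trans _ _ `|K|%:E); last exact: ltry.
apply: bound_opnorm => // x; apply: le_trans (TK x) _.
by apply: ler_wpM2r; [exact: hnorm_ge0|exact: ler_norm].
Qed.

End Theory.
End Hilbert.

(** * Coordinatewise limits and the completeness of C^n and l^2 *)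

Section Coordinates.
Variable R : realType.

(** Real and imaginary parts are kept separate to match the componentwise limits that define
    [l2dot]. *)
Definition ccvg (c : nat -> R[i]) (x : R[i]) :=
  (fun j => Re (c j)) @ \oo --> Re x /\ (fun j => Im (c j)) @ \oo --> Im x.

Lemma real_cauchy_cvg (a : nat -> R) :
  (forall e, 0 < e -> exists N, forall i j, (N <= i)%N -> (N <= j)%N -> `|a i - a j| < e) ->
  cvgn a.
Proof.
move=> Ca; apply/cauchy_cvgP/cauchy_exP => e e0.
have [N aN] := Ca e e0; exists (a N); exists N => // j /= Nj.
by apply: aN.
Qed.

Lemma complex_cauchy_cvg (c : nat -> R[i]) :
  (forall e : R, 0 < e -> exists N, forall i j, (N <= i)%N -> (N <= j)%N ->
    normc (c i - c j) < e) ->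
  exists x, ccvg c x.
Proof.
move=> Cc; exists (Complex (limn (fun j => Re (c j))) (limn (fun j => Im (c j)))).
split; apply: real_cauchy_cvg => e e0; have [N cN] := Cc e e0; exists N => i j Ni Nj.
  by apply: le_lt_trans (cN i j Ni Nj); rewrite -raddfB /=; exact: normc_Re.
by apply: le_lt_trans (cN i j Ni Nj); rewrite -raddfB /=; exact: normc_Im.
Qed.

Lemma ccvg_sqr_dist (a : R[i]) (c : nat -> R[i]) x : ccvg c x ->
  (fun j => normc (a - c j) ^+ 2) @ \oo --> normc (a - x) ^+ 2.
Proof.
move=> [cR cI]; rewrite normcE.
under eq_fun do rewrite normcE !raddfB /= !expr2.
rewrite !raddfB /= !expr2.
by apply: cvgD; apply: cvgM; apply: cvgB => //; apply: cvg_cst.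
Qed.

(** The step shared by both completeness proofs: a Cauchy estimate on finitely many coordinates
    survives the limit in the second index. *)
Lemma sum_sqr_dist_limit (I : eqType) (r : seq I) (u : nat -> I -> R[i]) (x : I -> R[i]) N C i :
  (forall k, ccvg (u^~ k) (x k)) ->
  (forall j, (N <= j)%N -> \sum_(k <- r) normc (u i k - u j k) ^+ 2 <= C) ->
  \sum_(k <- r) normc (u i k - x k) ^+ 2 <= C.
Proof.
move=> ux uC.
have cv : (fun j => \sum_(k <- r) normc (u i k - u j k) ^+ 2) @ \oo -->
    \sum_(k <- r) normc (u i k - x k) ^+ 2.
  elim: (r) => [|k s IH].
    by under eq_fun do rewrite big_nil; rewrite big_nil; apply: cvg_cst.
  under eq_fun do rewrite big_cons; rewrite big_cons.
  by apply: cvgD IH; apply: ccvg_sqr_dist.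
apply: ler_cvg_to cv (@cvg_cst _ C _ _ _) _.
by exists N => // j /=; exact: uC.
Qed.

Lemma ccvg_unique (c : nat -> R[i]) a b : ccvg c a -> ccvg c b -> a = b.
Proof.
case: a b => [a1 a2] [b1 b2] [/= aR aI] [/= bR bI].
by rewrite (cvg_unique _ aR bR) // (cvg_unique _ aI bI).
Qed.

Lemma ccvgD (c e : nat -> R[i]) a b : ccvg c a -> ccvg e b -> ccvg (c \+ e) (a + b).
Proof.
move=> [aR aI] [bR bI]; split; rewrite raddfD /=; under eq_fun do rewrite raddfD /=.
  exact: cvgD.
exact: cvgD.
Qed.

Lemma ccvgZ z (c : nat -> R[i]) a : ccvg c a -> ccvg (fun j => z * c j) (z * a).
Proof.
have reM (v w : R[i]) : Re (v * w) = Re v * Re w - Im v * Im w by case: v; case: w.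
have imM (v w : R[i]) : Im (v * w) = Re v * Im w + Im v * Re w by case: v; case: w.
move=> [aR aI]; split; rewrite ?reM ?imM; under eq_fun do rewrite ?reM ?imM.
  by apply: cvgB; apply: cvgM => //; apply: cvg_cst.
by apply: cvgD; apply: cvgM => //; apply: cvg_cst.
Qed.

Lemma ccvgJ (c : nat -> R[i]) a : ccvg c a -> ccvg (fun j => (c j)^*) a^*.
Proof.
have reJ (v : R[i]) : Re v^* = Re v by case: v.
have imJ (v : R[i]) : Im v^* = - Im v by case: v.
move=> [aR aI]; split; [rewrite reJ|rewrite imJ].
  by under eq_fun do rewrite reJ.
by under eq_fun do rewrite imJ; exact: cvgN.
Qed.

End Coordinates.

Section FiniteDimension.
Variables (R : realType) (n : nat).
Local Notation V := 'cV[R[i]]_n.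

Lemma cdot_self (x : V) : cdot x x = (\sum_i normc (x i ord0) ^+ 2)%:C.
Proof. by rewrite rmorph_sum; apply: eq_bigr => i _; rewrite mulcJ. Qed.

Lemma hnorm_cdot (x : V) : hnorm (@cdot R n) x ^+ 2 = \sum_i normc (x i ord0) ^+ 2.
Proof.
rewrite sqr_sqrtr cdot_self //=; apply: sumr_ge0 => i _; exact: sqr_ge0.
Qed.

Lemma cdot_ip : inner_product (@cdot R n).
Proof.
split.
- move=> a x y z; rewrite /cdot mulr_sumr -big_split /=; apply: eq_bigr => i _.
  by rewrite !mxE mulrDl mulrA.
- move=> x y; rewrite /cdot rmorph_sum; apply: eq_bigr => i _ /=.
  by rewrite rmorphM /= conjcK mulrC.
- by move=> x; rewrite cdot_self /= sumr_ge0 // => i _; exact: sqr_ge0.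
move=> x; rewrite cdot_self /= => /eqP; rewrite psumr_eq0; last by move=> i _; exact: sqr_ge0.
move=> /allP x0; apply/colP => i; rewrite mxE; apply: eq0_normc; apply/eqP.
by rewrite -sqrf_eq0; apply: x0; rewrite mem_index_enum.
Qed.

Lemma cdot_coord (x : V) i : normc (x i ord0) <= hnorm (@cdot R n) x.
Proof.
rewrite -(@ler_pXn2r _ 2) ?nnegrE ?normc_ge0 ?hnorm_ge0 // hnorm_cdot (bigD1 i) //= lerDl.
by apply: sumr_ge0 => j _; exact: sqr_ge0.
Qed.

Lemma cdot_hilbert : hilbert (@cdot R n).
Proof.
split=> [|u Cu]; first exact: cdot_ip.
have /choice[x ux] : forall i : 'I_n, exists x, ccvg (fun j => u j i ord0) x.
  move=> i; apply: complex_cauchy_cvg => e /Cu[N uN]; exists N => k l Nk Nl.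
  apply: le_lt_trans (uN k l Nk Nl); apply: le_trans (cdot_coord _ i).
  by rewrite !mxE.
exists (\col_i x i) => e e0; have [N uN] := Cu (e / 2) ltac:(by rewrite divr_gt0).
exists N => i Ni; apply: (@le_lt_trans _ _ (e / 2)); last by lra.
have e2 : 0 <= e / 2 by lra.
rewrite -(@ler_pXn2r _ 2) ?nnegrE ?hnorm_ge0 // hnorm_cdot.
under eq_bigr do rewrite !mxE.
apply: (@sum_sqr_dist_limit _ _ _ (fun j k => u j k ord0) x N) => // j Nj.
have := ltW (uN i j Ni Nj); rewrite -(@ler_pXn2r _ 2) ?nnegrE ?hnorm_ge0 // hnorm_cdot.
by under eq_bigr do rewrite !mxE.
Qed.

End FiniteDimension.

Section SequenceSpace.
Variable R : realType.
Implicit Types x y z : l2 R.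

Definition sqs (x : nat -> R[i]) N : R := \sum_(0 <= k < N) normc (x k) ^+ 2.

Lemma sqs_nondecreasing (x : nat -> R[i]) : nondecreasing_seq (sqs x).
Proof.
by apply/nondecreasing_seqP => n; rewrite /sqs big_nat_recr //= lerDl sqr_ge0.
Qed.

Lemma l2_cvg x : cvgn (sqs x).
Proof. by apply: nnseries_is_cvg => [k|]; [exact: sqr_ge0|exact: (valP x)]. Qed.

Lemma l2_bounded (x : nat -> R[i]) C : (forall N, sqs x N <= C) ->
  x \in @square_summable R.
Proof.
move=> xC; apply: (@le_lt_trans _ _ C%:E); last exact: ltry.
apply: lime_le; first by apply: is_cvg_nneseries => k _ _; rewrite lee_fin sqr_ge0.
by apply: nearW => N /=; rewrite sumEFin lee_fin; exact: xC.
Qed.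

Lemma l2_prod_cvg x y (f : R[i] -> R) : (forall z : R[i], `|f z| <= normc z) ->
  cvgn (series (fun k => f (x k * conjc (y k)))).
Proof.
move=> fz; apply: normed_cvg.
have : cvgn (series (fun k => normc (x k) ^+ 2 + normc (y k) ^+ 2)).
  rewrite (_ : series _ = sqs x \+ sqs y); first exact: is_cvgD (@l2_cvg x) (@l2_cvg y).
  by apply/funext => N; rewrite /series /sqs /= big_split.
apply: series_le_cvg => k; [exact: normr_ge0|by rewrite addr_ge0 ?sqr_ge0|].
apply: le_trans (fz _) _; rewrite normcM normcJ.
have := sqr_ge0 (normc (x k) - normc (y k)).
by have := normc_ge0 (x k); have := normc_ge0 (y k); nra.
Qed.

Lemma l2dot_cvg x y :
  ccvg (series (fun k => x k * conjc (y k))) (l2dot x y).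
Proof.
split=> /=.
  rewrite (_ : (fun j => _) = series (fun k => Re (x k * conjc (y k)))).
    exact: (@l2_prod_cvg x y _ (@normc_Re R)).
  by apply/funext => j; rewrite /series /= raddf_sum.
rewrite (_ : (fun j => _) = series (fun k => Im (x k * conjc (y k)))).
  exact: (@l2_prod_cvg x y _ (@normc_Im R)).
by apply/funext => j; rewrite /series /= raddf_sum.
Qed.

Lemma l2dot_ip_self x : sqs x @ \oo --> Re (l2dot x x).
Proof.
have [+ _] := l2dot_cvg x x; rewrite (_ : (fun j => _) = sqs x) //.
by apply/funext => j; rewrite /series /= raddf_sum; apply: eq_bigr => k _; rewrite mulcJ.
Qed.

Lemma l2_sqs_le x N : sqs x N <= hnorm (@l2dot R) x ^+ 2.
Proof.
have xx := @l2dot_ip_self x.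
have le : sqs x N <= Re (l2dot x x).
  rewrite -(cvg_lim _ xx) //; apply: nondecreasing_cvgn_le (sqs_nondecreasing x) _ _.
  exact: l2_cvg.
rewrite sqr_sqrtr //; apply: le_trans le; apply: sumr_ge0 => k _; exact: sqr_ge0.
Qed.

Lemma l2_coord x k : normc (x k) <= hnorm (@l2dot R) x.
Proof.
rewrite -(@ler_pXn2r _ 2) ?nnegrE ?normc_ge0 ?hnorm_ge0 //.
apply: le_trans (l2_sqs_le x k.+1); rewrite /sqs big_nat_recr //= lerDr.
by apply: sumr_ge0 => j _; exact: sqr_ge0.
Qed.

Lemma l2_norm_le x C : 0 <= C -> (forall N, sqs x N <= C ^+ 2) ->
  hnorm (@l2dot R) x <= C.
Proof.
move=> C0 xC; have xx := @l2dot_ip_self x.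
have le : Re (l2dot x x) <= C ^+ 2.
  apply: ler_cvg_to xx (@cvg_cst _ (C ^+ 2) _ _ _) _; exact: nearW.
rewrite -[C]ger0_norm // -sqrtr_sqr /hnorm; exact: ler_wsqrtr.
Qed.

Lemma l2P x y : (forall k, x k = y k) -> x = y.
Proof. by move=> xy; apply: val_inj; apply/funext => k; exact: xy. Qed.

Lemma l2_sumE I (q : seq I) (P : pred I) (F : I -> l2 R) k :
  (\sum_(i <- q | P i) F i) k = \sum_(i <- q | P i) F i k.
Proof. by elim/big_rec2: _ => // i x y _ <-. Qed.

Lemma l2dot_ip : inner_product (@l2dot R).
Proof.
split.
- move=> a x y z; apply: ccvg_unique (l2dot_cvg _ _) _.
  rewrite (_ : series _ = (fun j => a * series (fun k => x k * conjc (z k)) j) \+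
    series (fun k => y k * conjc (z k))).
    by apply: ccvgD; [apply: ccvgZ|]; apply: l2dot_cvg.
  apply/funext => j; rewrite /series /= mulr_sumr -big_split /=; apply: eq_bigr => k _.
  by rewrite mulrA -mulrDl.
- move=> x y; apply: ccvg_unique (l2dot_cvg _ _) _.
  rewrite (_ : series _ = fun j => (series (fun k => x k * conjc (y k)) j)^*).
    by apply: ccvgJ; apply: l2dot_cvg.
  apply/funext => j; rewrite /series /= rmorph_sum; apply: eq_bigr => k _ /=.
  by rewrite rmorphM /= conjcK mulrC.
- move=> x; apply: ler_cvg_to (@cvg_cst _ 0 _ _ _) (@l2dot_ip_self x) _.
  by apply: nearW => N; apply: sumr_ge0 => k _; exact: sqr_ge0.
move=> x x0; apply: l2P => k; apply: eq0_normc; apply/eqP.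
rewrite eq_le normc_ge0 andbT; apply: le_trans (l2_coord x k) _.
by rewrite /hnorm x0 sqrtr0.
Qed.

Lemma l2_hilbert : hilbert (@l2dot R).
Proof.
split=> [|u Cu]; first exact: l2dot_ip.
have /choice[x ux] : forall k, exists x : R[i], ccvg (fun j => u j k) x.
  move=> k; apply: complex_cauchy_cvg => e /Cu[N uN]; exists N => i j Ni Nj.
  by apply: le_lt_trans (uN i j Ni Nj); apply: le_trans (l2_coord _ k).
have near_x (e : R) N i : 0 <= e ->
    (forall j, (N <= j)%N -> hnorm (@l2dot R) (u i - u j) <= e) ->
    forall M, sqs (fun k => u i k - x k) M <= e ^+ 2.
  move=> e0 uN M; apply: (@sum_sqr_dist_limit _ _ _ (fun j k => u j k) x N) => // j Nj.
  apply: le_trans (l2_sqs_le (u i - u j) M) _.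
  by rewrite ler_pXn2r ?nnegrE ?hnorm_ge0 //; apply: uN.
have [N uN] := Cu 1 ltr01.
(* The Cauchy estimate makes the difference with [u N] square summable, so the limit is presented as
   [u N] minus this difference. *)
have dx : (fun k => u N k - x k) \in @square_summable R.
  apply: (@l2_bounded _ (1 ^+ 2)); apply: (@near_x _ N) => // j Nj; apply: ltW.
  exact: uN.
exists (u N - L2 dx) => e e0; have [N' uN'] := Cu (e / 2) ltac:(by rewrite divr_gt0).
exists N' => i Ni; apply: (@le_lt_trans _ _ (e / 2)); last by lra.
have e2 : 0 <= e / 2 by lra.
apply: l2_norm_le => // M.
have -> : sqs (u i - (u N - L2 dx)) M = sqs (fun k => u i k - x k) M.
  apply: eq_bigr => k _; congr (normc _ ^+ 2).
  by rewrite -[LHS]/(u i k - (u N k - (u N k - x k))) subKr.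
by apply: (@near_x _ N') => // j Nj; apply/ltW/uN'.
Qed.

End SequenceSpace.

(** * Norms of noncommutative power series *)

Section FiniteSums.
Variable R : realType.

Lemma sum_enum_val (I : finType) (F : I -> R) :
  \sum_i F i = \sum_(k < #|I|) F (enum_val k).
Proof. by rewrite (reindex _ (onW_bij _ (@enum_val_bij I))). Qed.

Lemma minkowski (I : finType) (a b : I -> R[i]) :
  Num.sqrt (\sum_i normc (a i + b i) ^+ 2) <=
  Num.sqrt (\sum_i normc (a i) ^+ 2) + Num.sqrt (\sum_i normc (b i) ^+ 2).
Proof.
have E (c : I -> R[i]) : Num.sqrt (\sum_i normc (c i) ^+ 2) =
    hnorm (@cdot R #|I|) (\col_k c (enum_val k)).
  rewrite -[RHS]ger0_norm ?hnorm_ge0 // -sqrtr_sqr hnorm_cdot sum_enum_val.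
  by under [in RHS]eq_bigr do rewrite mxE.
rewrite !E; apply: le_trans (hnormD (cdot_ip _ _) _ _).
by rewrite le_eqVlt; apply/orP; left; apply/eqP; congr hnorm; apply/colP => k; rewrite !mxE.
Qed.

Lemma cauchy_schwarz_sum (I : finType) (a b : I -> R) :
  (forall i, 0 <= a i) -> (forall i, 0 <= b i) ->
  \sum_i a i * b i <= Num.sqrt (\sum_i a i ^+ 2) * Num.sqrt (\sum_i b i ^+ 2).
Proof.
move=> a0 b0.
have E (c : I -> R) : Num.sqrt (\sum_i c i ^+ 2) =
    hnorm (@cdot R #|I|) (\col_k (c (enum_val k))%:C).
  rewrite -[RHS]ger0_norm ?hnorm_ge0 // -sqrtr_sqr hnorm_cdot sum_enum_val.
  by congr Num.sqrt; apply: eq_bigr => k _; rewrite mxE normc_real real_normK ?num_real.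
rewrite !E; apply: le_trans (cauchy_schwarz (cdot_ip _ _) _ _).
rewrite [leLHS]sum_enum_val /cdot; set c := \sum_(i < _) (_ * conjc _).
have -> : c = (\sum_(k < #|I|) a (enum_val k) * b (enum_val k))%:C.
  by rewrite rmorph_sum; apply: eq_bigr => k _; rewrite !mxE conjc_real -rmorphM.
by rewrite normc_real ler_norm.
Qed.

(** The pairs [(k, l - k)] with [l < N] form a triangle inside the square of index pairs on the
    right, and all terms are nonnegative. *)
Lemma cauchy_product_le (a b : nat -> R) N :
  (forall k, 0 <= a k) -> (forall k, 0 <= b k) ->
  \sum_(l < N) \sum_(k < l.+1) a k * b (l - k)%N <=
  (\sum_(l < N) a l) * (\sum_(l < N) b l).
Proof.
move=> a0 b0; have -> : \sum_(l < N) \sum_(k < l.+1) a k * b (l - k)%N =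
    \sum_(k < N) a k * \sum_(l < N - k) b l.
  elim: N => [|N IH]; first by rewrite !big_ord0.
  rewrite big_ord_recr /= IH [RHS]big_ord_recr /= subSnn big_ord1.
  rewrite [X in _ + X]big_ord_recr /= subnn addrA -big_split /=; congr (_ + _).
  by apply: eq_bigr => k _; rewrite subSn ?big_ord_recr ?mulrDr // ltnW.
rewrite mulr_suml; apply: ler_sum => k _; apply: ler_wpM2l => //.
rewrite (big_ord_widen N _ (leq_subr k N)) [leRHS](bigID (fun i : 'I_N => (i < N - k)%N)) /=.
by rewrite lerDl sumr_ge0.
Qed.

End FiniteSums.

Lemma sum_tuple_cons (V : nmodType) d l (F : seq 'I_d -> V) :
  \sum_(w : l.+1.-tuple 'I_d) F w = \sum_(j < d) \sum_(u : l.-tuple 'I_d) F (j :: u).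
Proof.
rewrite pair_big /=.
pose h (p : 'I_d * l.-tuple 'I_d) := [tuple of p.1 :: p.2].
rewrite (reindex h) //=; apply/onW_bij/inj_card_bij; last first.
  by rewrite card_prod !card_tuple card_ord expnS.
by move=> [i u] [j v] /(congr1 val) /= [-> uv]; congr pair; apply: val_inj.
Qed.

Lemma sum_tuple_rcons (V : nmodType) d l (F : seq 'I_d -> V) :
  \sum_(w : l.+1.-tuple 'I_d) F w = \sum_(j < d) \sum_(u : l.-tuple 'I_d) F (rcons u j).
Proof.
rewrite exchange_big pair_big /=.
pose h (p : l.-tuple 'I_d * 'I_d) := [tuple of rcons p.1 p.2].
rewrite (reindex h) //=; apply/onW_bij/inj_card_bij; last first.
  by rewrite card_prod !card_tuple card_ord expnSr.
move=> [u i] [v j] /(congr1 val) /= /rcons_inj[uv ->].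
by congr pair; apply: val_inj.
Qed.

Section SeriesNorms.
Variables (R : realType) (d : nat).
Local Notation S := (ncseries R d).
Implicit Types (f g h : S) (s t : R).

Definition hom_norm f l : R := Num.sqrt (hom_sqnorm f l).

Lemma hom_norm_ge0 f l : 0 <= hom_norm f l.
Proof. exact: sqrtr_ge0. Qed.

Lemma hom_norm_sqr f l : hom_norm f l ^+ 2 = hom_sqnorm f l.
Proof. by rewrite sqr_sqrtr ?hom_sqnorm_ge0. Qed.

Lemma eq_hom_norm f g l : (forall w, size w = l -> f w = g w) ->
  hom_norm f l = hom_norm g l.
Proof.
by move=> fg; congr Num.sqrt; apply: eq_bigr => w _; rewrite fg ?size_tuple.
Qed.

Lemma hom_norm0 l : hom_norm 0 l = 0.
Proof.
rewrite /hom_norm /hom_sqnorm big1 ?sqrtr0 // => w _.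
by rewrite -[(0 : S) w]/(0 : R[i]) normc0 expr0n.
Qed.

Lemma hom_normN f l : hom_norm (- f) l = hom_norm f l.
Proof.
congr Num.sqrt; apply: eq_bigr => w _.
by rewrite -[(- f) w]/(- f w) normcN.
Qed.

Lemma hom_normD f g l : hom_norm (f + g) l <= hom_norm f l + hom_norm g l.
Proof. exact: minkowski. Qed.

Lemma hom_norm_sum (I : Type) (r : seq I) (P : pred I) (F : I -> S) l :
  hom_norm (\sum_(i <- r | P i) F i) l <= \sum_(i <- r | P i) hom_norm (F i) l.
Proof.
elim/big_rec2: _ => [|i x y _ xy]; first by rewrite hom_norm0.
by apply: le_trans (hom_normD _ _ _) _; rewrite lerD2l.
Qed.

Lemma sum_seriesE (I : Type) (r : seq I) (P : pred I) (F : I -> S) w :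
  (\sum_(i <- r | P i) F i) w = \sum_(i <- r | P i) F i w.
Proof. by elim/big_rec2: _ => // i x y _ <-. Qed.

(** For each cut [k] the summand [T k] is a tensor product: a word of length [l] is a pair of prefix
    and suffix, so its norm is exactly the product of the two norms. The triangle inequality over
    the cuts does the rest. *)
Lemma hom_normM f g l :
  hom_norm (f * g) l <= \sum_(k < l.+1) hom_norm f k * hom_norm g (l - k).
Proof.
pose T (k : nat) : S := fun w => f (take k w) * g (drop k w).
rewrite (@eq_hom_norm _ (\sum_(k < l.+1) T k)); last first.
  by move=> w wl; rewrite sum_seriesE -[(f * g) w]/(ncmul f g w) /ncmul wl.
apply: le_trans (hom_norm_sum _ _ _ _) _; apply: ler_sum => -[k /= kl] _.
rewrite -sqrtrM ?hom_sqnorm_ge0 // ler_wsqrtr //.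
have lE : l = (k + (l - k))%N by rewrite subnKC.
rewrite -(big_split_tuple k (l - k)
  (fun u => normc (f u) ^+ 2) (fun u => normc (g u) ^+ 2)) -lE.
by rewrite le_eqVlt; apply/orP; left; apply/eqP/eq_bigr => w _; rewrite normcM exprMn.
Qed.

(** Partial sums of the l^1 norm over degrees. They are submultiplicative already at each finite [N]
    ([wsumM]), so Banach algebra estimates can be made without passing to a limit. *)
Definition wsum s f N : R := \sum_(l < N) hom_norm f l * s ^+ l.

Lemma wterm_ge0 s f l : 0 <= s -> 0 <= hom_norm f l * s ^+ l.
Proof. by move=> s0; rewrite mulr_ge0 ?hom_norm_ge0 ?exprn_ge0. Qed.

Lemma wsum_ge0 s f N : 0 <= s -> 0 <= wsum s f N.
Proof. by move=> s0; apply: sumr_ge0 => l _; exact: wterm_ge0. Qed.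

Lemma wsum0 s N : wsum s 0 N = 0.
Proof. by rewrite /wsum big1 // => l _; rewrite hom_norm0 mul0r. Qed.

Lemma wsumN s f N : wsum s (- f) N = wsum s f N.
Proof. by apply: eq_bigr => l _; rewrite hom_normN. Qed.

Lemma wsumD s f g N : 0 <= s -> wsum s (f + g) N <= wsum s f N + wsum s g N.
Proof.
move=> s0; rewrite /wsum -big_split /=; apply: ler_sum => l _.
by rewrite -mulrDl; apply: ler_wpM2r; rewrite ?exprn_ge0 ?hom_normD.
Qed.

Lemma wsum_sum (I : Type) (r : seq I) (P : pred I) (F : I -> S) s N : 0 <= s ->
  wsum s (\sum_(i <- r | P i) F i) N <= \sum_(i <- r | P i) wsum s (F i) N.
Proof.
move=> s0; elim/big_rec2: _ => [|i x y _ xy]; first by rewrite wsum0.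
by apply: le_trans (wsumD _ _ _ s0) _; rewrite lerD2l.
Qed.

Lemma wsum_conv_le s f g N : 0 <= s ->
  wsum s (f * g) N <= \sum_(l < N) \sum_(k < l.+1)
    (hom_norm f k * s ^+ k) * (hom_norm g (l - k) * s ^+ (l - k)).
Proof.
move=> s0; apply: ler_sum => l _.
apply: le_trans (ler_wpM2r _ (hom_normM f g l)) _; first exact: exprn_ge0.
rewrite mulr_suml; apply: ler_sum => -[k /= kl] _.
by rewrite mulrACA -exprD subnKC.
Qed.

Lemma wsumM s f g N : 0 <= s -> wsum s (f * g) N <= wsum s f N * wsum s g N.
Proof.
move=> s0; apply: le_trans (wsum_conv_le _ _ _ s0) _.
apply: (cauchy_product_le (a := fun k => hom_norm f k * s ^+ k)
  (b := fun k => hom_norm g k * s ^+ k)) => k; exact: wterm_ge0.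
Qed.

Lemma wsum_le_nat s f M N : 0 <= s -> (M <= N)%N -> wsum s f M <= wsum s f N.
Proof.
move=> s0 MN; rewrite /wsum (big_ord_widen N (fun l => hom_norm f l * s ^+ l) MN).
by rewrite [leRHS](bigID (fun i : 'I_N => (i < M)%N)) /= lerDl sumr_ge0 // => l _; exact: wterm_ge0.
Qed.

Lemma wsum_le_radius s t f N : 0 <= s -> s <= t -> wsum s f N <= wsum t f N.
Proof.
move=> s0 st; apply: ler_sum => l _; apply: ler_wpM2l; first exact: hom_norm_ge0.
by rewrite lerXn2r ?nnegrE // (le_trans s0).
Qed.

Definition bnd s f C := forall N, wsum s f N <= C.

Lemma bnd_ge0 s f C : bnd s f C -> 0 <= C.
Proof. by move=> /(_ 0%N); rewrite /wsum big_ord0. Qed.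

Lemma bnd_term s f C l : 0 <= s -> bnd s f C -> hom_norm f l * s ^+ l <= C.
Proof.
move=> s0 /(_ l.+1); apply: le_trans; rewrite /wsum big_ord_recr /= lerDr.
exact: wsum_ge0.
Qed.

Lemma bndD s f g C D : 0 <= s -> bnd s f C -> bnd s g D -> bnd s (f + g) (C + D).
Proof. by move=> s0 fC gD N; apply: le_trans (wsumD _ _ _ s0) _; apply: lerD. Qed.

Lemma bndM s f g C D : 0 <= s -> bnd s f C -> bnd s g D -> bnd s (f * g) (C * D).
Proof.
move=> s0 fC gD N; apply: le_trans (wsumM _ _ _ s0) _.
by apply: ler_pM => //; exact: wsum_ge0.
Qed.

(** Each term is at most [Num.sqrt C] times a power of [s / t], and the geometric series converges
    as [s < t]. Growth conditions and the Fock norm are turned into l^1 bounds here, at the price of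
    a smaller radius. *)
Lemma bnd_sqnorm s t f C : 0 < s -> s < t ->
  (forall l, hom_sqnorm f l * t ^+ (2 * l) <= C) ->
  bnd s f (Num.sqrt C / (1 - s / t)).
Proof.
move=> s0 st fC N; have t0 := lt_trans s0 st.
have q0 : 0 <= s / t by rewrite divr_ge0 // ltW.
have q1 : 0 < 1 - s / t by rewrite subr_gt0 ltr_pdivrMr ?mul1r.
apply: (@le_trans _ _ (\sum_(l < N) Num.sqrt C * (s / t) ^+ l)).
  apply: ler_sum => l _; rewrite expr_div_n mulrA ler_pdivlMr ?exprn_gt0 // mulrAC.
  apply: ler_wpM2r; first by rewrite exprn_ge0 // ltW.
  have -> : t ^+ l = Num.sqrt (t ^+ (2 * l)).
    by rewrite mulnC exprM sqrtr_sqr ger0_norm // exprn_ge0 // ltW.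
  rewrite -sqrtrM ?hom_sqnorm_ge0 //; exact: ler_wsqrtr.
rewrite -mulr_sumr ler_wpM2l ?sqrtr_ge0 // -[leRHS]mul1r ler_pdivlMr // mulrC.
rewrite -opprB mulNr -subrX1 opprB lerBlDr lerDl; exact: exprn_ge0.
Qed.

Lemma ereal_between s (rho : \bar R) : (s%:E < rho)%E ->
  exists2 t : R, s < t & (t%:E < rho)%E.
Proof.
case: rho => [y| |//]; last by exists (s + 1); rewrite ?ltry // ltrDl.
by rewrite lte_fin => sy; exists ((s + y) / 2); rewrite ?lte_fin; lra.
Qed.

Lemma conv_bndP (rho : \bar R) f : (f \in @conv_pred R d rho) <->
  (forall s, 0 < s -> (s%:E < rho)%E -> exists C, bnd s f C).
Proof.
split=> [/radiusP fr s s0 /ereal_between[t st tr]|fr].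
  have [C fC] := fr t (lt_trans s0 st) tr.
  by eexists; apply: bnd_sqnorm st fC.
apply/radiusP => s s0 sr; have [C fC] := fr s s0 sr.
exists (C ^+ 2) => l; rewrite -hom_norm_sqr mulnC exprM -exprMn.
by rewrite lerXn2r ?nnegrE ?(bnd_ge0 fC) ?wterm_ge0 ?(ltW s0) // bnd_term // ltW.
Qed.

Definition trunc n f : S := fun w => if (size w < n)%N then f w else 0.

Lemma hom_norm_trunc n f l : hom_norm (trunc n f) l = if (l < n)%N then hom_norm f l else 0.
Proof.
case: ifP => ln; first by apply: eq_hom_norm => w wl; rewrite /trunc wl ln.
by rewrite -(hom_norm0 l); apply: eq_hom_norm => w wl; rewrite /trunc wl ln.
Qed.

Lemma bnd_trunc s n f : 0 <= s -> bnd s (trunc n f) (wsum s f n).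
Proof.
move=> s0 N; apply: (@le_trans _ _ (wsum s (trunc n f) n)).
  have [/wsum_le_nat->//|/ltnW nN] := leqP N n.
  rewrite /wsum (big_ord_widen N (fun l => hom_norm (trunc n f) l * s ^+ l) nN).
  rewrite [leRHS]big_mkcond /=; apply: ler_sum => l _; rewrite hom_norm_trunc.
  by case: ifP => //; rewrite mul0r.
by apply: ler_sum => l _; rewrite hom_norm_trunc ltn_ord.
Qed.

Lemma conv_trunc (rho : \bar R) n f : trunc n f \in @conv_pred R d rho.
Proof.
by apply/conv_bndP => s s0 _; exists (wsum s f n); apply: bnd_trunc; exact: ltW.
Qed.

(** If every [N] were followed by a growth of more than [e], the partial sums would exceed [C] after
    finitely many steps; the tail from a good [N] on is therefore at most [e]. *)
Lemma bnd_tail s f C e : 0 <= s -> bnd s f C -> 0 < e ->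
  exists N, forall n, (N <= n)%N -> bnd s (f - trunc n f) e.
Proof.
move=> s0 fC e0; have [N NP] : exists N, forall n, wsum s f n <= wsum s f N + e.
  apply: contrapT => /forallNP H.
  have step k : exists N, e * k%:R <= wsum s f N.
    elim: k => [|k [N kN]]; first by exists 0%N; rewrite mulr0 wsum_ge0.
    have /existsNP[n /negP] := H N; rewrite -ltNge => nN; exists n.
    by rewrite -natr1 mulrDr mulr1; apply: le_trans (ltW nN); rewrite lerD2r.
  have [N CN] := step (Num.bound (C / e)); have := le_trans CN (fC N).
  apply/negP; rewrite -ltNge mulrC -ltr_pdivrMr //.
  by apply: archi_boundP; rewrite divr_ge0 ?(bnd_ge0 fC) // ltW.
exists N => n Nn m.
have split_n : wsum s (f - trunc n f) (maxn m n) + wsum s f n = wsum s f (maxn m n).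
  rewrite /wsum (big_ord_widen (maxn m n) (fun l => hom_norm f l * s ^+ l) (leq_maxr m n)).
  rewrite [X in _ + X]big_mkcond /= -big_split /=; apply: eq_bigr => l _; case: ifP => ln.
    rewrite (@eq_hom_norm _ 0) ?hom_norm0 ?mul0r ?add0r // => w wl.
    by rewrite -[LHS]/(f w - trunc n f w) /trunc wl ln subrr.
  rewrite addr0; congr (_ * _); apply: eq_hom_norm => w wl.
  by rewrite -[LHS]/(f w - trunc n f w) /trunc wl ln subr0.
apply: le_trans (wsum_le_nat _ s0 (leq_maxl m n)) _.
have := NP (maxn m n); rewrite -split_n; have := wsum_le_nat f s0 Nn; lra.
Qed.

End SeriesNorms.

(** * Weighted Fock spaces *)

Lemma sum_uniq_le (R : numDomainType) (T : eqType) (s t : seq T) (F : T -> R) :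
  uniq s -> (forall x, 0 <= F x) -> {in s, forall x, F x != 0 -> x \in t} ->
  \sum_(x <- s) F x <= \sum_(x <- t) F x.
Proof.
move=> us F0; elim: s t us => [|x s IH] t /=; first by rewrite big_nil sumr_ge0.
move=> /andP[xs us] st; rewrite big_cons.
have [Fx0|Fx0] := eqVneq (F x) 0.
  by rewrite Fx0 add0r; apply: IH => // y ys; apply: st; rewrite inE ys orbT.
have xt : x \in t by apply: st; rewrite ?mem_head.
rewrite [leRHS](perm_big _ (perm_to_rem xt)) big_cons lerD2l; apply: IH => // y ys Fy.
have /st yt : y \in x :: s by rewrite inE ys orbT.
have := perm_mem (perm_to_rem xt) y; rewrite yt // inE => /esym/orP[/eqP yx|//].
by move: xs; rewrite -yx ys.
Qed.

Section Encoding.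
Variables (R : realType) (d : nat).
Local Notation S := (ncseries R d).
Local Notation norm2 := (hnorm (@l2dot R)).
Implicit Types (f g : S) (r : R) (x y : l2 R) (w : seq 'I_d).

Definition words n : seq (seq 'I_d) :=
  flatten [seq [seq val w | w : l.-tuple 'I_d] | l <- iota 0 n].

Lemma mem_words n w : (w \in words n) = (size w < n)%N.
Proof.
apply/flatten_mapP/idP => [[l]|wn].
  by rewrite mem_iota add0n => ln /mapP[u _ ->]; rewrite size_tuple.
exists (size w); first by rewrite mem_iota.
by apply/mapP; exists (in_tuple w); rewrite ?mem_enum.
Qed.

Lemma sum_words n (F : seq 'I_d -> R) :
  \sum_(w <- words n) F w = \sum_(l < n) \sum_(w : l.-tuple 'I_d) F w.
Proof.
rewrite big_flatten big_map -{1}[n]subn0 -/(index_iota 0 n) big_mkord.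
by apply: eq_bigr => l _; rewrite big_map big_enum.
Qed.

Lemma uniq_words n : uniq (words n).
Proof.
elim: n => // n IH; rewrite /words -addn1 iotaD map_cat flatten_cat cat_uniq IH /= cats0.
rewrite (map_inj_uniq val_inj) enum_uniq andbT.
by apply/hasPn => w /mapP[u _ ->]; rewrite mem_words size_tuple ltnn.
Qed.

(** Partial sums of the squared norm in the Fock space of radius [r], where a word of length [l] has
    norm [r ^+ l]. *)
Definition sqw r f N : R := \sum_(l < N) hom_sqnorm f l * r ^+ (2 * l).

Lemma sqw_words r f N :
  sqw r f N = \sum_(w <- words N) (normc (f w) * r ^+ size w) ^+ 2.
Proof.
rewrite sum_words; apply: eq_bigr => l _; rewrite /hom_sqnorm mulr_suml.
by apply: eq_bigr => w _; rewrite exprMn -exprM size_tuple mulnC.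
Qed.

(* Words are coded by [pickle], which need not be onto [nat] (for d = 0 there is
   only one word); the other coordinates of [l2] are unused. *)
Definition word_of : nat -> option (seq 'I_d) := @pickle_inv _.

Definition enc_fun r f (k : nat) : R[i] :=
  if word_of k is Some w then f w * (r ^+ size w)%:C else 0.

(** The value is 0 when [f] lies outside the Fock space of radius [r], which explains the hypotheses
    [fock r f] below. The weights make [enc r] isometric. *)
Definition enc r f : l2 R := insubd 0 (enc_fun r f).

Definition dec r x : S := fun w => x (pickle w) * (r ^- size w)%:C.

Lemma sqs_enc_fun r f C : 0 <= r -> (forall N, sqw r f N <= C) ->
  forall N, sqs (enc_fun r f) N <= C.
Proof.
move=> r0 fC N; pose ws := pmap (word_of) (iota 0 N).
pose L := (\max_(w <- ws) size w).+1; apply: le_trans (fC L); rewrite sqw_words.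
pose F w := (normc (f w) * r ^+ size w) ^+ 2.
have -> : sqs (enc_fun r f) N = \sum_(w <- ws) F w.
  rewrite /sqs /ws /index_iota subn0; elim: (iota 0 N) => [|k s IH] /=; first by rewrite !big_nil.
  rewrite big_cons IH /enc_fun; case: (word_of k) => [w|] /=.
    by rewrite big_cons normcM normc_real ger0_norm ?exprn_ge0.
  by rewrite !(expr0n, addr0, sqrtr0, add0r).
apply: sum_uniq_le => [|w|w wws _]; last 1 first.
- by rewrite mem_words ltnS; exact: (@leq_bigmax_seq _ ws xpredT size w wws).
- by apply: (pmap_uniq (@pickle_invK _)); exact: iota_uniq.
exact: sqr_ge0.
Qed.

Definition fock r f := exists C, forall N, sqw r f N <= C.

Lemma encE r f : 0 <= r -> fock r f -> forall k, enc r f k = enc_fun r f k.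
Proof.
move=> r0 [C fC] k; rewrite /enc /insubd insubT //.
by apply: l2_bounded; apply: sqs_enc_fun fC.
Qed.

Lemma enc_pickle r f w : 0 <= r -> fock r f -> enc r f (pickle w) = f w * (r ^+ size w)%:C.
Proof. by move=> r0 fr; rewrite encE // /enc_fun /word_of pickleK_inv. Qed.

Lemma enc_norm_le r f C : 0 <= r -> 0 <= C -> (forall N, sqw r f N <= C ^+ 2) ->
  norm2 (enc r f) <= C.
Proof.
move=> r0 C0 fC; apply: l2_norm_le => // N.
have -> : sqs (enc r f) N = sqs (enc_fun r f) N.
  by apply: eq_bigr => k _; rewrite encE //; exists (C ^+ 2).
exact: sqs_enc_fun fC N.
Qed.

Lemma dec_sqw r x N : 0 < r -> sqw r (dec r x) N <= norm2 x ^+ 2.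
Proof.
move=> r0; pose ks := [seq pickle w | w <- words N].
pose L := (\max_(k <- ks) k).+1; apply: le_trans (l2_sqs_le x L).
rewrite sqw_words.
have -> : \sum_(w <- words N) (normc (dec r x w) * r ^+ size w) ^+ 2 =
    \sum_(k <- ks) normc (x k) ^+ 2.
  rewrite big_map; apply: eq_bigr => w _; congr (_ ^+ 2).
  rewrite /dec normcM normc_real ger0_norm ?invr_ge0 ?exprn_ge0 ?(ltW r0) //.
  by rewrite mulfVK // expf_eq0 gt_eqF // andbF.
apply: sum_uniq_le => [|k|k kks _]; last 1 first.
- by rewrite mem_index_iota /= ltnS; exact: (@leq_bigmax_seq _ ks xpredT id k kks).
- by rewrite map_inj_uniq ?uniq_words //; exact: (pcan_inj pickleK).
exact: sqr_ge0.
Qed.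

Lemma fock_dec r x : 0 < r -> fock r (dec r x).
Proof. by move=> r0; exists (norm2 x ^+ 2) => N; exact: dec_sqw. Qed.

Lemma enc_dec_pickle r x w : 0 < r -> enc r (dec r x) (pickle w) = x (pickle w).
Proof.
move=> r0; rewrite enc_pickle ?(ltW r0) //; last exact: fock_dec.
rewrite /dec -mulrA -real_complexM mulVf ?mulr1 //.
by rewrite expf_eq0 gt_eqF // andbF.
Qed.

Lemma dec_enc r f : 0 < r -> fock r f -> dec r (enc r f) = f.
Proof.
move=> r0 fr; apply/funext => w; rewrite /dec enc_pickle ?(ltW r0) //.
rewrite -mulrA -real_complexM mulfV ?mulr1 //.
by rewrite expf_eq0 gt_eqF // andbF.
Qed.

Lemma enc_sqw r f N : 0 < r -> fock r f -> sqw r f N <= norm2 (enc r f) ^+ 2.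
Proof. by move=> r0 fr; rewrite -{1}(dec_enc r0 fr); exact: dec_sqw. Qed.

(** For [r > 0] these vectors form the range of [enc r], the copy of the Fock space inside
    [l2 R]. *)
Definition fock_vec (x : l2 R) := forall k, word_of k = None -> x k = 0.

Lemma fock_vec_enc r f : 0 <= r -> fock_vec (enc r f).
Proof.
move=> r0 k kN; rewrite /enc /insubd; case: insubP => [x _ ->|_] //=.
by rewrite /enc_fun kN.
Qed.

Lemma fock_vecP x y : fock_vec x -> fock_vec y ->
  (forall w, x (pickle w) = y (pickle w)) -> x = y.
Proof.
move=> xF yF xy; apply: l2P => k; case E : (word_of k) => [w|].
  by have : oapp pickle k (word_of k) = k := pickle_invK k; rewrite E /= => <-; exact: xy.
by rewrite xF // yF.
Qed.

Lemma enc_dec r x : 0 < r -> fock_vec x -> enc r (dec r x) = x.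
Proof.
move=> r0 xF; apply: fock_vecP => //; first by apply: fock_vec_enc; exact: ltW.
by move=> w; rewrite enc_dec_pickle.
Qed.

Lemma sqw_add r f g N : sqw r (f + g) N <= 2 * (sqw r f N + sqw r g N).
Proof.
rewrite /sqw -big_split /= mulr_sumr; apply: ler_sum => l _; rewrite -mulrDl mulrA.
by apply: ler_wpM2r; rewrite ?hom_sqnormD // mulnC exprM sqr_ge0.
Qed.

Lemma fockD r f g : fock r f -> fock r g -> fock r (f + g).
Proof.
move=> [C fC] [D gD]; exists (2 * (C + D)) => N; apply: le_trans (sqw_add _ _ _ _) _.
by rewrite ler_pM2l // lerD.
Qed.

(** Over degrees the l^2 norm is at most the l^1 norm, at the same radius; the converse comparison
    [bnd_fock] loses radius. *)
Lemma fock_bnd r f C : 0 <= r -> bnd r f C -> forall N, sqw r f N <= C ^+ 2.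
Proof.
move=> r0 fC N; have Nsq : sqw r f N = \sum_(l < N) (hom_norm f l * r ^+ l) ^+ 2.
  by apply: eq_bigr => l _; rewrite exprMn hom_norm_sqr -exprM mulnC.
apply: (@le_trans _ _ (wsum r f N ^+ 2)); last first.
  by rewrite lerXn2r ?nnegrE ?wsum_ge0 ?(bnd_ge0 fC).
rewrite Nsq /wsum; elim: N {Nsq} => [|N IH]; first by rewrite !big_ord0 expr0n.
rewrite !big_ord_recr /= sqrrD -addrA; apply: lerD => //.
by rewrite lerDr mulrn_wge0 // mulr_ge0 ?wterm_ge0 // -/(wsum r f N) wsum_ge0.
Qed.

Lemma bnd_fock r s f C : 0 < s -> s < r -> 0 <= C -> (forall N, sqw r f N <= C ^+ 2) ->
  bnd s f (C / (1 - s / r)).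
Proof.
move=> s0 sr C0 fC; rewrite -[C]ger0_norm // -sqrtr_sqr; apply: bnd_sqnorm => // l.
apply: le_trans (fC l.+1); rewrite /sqw big_ord_recr /= lerDr; apply: sumr_ge0 => k _.
by rewrite mulr_ge0 ?hom_sqnorm_ge0 // mulnC exprM sqr_ge0.
Qed.

Lemma enc_norm_bnd r f C : 0 <= r -> bnd r f C -> norm2 (enc r f) <= C.
Proof.
move=> r0 fC; apply: enc_norm_le => //; first exact: bnd_ge0 fC.
exact: fock_bnd.
Qed.

Lemma bnd_is_fock r f C : 0 <= r -> bnd r f C -> fock r f.
Proof. by move=> r0 fC; exists (C ^+ 2) => N; exact: fock_bnd. Qed.

End Encoding.

Section Strip.
Variables (R : realType) (d : nat).
Local Notation S := (ncseries R d).
Local Notation norm2 := (hnorm (@l2dot R)).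
Implicit Types (f g h : S) (r s : R) (x y : l2 R) (w : seq 'I_d) (a : R[i]).

(** Scalars act as right multiplication by constant series, so a right ideal is a linear subspace by
    its very closure properties. *)
Definition const_series a : S := fun w => if w == [::] then a else 0.

(** The left inverse of right multiplication by the letter [j]: a series is its constant term plus
    the sum of the [rstrip j f] times the letters. *)
Definition rstrip j f : S := fun w => f (rcons w j).

Lemma mul_seriesE f g w :
  (f * g) w = \sum_(i < (size w).+1) f (take i w) * g (drop i w).
Proof. by []. Qed.

Lemma mul_nil f g : (f * g) [::] = f [::] * g [::].
Proof. by rewrite mul_seriesE big_ord1. Qed.

(** The cuts of [rcons w j] are those of [w] and one more at the end. When [g] has no constant term,
    stripping therefore commutes with left multiplication by [f]. *)
Lemma mul_rcons f g w j :
  (f * g) (rcons w j) = (f * rstrip j g) w + f (rcons w j) * g [::].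
Proof.
rewrite !mul_seriesE size_rcons big_ord_recr /= -(size_rcons w j) take_size drop_size.
rewrite size_rcons; congr (_ + _); apply: eq_bigr => -[i /=]; rewrite ltnS => iw _.
rewrite /rstrip -!cats1 takel_cat // drop_cat; case: ltnP => // wi.
have -> : i = size w by apply/eqP; rewrite eqn_leq iw.
by rewrite subnn drop0 drop_size.

Qed.

Lemma mul_cst f a w : (f * const_series a) w = f w * a.
Proof.
case/lastP: w => [|w j]; first by rewrite mul_nil.
rewrite mul_rcons; have -> : rstrip j (const_series a) = 0.
  by apply/funext => v; rewrite /rstrip /const_series; case: v.
by rewrite mulr0 -[X in X + _]/(0 : R[i]) add0r.
Qed.

Lemma bnd_cst s a : bnd s (const_series a) (normc a).
Proof.
case=> [|N]; first by rewrite /wsum big_ord0 normc_ge0.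
rewrite /wsum big_ord_recl /= expr0 mulr1 big1 ?addr0 => [|l _].
  rewrite /hom_norm /hom_sqnorm (bigD1 [tuple]) //= big1 ?addr0 => [|w].
    by rewrite sqrtr_sqr ger0_norm ?normc_ge0.
  by move=> /negP[]; apply/eqP; exact: tuple0.
rewrite (@eq_hom_norm _ _ _ 0) ?hom_norm0 ?mul0r // => w wl.
by rewrite /const_series; case: w wl.
Qed.

Lemma hom_sqnorm_rstrip f l :
  hom_sqnorm f l.+1 = \sum_(j < d) hom_sqnorm (rstrip j f) l.
Proof. exact: (sum_tuple_rcons l (fun w => normc (f w) ^+ 2)). Qed.

Lemma hom_norm_rstrip f j l : hom_norm (rstrip j f) l <= hom_norm f l.+1.
Proof.
apply: ler_wsqrtr; rewrite hom_sqnorm_rstrip (bigD1 j) //= lerDl.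
by apply: sumr_ge0 => i _; exact: hom_sqnorm_ge0.
Qed.

Lemma bnd_rstrip s f j C : 0 < s -> bnd s f C -> bnd s (rstrip j f) (C / s).
Proof.
move=> s0 fC N; rewrite ler_pdivlMr //; apply: le_trans (fC N.+1).
rewrite /wsum [leRHS]big_ord_recl /= mulr_suml.
apply: (@le_trans _ _ (\sum_(l < N) hom_norm f (bump 0 l) * s ^+ (bump 0 l))).
  apply: ler_sum => l _; rewrite -mulrA -exprSr ler_wpM2r ?exprn_ge0 ?(ltW s0) //.
  exact: hom_norm_rstrip.
by rewrite lerDr wterm_ge0 // ltW.
Qed.

(** The constant term and the parts ending in different letters are orthogonal, and appending a
    letter multiplies norms by [r]. This is the isometry property behind the Wold decomposition. *)
Lemma sqw_rstrip r f N :
  sqw r f N.+1 = normc (f [::]) ^+ 2 + r ^+ 2 * \sum_(j < d) sqw r (rstrip j f) N.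
Proof.
rewrite /sqw big_ord_recl /= muln0 expr0 mulr1; congr (_ + _).
  rewrite /hom_sqnorm (bigD1 [tuple]) //= big1 ?addr0 // => w.
  by move=> /negP[]; apply/eqP; exact: tuple0.
rewrite exchange_big mulr_sumr; apply: eq_bigr => l _ /=.
rewrite -mulr_suml -hom_sqnorm_rstrip mulrCA -exprD; congr (_ * _ ^+ _).
by rewrite /bump /= add1n mulnS.
Qed.

Lemma sqw_ge0 r f N : 0 <= sqw r f N.
Proof.
by apply: sumr_ge0 => l _; rewrite mulr_ge0 ?hom_sqnorm_ge0 // mulnC exprM sqr_ge0.
Qed.

Lemma sqw_cvg r f : 0 < r -> fock r f -> sqw r f @ \oo --> norm2 (enc r f) ^+ 2.
Proof.
move=> r0 fr; have nd : nondecreasing_seq (sqw r f).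
  apply/nondecreasing_seqP => N; rewrite /sqw big_ord_recr /= lerDl.
  by rewrite mulr_ge0 ?hom_sqnorm_ge0 // mulnC exprM sqr_ge0.
have cv : cvgn (sqw r f).
  apply: nondecreasing_is_cvgn => //; have [C fC] := fr; exists C => _ [N _ <-].
  exact: fC.
suff <- : limn (sqw r f) = norm2 (enc r f) ^+ 2 by [].
have L0 : 0 <= limn (sqw r f).
  by apply: le_trans (nondecreasing_cvgn_le nd cv 0%N); exact: sqw_ge0.
apply/eqP; rewrite eq_le; apply/andP; split.
  by apply: limr_le => //; apply: nearW => N; exact: enc_sqw.
rewrite -[leRHS]sqr_sqrtr // lerXn2r ?nnegrE ?hnorm_ge0 ?sqrtr_ge0 //.
apply: enc_norm_le (ltW r0) (sqrtr_ge0 _) _ => N; rewrite sqr_sqrtr //.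
exact: nondecreasing_cvgn_le.
Qed.

Lemma enc_linear r f g a : 0 <= r -> fock r f -> fock r g ->
  enc r (f * const_series a + g) = a *: enc r f + enc r g.
Proof.
move=> r0 fr gr; have fag : fock r (f * const_series a + g).
  apply: fockD => //; have [C fC] := fr; exists (C * normc a ^+ 2) => N.
  rewrite (_ : sqw _ _ _ = sqw r f N * normc a ^+ 2).
    by apply: ler_wpM2r; rewrite ?sqr_ge0.
  rewrite /sqw mulr_suml; apply: eq_bigr => l _; rewrite mulrAC; congr (_ * _).
  rewrite /hom_sqnorm mulr_suml; apply: eq_bigr => w _.
  by rewrite mul_cst normcM exprMn.
apply: l2P => k; rewrite -[RHS]/(a * enc r f k + enc r g k) !encE // /enc_fun.
case: (word_of _ k) => [w|]; last by rewrite mulr0 addr0.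
rewrite -[X in X * _]/((f * const_series a) w + g w) mul_cst mulrDl; congr (_ + _).
by rewrite mulrAC mulrC.
Qed.

Lemma fockN r (f : S) : fock r f -> fock r (- f).
Proof.
move=> [C fC]; exists C => N; apply: le_trans (fC N); rewrite le_eqVlt; apply/orP; left.
apply/eqP; apply: eq_bigr => l _; congr (_ * _); apply: eq_bigr => w _.
by rewrite -[(- f) w]/(- f w) normcN.
Qed.

Lemma encB r (f h : S) : 0 <= r -> fock r f -> fock r h ->
  enc r f - enc r h = enc r (f - h).
Proof.
move=> r0 fr hr; rewrite addrC -scaleN1r -(enc_linear _ r0 hr fr); congr (enc r _).
apply/funext => w; rewrite -[LHS]/((h * const_series (-1)) w + f w) mul_cst mulrN1.
by rewrite addrC.
Qed.

Lemma decB r x y : dec r (x - y) = dec r x - dec r y :> S.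
Proof.
by apply/funext => w; rewrite -[RHS]/(dec r x w - dec r y w) /dec -mulrBl.
Qed.

(** On the Fock space this is [r ^- 2] times the adjoint of right multiplication by the letter
    [j]. *)
Definition strip r j x : l2 R := enc r (rstrip j (dec r x)).

Lemma fock_rstrip r j f : 0 < r -> fock r f -> fock r (rstrip j f).
Proof.
move=> r0 [C fC]; exists (C / r ^+ 2) => N; rewrite ler_pdivlMr ?exprn_gt0 //.
apply: le_trans (fC N.+1); rewrite sqw_rstrip (bigD1 j) //= mulrDr addrCA mulrC lerDl.
by rewrite addr_ge0 ?sqr_ge0 // mulr_ge0 ?sqr_ge0 ?sumr_ge0 // => i _; exact: sqw_ge0.
Qed.

Lemma strip_pickle r j x w : 0 < r ->
  strip r j x (pickle w) = x (pickle (rcons w j)) / r%:C.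
Proof.
move=> r0; rewrite /strip enc_pickle ?(ltW r0) //; last exact/fock_rstrip/fock_dec.
rewrite /rstrip /dec size_rcons -mulrA -real_complexM exprS invfM mulfVK; last first.
  by rewrite expf_eq0 gt_eqF // andbF.
by congr (_ * _); rewrite fmorphV.
Qed.

Lemma strip_linear r j a x y : 0 < r ->
  strip r j (a *: x + y) = a *: strip r j x + strip r j y.
Proof.
move=> r0; have fv z : fock_vec d (strip r j z) by apply: fock_vec_enc; exact: ltW.
apply: (@fock_vecP _ d) => // [k kN|w].
  by rewrite -[LHS]/(a * strip r j x k + strip r j y k) !fv // mulr0 addr0.
rewrite -[RHS]/(a * strip r j x (pickle w) + strip r j y (pickle w)) !strip_pickle //.
by rewrite mulrA -mulrDl.
Qed.

Lemma strip_norm r x : 0 < r -> fock_vec d x ->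
  r ^+ 2 * \sum_(j < d) norm2 (strip r j x) ^+ 2 <= norm2 x ^+ 2.
Proof.
move=> r0 xF; rewrite -[in leRHS](enc_dec r0 xF).
have fx := fock_dec d x r0; rewrite mulr_sumr.
have cv : (fun N => r ^+ 2 * \sum_(j < d) sqw r (rstrip j (dec r x)) N) @ \oo -->
    r ^+ 2 * \sum_(j < d) norm2 (strip r j x) ^+ 2.
  apply: cvgM; first exact: cvg_cst.
  elim: (index_enum _) => [|k s IH].
    by under eq_fun do rewrite big_nil; rewrite big_nil; apply: cvg_cst.
  under eq_fun do rewrite big_cons; rewrite big_cons; apply: cvgD IH.
  by apply: sqw_cvg => //; apply: fock_rstrip.
rewrite -mulr_sumr; apply: ler_cvg_to cv (@cvg_cst _ (norm2 (enc r (dec r x)) ^+ 2) _ _ _) _.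
apply: nearW => N; apply: le_trans (enc_sqw N.+1 r0 fx); rewrite sqw_rstrip lerDr.
exact: sqr_ge0.
Qed.

Lemma strip_norm1 r j x : 0 < r -> fock_vec d x -> norm2 (strip r j x) <= norm2 x / r.
Proof.
move=> r0 xF; rewrite ler_pdivlMr // -(@ler_pXn2r _ 2) ?nnegrE ?hnorm_ge0 //; last first.
  by rewrite mulr_ge0 ?hnorm_ge0 ?ltW.
apply: le_trans (strip_norm r0 xF); rewrite exprMn mulrC ler_pM2l ?exprn_gt0 //.
by rewrite (bigD1 j) //= lerDl sumr_ge0 // => i _; exact: sqr_ge0.
Qed.

Lemma fock_vec_subspace : subspace (fock_vec d : set (l2 R)).
Proof.
split=> [//|a x y xF yF k kN].
by rewrite -[LHS]/(a * x k + y k) xF // yF // mulr0 addr0.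
Qed.

Lemma fock_vec_closed (M : set (l2 R)) : (M `<=` fock_vec d) ->
  hclosure (@l2dot R) M `<=` fock_vec d.
Proof.
move=> MF x Mx k kN; apply: eq0_normc; apply/eqP; rewrite eq_le normc_ge0 andbT.
apply/ler_addgt0Pl => e /Mx[m Mm xm]; rewrite addr0; apply: le_trans (ltW xm).
apply: le_trans (l2_coord _ k); rewrite -[(x - m) k]/(x k - m k) (MF m) // subr0.
exact: lexx.
Qed.

End Strip.

(** * Wold decomposition of the closure of a right ideal *)

Section Wold.
Variables (R : realType) (d : nat) (rho : \bar R) (m : nat).
Local Notation S := (ncseries R d).
Local Notation norm2 := (hnorm (@l2dot R)).
Local Notation conv := (@conv_pred R d rho).
Variable g : 'I_m -> S.
Hypothesis g_conv : forall k, g k \in conv.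
Implicit Types (r s : R) (x y e : l2 R) (a b : R[i]).

Lemma conv_cst a : (const_series a : S) \in conv.
Proof. by apply/conv_bndP => s s0 _; exists (normc a); exact: bnd_cst. Qed.

Lemma conv_rstrip (f : S) j : f \in conv -> rstrip j f \in conv.
Proof.
move=> /conv_bndP fc; apply/conv_bndP => s s0 /(fc s s0)[C fC].
by exists (C / s); exact: bnd_rstrip.
Qed.

Lemma conv_fock (f : S) r : 0 < r -> (r%:E < rho)%E -> f \in conv -> fock r f.
Proof.
by move=> r0 rr /conv_bndP/(_ r r0 rr)[C fC]; apply: bnd_is_fock fC; exact: ltW.
Qed.

Lemma convD (f1 f2 : S) : f1 \in conv -> f2 \in conv -> f1 + f2 \in conv.
Proof. exact: rpredD. Qed.

Lemma convM (f1 f2 : S) : f1 \in conv -> f2 \in conv -> f1 * f2 \in conv.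
Proof. exact: rpredM. Qed.

Definition comb (h : 'I_m -> S) : S := \sum_k g k * h k.

Definition combs : set S :=
  [set f | exists2 h : 'I_m -> S, (forall k, h k \in conv) & f = comb h].

Definition combs0 : set S :=
  [set f | exists2 h : 'I_m -> S, (forall k, h k \in conv /\ h k [::] = 0) & f = comb h].

(* The closures, in the Fock space of radius r, of the right ideal generated by
   the [g k] and of its products with the letters from the right. *)
Definition Mr r : set (l2 R) := hclosure (@l2dot R) (enc r @` combs).
Definition M0r r : set (l2 R) := hclosure (@l2dot R) (enc r @` combs0).

Lemma combs_conv f : combs f -> f \in conv.
Proof. by move=> [h hc ->]; apply: rpred_sum => k _; exact: convM. Qed.

Lemma combs0_combs : combs0 `<=` combs.
Proof. by move=> f [h hP ->]; exists h; [move=> k; case: (hP k)|reflexivity]. Qed.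

Lemma comb_linear h1 h2 a :
  comb h1 * const_series a + comb h2 = comb (fun k => h1 k * const_series a + h2 k).
Proof.
by rewrite /comb mulr_suml -big_split /=; apply: eq_bigr => k _; rewrite mulrDr mulrA.
Qed.

Lemma combs_linear a f1 f2 : combs f1 -> combs f2 -> combs (f1 * const_series a + f2).
Proof.
move=> [h1 h1c ->] [h2 h2c ->]; rewrite comb_linear; eexists; last reflexivity.
by move=> k; exact: convD (convM (h1c k) (conv_cst a)) (h2c k).
Qed.

Lemma combs0_linear a f1 f2 : combs0 f1 -> combs0 f2 -> combs0 (f1 * const_series a + f2).
Proof.
move=> [h1 h1c ->] [h2 h2c ->]; rewrite comb_linear; eexists; last reflexivity.
move=> k; have [c1 z1] := h1c k; have [c2 z2] := h2c k; split.
  exact: convD (convM c1 (conv_cst a)) c2.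
by rewrite -[LHS]/((h1 k * const_series a) [::] + h2 k [::]) z2 mul_nil z1 mul0r addr0.
Qed.

Lemma combs_mul f h : combs f -> h \in conv -> combs (f * h).
Proof.
move=> [k kc ->] hc; exists (fun i => k i * h); first by move=> i; exact: convM (kc i) hc.
by rewrite /comb mulr_suml; apply: eq_bigr => i _; rewrite mulrA.
Qed.

Lemma comb0 : comb (fun=> 0) = 0.
Proof. by rewrite /comb big1 // => k _; rewrite mulr0. Qed.

Section Level.
Variable r : R.
Hypotheses (r0 : 0 < r) (rr : (r%:E < rho)%E).
Let hl := l2_hilbert R.
Let ip := hilbert_ip hl.
Let r0' : 0 <= r := ltW r0.

Lemma enc0 : enc r (0 : S) = 0.
Proof.
have f0 : fock r (0 : S) := conv_fock r0 rr (rpred0 _).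
apply: (@fock_vecP _ d); [exact: fock_vec_enc|by []|] => w.
by rewrite enc_pickle // -[(0 : S) w]/(0 : R[i]) mul0r.
Qed.

Lemma enc_conv (f : S) w : f \in conv -> enc r f (pickle w) = f w * (r ^+ size w)%:C.
Proof. by move=> fc; exact: (enc_pickle w r0' (conv_fock r0 rr fc)). Qed.

Lemma enc_sub_subspace (P : set S) : P 0 -> (forall f, P f -> f \in conv) ->
  (forall a f1 f2, P f1 -> P f2 -> P (f1 * const_series a + f2)) -> subspace (enc r @` P).
Proof.
move=> P0 Pc Pl; split; first by exists 0 => //; exact: enc0.
move=> a _ _ [f1 f1P <-] [f2 f2P <-]; exists (f1 * const_series a + f2); first exact: Pl.
by rewrite (enc_linear _ r0' (conv_fock r0 rr (Pc _ f1P)) (conv_fock r0 rr (Pc _ f2P))).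
Qed.

Lemma enc_comb_cst (b : 'I_m -> R[i]) :
  enc r (comb (fun k => const_series (b k))) = \sum_k b k *: enc r (g k).
Proof.
have hb : comb (fun k => const_series (b k)) \in conv.
  by apply: rpred_sum => k _; exact: convM (g_conv k) (conv_cst (b k)).
apply: (@fock_vecP _ d); first exact: fock_vec_enc.
  apply: (subspace_sum _ (fock_vec_subspace _ _)) => k _.
  by apply: (subspaceZ _ (fock_vec_subspace _ _)); exact: fock_vec_enc.
move=> w; rewrite (enc_conv _ hb) /comb sum_seriesE l2_sumE mulr_suml.
apply: eq_bigr => k _.
rewrite -[RHS]/(b k * enc r (g k) (pickle w)) (enc_conv _ (g_conv k)).
by rewrite mul_cst mulrAC mulrC.
Qed.

Lemma Mr_subspace : subspace (Mr r).
Proof.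
apply: (hclosure_subspace hl); apply: enc_sub_subspace.
- by exists (fun=> 0); [move=> _; exact: rpred0|rewrite comb0].
- exact: combs_conv.
- exact: combs_linear.
Qed.

Lemma M0r_subspace : subspace (M0r r).
Proof.
apply: (hclosure_subspace hl); apply: enc_sub_subspace.
- by exists (fun=> 0); [move=> _; split=> //; exact: rpred0|rewrite comb0].
- by move=> f /combs0_combs; exact: combs_conv.
- exact: combs0_linear.
Qed.

Lemma M0r_closed : hclosure (@l2dot R) (M0r r) `<=` M0r r.
Proof. exact: hclosureK. Qed.

Lemma M0r_Mr : M0r r `<=` Mr r.
Proof.
move=> x Mx e e0; have [y [f fJ <-] xy] := Mx e e0; exists (enc r f) => //.
by exists f => //; exact: combs0_combs.
Qed.

Lemma Mr_fock_vec : Mr r `<=` fock_vec d.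
Proof. by apply: fock_vec_closed => _ [f _ <-]; exact: fock_vec_enc. Qed.

Lemma Mr_enc f : combs f -> Mr r (enc r f).
Proof. by move=> fJ; apply: (hclosure_sub hl); exists f. Qed.

Lemma M0r_enc f : combs0 f -> M0r r (enc r f).
Proof. by move=> fJ; apply: (hclosure_sub hl); exists f. Qed.

Lemma M0r_nil x : M0r r x -> x (pickle ([::] : seq 'I_d)) = 0.
Proof.
move=> Mx; apply: eq0_normc; apply/eqP; rewrite eq_le normc_ge0 andbT.
apply/ler_addgt0Pl => e /Mx[_ [f fJ <-] xm]; rewrite addr0; apply: le_trans (ltW xm).
apply: le_trans (l2_coord _ (pickle ([::] : seq 'I_d))).
rewrite -[X in _ <= normc X]/(x (pickle ([::] : seq 'I_d)) - enc r f (pickle ([::] : seq 'I_d))).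
rewrite (enc_conv _ (combs_conv (combs0_combs fJ))).
case: fJ => h hP ->; rewrite /comb sum_seriesE big1 ?mul0r ?subr0 // => k _.
by rewrite mul_nil; case: (hP k) => _ ->; rewrite mulr0.
Qed.

Lemma rstrip_combs0 f j : combs0 f -> combs (rstrip j f).
Proof.
move=> [h hP ->]; exists (fun k => rstrip j (h k)).
  by move=> k; apply: conv_rstrip; case: (hP k).
apply/funext => w; rewrite /rstrip /comb !sum_seriesE; apply: eq_bigr => k _.
by rewrite mul_rcons; case: (hP k) => _ ->; rewrite mulr0 addr0.
Qed.

(** Stripping sends [combs0] into [combs] and is bounded by [r^-1], so the inclusion passes to the
    closures. The remainder of a division can thus be divided again. *)
Lemma strip_M0r x (j : 'I_d) : M0r r x -> Mr r (strip r j x).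
Proof.
move=> Mx e e0; have [_ [f fJ <-] xf] := Mx (e * r) ltac:(by rewrite mulr_gt0).
have ff := conv_fock r0 rr (combs_conv (combs0_combs fJ)).
exists (strip r j (enc r f)).
  by exists (rstrip j f); [exact: rstrip_combs0|rewrite /strip dec_enc].
have -> : strip r j x - strip r j (enc r f) = strip r j (x - enc r f).
  by rewrite addrC -scaleN1r -strip_linear // scaleN1r addrC.
apply: le_lt_trans (strip_norm1 _ r0 _) _; last by rewrite ltr_pdivrMr.
apply: (subspaceB (fock_vec_subspace _ _)); last exact: fock_vec_enc.
exact/Mr_fock_vec/M0r_Mr.
Qed.

(** * Division by a finite basis modulo [M0r] *)

Section Basis.
Variables (n : nat) (tau : 'I_n -> 'I_m).
Local Notation gam := (fun k => enc r (g (tau k))).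
Hypothesis indep : forall c : 'I_n -> R[i],
  M0r r (\sum_k c k *: gam k) -> forall k, c k = 0.
Hypothesis spanning : forall k : 'I_m, exists c : 'I_n -> R[i],
  M0r r (enc r (g k) - \sum_l c l *: gam l).

Lemma combs_g k : combs (g k).
Proof.
exists (fun l => (l == k)%:R) => [l|]; first by case: (l == k); rewrite ?rpred1 ?rpred0.
rewrite /comb (bigD1 k) //= eqxx mulr1 big1 ?addr0 // => l lk.
by rewrite (negbTE lk) mulr0.
Qed.

Lemma wandering_exists : exists theta : 'I_n -> l2 R, forall k,
  M0r r (gam k - theta k) /\ forall x, M0r r x -> l2dot (theta k) x = 0.
Proof.
suff /choice[th thP] : forall k, exists t, M0r r (gam k - t) /\
    forall x, M0r r x -> l2dot t x = 0 by exists th.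
move=> k; have [p Mp pP] := projection hl (gam k) M0r_subspace M0r_closed.
exists (gam k - p); split; [rewrite opprB addrC subrK; exact: Mp|exact: pP].
Qed.

Variable theta : 'I_n -> l2 R.
Hypothesis theta_gam : forall k, M0r r (gam k - theta k).
Hypothesis theta_perp : forall k x, M0r r x -> l2dot (theta k) x = 0.

Lemma theta_Mr k : Mr r (theta k).
Proof.
rewrite -[theta k](subKr (gam k)); apply: (subspaceB Mr_subspace).
  by apply: Mr_enc; exact: combs_g.
exact: M0r_Mr.
Qed.

Definition theta_comb (c : 'I_n -> R[i]) : l2 R := \sum_k c k *: theta k.

Lemma theta_comb_perp c x : M0r r x -> l2dot (theta_comb c) x = 0.
Proof.
move=> Mx; rewrite (dot_suml ip) big1 // => k _.
by rewrite (dotZl ip) theta_perp // mulr0.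
Qed.

Definition gram : 'M[R[i]]_n := \matrix_(k, l) l2dot (theta k) (theta l).

(** A row vector [c] killed by the Gram matrix makes [theta_comb c] a vector of norm 0, so the same
    combination of the [gam k] lies in [M0r], against independence. *)
Lemma gram_unit : gram \in unitmx.
Proof.
rewrite -row_free_unit; apply/row_freeP/row_freeP/inj_row_free => v vG.
pose c k := v ord0 k.
have tc0 : theta_comb c = 0.
  apply: (hnorm_eq0 ip); apply/eqP; rewrite -sqrf_eq0 (hnorm_sqr ip).
  rewrite {2}/theta_comb (dot_sumr ip) big1 // => l _.
  rewrite (dotZr ip) (dot_suml ip).
  have := congr1 (fun M : 'rV_n => M ord0 l) vG; rewrite !mxE => vGl.
  rewrite (eq_bigr (fun k => v ord0 k * gram k l)) ?vGl ?mulr0 // => k _.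
  by rewrite (dotZl ip) mxE.
have : M0r r (\sum_k c k *: gam k).
  rewrite (_ : \sum_k _ = \sum_k c k *: (gam k - theta k)).
    apply: (subspace_sum _ M0r_subspace) => k _; apply: (subspaceZ _ M0r_subspace).
    exact: theta_gam.
  under [RHS]eq_bigr do rewrite scalerBr.
  by rewrite sumrB -/(theta_comb c) tc0 subr0.
by move/indep => c0; apply/rowP => k; rewrite mxE; exact: c0.
Qed.

(** Coordinates of the orthogonal projection of [e] onto the span of the [theta k]; the inverse Gram
    matrix appears because these are not orthonormal. *)
Definition coef (e : l2 R) (k : 'I_n) : R[i] :=
  \sum_l l2dot e (theta l) * invmx gram l k.

Lemma coef_linear a x y k : coef (a *: x + y) k = a * coef x k + coef y k.
Proof.
rewrite /coef mulr_sumr -big_split /=; apply: eq_bigr => l _.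
by rewrite (dotPl ip) mulrDl mulrA.
Qed.

Lemma coef_M0r x k : M0r r x -> coef x k = 0.
Proof.
move=> Mx; rewrite /coef big1 // => l _.
by rewrite (dotC ip) theta_perp // raddf0 mul0r.
Qed.

Lemma coef_theta_comb c k : coef (theta_comb c) k = c k.
Proof.
pose v : 'rV_n := \row_l c l.
have -> : c k = (v *m gram *m invmx gram) ord0 k by rewrite mulmxK ?gram_unit // mxE.
rewrite [RHS]mxE; apply: eq_bigr => l _; congr (_ * _).
rewrite (dot_suml ip) mxE; apply: eq_bigr => i _.
by rewrite (dotZl ip) !mxE.
Qed.

Definition rest e : l2 R := e - theta_comb (coef e).

Lemma rest_linear a x y : rest (a *: x + y) = a *: rest x + rest y.
Proof.
rewrite /rest scalerBr addrACA -opprD; congr (_ - _).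
rewrite /theta_comb scaler_sumr -big_split /=; apply: eq_bigr => k _.
by rewrite coef_linear scalerDl scalerA.
Qed.

Definition coef_bound k : R := \sum_l norm2 (theta l) * normc (invmx gram l k).

Lemma coef_bound_ge0 k : 0 <= coef_bound k.
Proof. by apply: sumr_ge0 => l _; rewrite mulr_ge0 ?hnorm_ge0 ?normc_ge0. Qed.

Lemma coef_le e k : normc (coef e k) <= coef_bound k * norm2 e.
Proof.
apply: le_trans (normc_sum _ _ _) _; rewrite mulr_suml; apply: ler_sum => l _.
rewrite normcM mulrAC; apply: ler_wpM2r; first exact: normc_ge0.
by rewrite mulrC; exact: cauchy_schwarz.
Qed.

Lemma rest_le e : norm2 (rest e) <=
  (1 + \sum_k coef_bound k * norm2 (theta k)) * norm2 e.
Proof.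
apply: le_trans (hnormD ip _ _) _; rewrite (hnormN ip) mulrDl mul1r lerD2l.
apply: le_trans (hnorm_sum ip _ _ _) _; rewrite mulr_suml; apply: ler_sum => k _.
rewrite (hnormZ ip) mulrAC; apply: ler_wpM2r; first exact: hnorm_ge0.
exact: coef_le.
Qed.

(** For an element of [combs], only the constant terms [b k] of its coefficients count modulo [M0r];
    [spanning] reduces the [g k] to the [gam l], and these are congruent to the [theta l]. The bound
    [rest_le] extends the claim to the closure. *)
Lemma rest_Mr e : Mr r e -> M0r r (rest e).
Proof.
have key f : combs f -> M0r r (rest (enc r f)).
  move=> [h hc ->]; suff [c cP] : exists c, M0r r (enc r (comb h) - theta_comb c).
    rewrite /rest (_ : coef (enc r (comb h)) = c) //; apply/funext => k.
    rewrite -[enc r _](subrK (theta_comb c)) -[X in coef (X + _)]scale1r.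
    by rewrite coef_linear coef_M0r // mulr0 add0r coef_theta_comb.
  pose b k := h k [::].
  have /choice[sp spP] := spanning.
  exists (fun l => \sum_k b k * sp k l).
  have E : \sum_k b k *: \sum_l sp k l *: gam l = \sum_l (\sum_k b k * sp k l) *: gam l.
    under eq_bigr do rewrite scaler_sumr.
    rewrite exchange_big; apply: eq_bigr => l _; rewrite scaler_suml.
    by apply: eq_bigr => k _; rewrite scalerA.
  rewrite -(subrKA (\sum_k b k *: enc r (g k))); apply: (subspaceD M0r_subspace).
    have hb : comb (fun k => const_series (b k)) \in conv.
      apply: combs_conv; exists (fun k => const_series (b k)); last reflexivity.
      by move=> k; exact: conv_cst.
    have hh : comb h \in conv by apply: combs_conv; exists h; [exact: hc|reflexivity].
    rewrite -enc_comb_cst addrC -scaleN1r.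
    rewrite -(enc_linear _ r0' (conv_fock r0 rr hb) (conv_fock r0 rr hh)).
    rewrite comb_linear; apply: M0r_enc; eexists; last reflexivity.
    move=> k /=; split; first exact: convD (convM (conv_cst (b k)) (conv_cst (-1))) (hc k).
    rewrite -[LHS]/((const_series (b k) * const_series (-1)) [::] + h k [::]) mul_nil.
    by rewrite /const_series /= mulrN1 addNr.
  rewrite -(subrKA (\sum_l (\sum_k b k * sp k l) *: gam l)).
  apply: (subspaceD M0r_subspace).
    rewrite -E -sumrB; apply: (subspace_sum _ M0r_subspace) => k _.
    by rewrite -scalerBr; apply: (subspaceZ _ M0r_subspace).
  rewrite -sumrB; apply: (subspace_sum _ M0r_subspace) => l _.
  by rewrite -scalerBr; apply: (subspaceZ _ M0r_subspace); exact: theta_gam.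
move=> Me; apply: M0r_closed => ep ep0.
set K := 1 + \sum_k coef_bound k * norm2 (theta k).
have K0 : 0 < K.
  rewrite ltr_wpDr // sumr_ge0 // => k _.
  by rewrite mulr_ge0 ?coef_bound_ge0 ?hnorm_ge0.
have [_ [f fJ <-] ef] := Me (ep / K) ltac:(by rewrite divr_gt0).
exists (rest (enc r f)); first exact: key.
have -> : rest e - rest (enc r f) = rest (e - enc r f).
  by rewrite addrC -scaleN1r -rest_linear scaleN1r addrC.
apply: le_lt_trans (rest_le _) _; by rewrite -/K mulrC -ltr_pdivlMr.
Qed.

Definition step (j : 'I_d) e : l2 R := strip r j (rest e).

Lemma step_Mr j e : Mr r e -> Mr r (step j e).
Proof. by move=> Me; apply: strip_M0r; exact: rest_Mr. Qed.

(* The letters of a word are read from right to left. *)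
Definition quotient_coef k e : S :=
  fun w => coef (foldl (fun x j => step j x) e (rev w)) k.

Lemma quotient_coef_rcons k e j :
  rstrip j (quotient_coef k e) = quotient_coef k (step j e).
Proof. by apply/funext => w; rewrite /rstrip /quotient_coef rev_rcons. Qed.

(* Wold decomposition: the [theta k] span the orthogonal complement of M0r in Mr,
   and a remainder in M0r is a sum of elements of Mr times letters. *)
Lemma quotient_coefE e : Mr r e ->
  dec r e = \sum_k dec r (theta k) * quotient_coef k e.
Proof.
move=> Me; apply/funext => w; rewrite sum_seriesE.
have split_e x v : dec r x v = \sum_k coef x k * dec r (theta k) v + dec r (rest x) v.
  rewrite -{1}(subrK (theta_comb (coef x)) x) -/(rest x) addrC /dec.
  rewrite -[X in X * _]/(theta_comb (coef x) (pickle v) + rest x (pickle v)) mulrDl.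
  by rewrite l2_sumE mulr_suml; congr (_ + _); apply: eq_bigr => k _; rewrite mulrA.
elim/last_ind: w e Me => [|w j IH] e Me.
  rewrite split_e {2}/dec M0r_nil ?mul0r ?addr0; last exact: rest_Mr.
  by apply: eq_bigr => k _; rewrite mul_nil mulrC.
rewrite split_e -[dec r (rest e) _]/(rstrip j (dec r (rest e)) w).
have fre : fock r (rstrip j (dec r (rest e))) by apply/fock_rstrip/fock_dec.
rewrite -(dec_enc r0 fre) -/(strip r j (rest e)) -/(step j e) IH; last exact: step_Mr.
rewrite -big_split /=; apply: eq_bigr => k _.
by rewrite mul_rcons quotient_coef_rcons addrC mulrC.
Qed.

(** Since the [theta k] are orthogonal to [M0r], Pythagoras splits the squared norm of [e] exactly:
    one part pays for the constant terms, and [strip_norm] distributes that of [rest e] over the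
    letters. Hence the constant does not grow from degree to degree. *)
Lemma quotient_coef_sqw e N : Mr r e ->
  \sum_k sqw r (quotient_coef k e) N <= (\sum_k coef_bound k ^+ 2) * norm2 e ^+ 2.
Proof.
set K := \sum_k coef_bound k ^+ 2.
have K0 : 0 <= K by apply: sumr_ge0 => k _; exact: sqr_ge0.
elim: N e => [|N IH] e Me.
  rewrite big1 ?(mulr_ge0 K0 (sqr_ge0 _)) // => k _.
  by rewrite /sqw big_ord0.
under eq_bigr do rewrite sqw_rstrip.
rewrite big_split /=; pose y := theta_comb (coef e).
have ey : norm2 e ^+ 2 = norm2 y ^+ 2 + norm2 (rest e) ^+ 2.
  rewrite -(hnorm_pythagoras ip); last by apply: theta_comb_perp; exact: rest_Mr.
  by rewrite addrC subrK.
rewrite ey mulrDr; apply: lerD.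
  rewrite mulr_suml; apply: ler_sum => k _; rewrite -exprMn lerXn2r ?nnegrE ?normc_ge0 //.
    by rewrite mulr_ge0 ?coef_bound_ge0 ?hnorm_ge0.
  by have := coef_le y k; rewrite coef_theta_comb.
have re := rest_Mr Me.
rewrite -mulr_sumr exchange_big /=.
apply: (@le_trans _ _ (r ^+ 2 * \sum_(j < d) K * norm2 (step j e) ^+ 2)).
  apply: ler_wpM2l; first exact: sqr_ge0.
  apply: ler_sum => j _; under eq_bigr do rewrite quotient_coef_rcons.
  by apply: IH; exact: step_Mr.
rewrite -mulr_sumr mulrCA; apply: ler_wpM2l => //; apply: strip_norm => //.
exact/Mr_fock_vec/M0r_Mr.
Qed.

End Basis.
End Level.
End Wold.

(** * Matrices of power series and the inversion of 1 - U *)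

Section SeriesMatrices.
Variables (R : realType) (d : nat).
Local Notation S := (ncseries R d).
Implicit Types (f g : S) (s : R).

Definition agree N f g := forall w, (size w <= N)%N -> f w = g w.

Lemma agree_mul N f g h : agree N g h -> agree N (f * g) (f * h).
Proof.
move=> gh w wN; rewrite !mul_seriesE; apply: eq_bigr => i _; rewrite gh //.
by rewrite size_drop; apply: leq_trans wN; exact: leq_subr.
Qed.

Lemma agree_sym N f g : agree N f g -> agree N g f.
Proof. by move=> fg w wN; rewrite fg. Qed.

Lemma agree_add N f g f' g' : agree N f f' -> agree N g g' -> agree N (f + g) (f' + g').
Proof.
move=> ff gg w wN; rewrite -[LHS]/(f w + g w) -[RHS]/(f' w + g' w).
by rewrite ff // gg.
Qed.

Lemma agree_sum (I : Type) (r : seq I) (P : pred I) N (F G : I -> S) :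
  (forall i, P i -> agree N (F i) (G i)) ->
  agree N (\sum_(i <- r | P i) F i) (\sum_(i <- r | P i) G i).
Proof. by move=> FG w wN; rewrite !sum_seriesE; apply: eq_bigr => i Pi; rewrite FG. Qed.

Lemma wsum_agree s f g N : agree N f g -> wsum s f N.+1 = wsum s g N.+1.
Proof.
move=> fg; apply: eq_bigr => l _; congr (_ * _); apply: eq_hom_norm => w wl.
by apply: fg; rewrite wl -ltnS.
Qed.

Definition magree p q N (A B : 'M[S]_(p, q)) := forall i j, agree N (A i j) (B i j).

Lemma magree_mul p q t N (A : 'M[S]_(p, q)) (B C : 'M[S]_(q, t)) :
  magree N B C -> magree N (A *m B) (A *m C).
Proof.
by move=> BC i j; rewrite !mxE; apply: agree_sum => k _; apply: agree_mul; exact: BC.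
Qed.

(** Summing over all entries is crude but keeps the norm submultiplicative for matrix products
    ([mwsumM]). *)
Definition mwsum s p q (A : 'M[S]_(p, q)) N : R := \sum_i \sum_j wsum s (A i j) N.

Lemma mwsum_ge0 s p q (A : 'M[S]_(p, q)) N : 0 <= s -> 0 <= mwsum s A N.
Proof. by move=> s0; apply: sumr_ge0 => i _; apply: sumr_ge0 => j _; exact: wsum_ge0. Qed.

Lemma mwsum_entry s p q (A : 'M[S]_(p, q)) N i j : 0 <= s ->
  wsum s (A i j) N <= mwsum s A N.
Proof.
move=> s0; rewrite /mwsum (bigD1 i) //= (bigD1 j) //= -addrA lerDl addr_ge0 //.
  by apply: sumr_ge0 => k _; exact: wsum_ge0.
by apply: sumr_ge0 => k _; apply: sumr_ge0 => l _; exact: wsum_ge0.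
Qed.

Lemma mwsumD s p q (A B : 'M[S]_(p, q)) N : 0 <= s ->
  mwsum s (A + B) N <= mwsum s A N + mwsum s B N.
Proof.
move=> s0; rewrite /mwsum -big_split /=; apply: ler_sum => i _.
by rewrite -big_split /=; apply: ler_sum => j _; rewrite mxE wsumD.
Qed.

Lemma mwsumM s p q t (A : 'M[S]_(p, q)) (B : 'M[S]_(q, t)) N : 0 <= s ->
  mwsum s (A *m B) N <= mwsum s A N * mwsum s B N.
Proof.
move=> s0.
apply: (@le_trans _ _ (\sum_k (\sum_i wsum s (A i k) N) * (\sum_j wsum s (B k j) N))).
  under [leRHS]eq_bigr do rewrite big_distrlr /=.
  rewrite [leRHS]exchange_big /=; apply: ler_sum => i _.
  rewrite [leRHS]exchange_big /=; apply: ler_sum => j _; rewrite mxE.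
  apply: le_trans (wsum_sum _ _ _ _ s0) _; apply: ler_sum => k _; exact: wsumM.
rewrite /mwsum [X in X * _]exchange_big /= mulr_suml; apply: ler_sum => k _.
apply: ler_wpM2l; first by apply: sumr_ge0 => i _; exact: wsum_ge0.
rewrite [leRHS](bigD1 k) //= lerDl; apply: sumr_ge0 => l _; apply: sumr_ge0 => j _.
exact: wsum_ge0.
Qed.

Definition mbounded s p q (A : 'M[S]_(p, q)) := forall i j, exists C, bnd s (A i j) C.

Lemma bounded_sum s (I : finType) (P : pred I) (F : I -> S) : 0 <= s ->
  (forall i, exists C, bnd s (F i) C) -> exists C, bnd s (\sum_(i | P i) F i) C.
Proof.
move=> s0 /choice[C FC]; exists (\sum_(i | P i) C i) => N.
by apply: le_trans (wsum_sum _ _ _ _ s0) _; apply: ler_sum => i _; exact: FC.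
Qed.

Lemma mboundedM s p q t (A : 'M[S]_(p, q)) (B : 'M[S]_(q, t)) : 0 <= s ->
  mbounded s A -> mbounded s B -> mbounded s (A *m B).
Proof.
move=> s0 bA bB i j; rewrite mxE; apply: bounded_sum => // k.
by have [C AC1] := bA i k; have [D BD1] := bB k j; exists (C * D); exact: bndM.
Qed.

Lemma mboundedD s p q (A B : 'M[S]_(p, q)) : 0 <= s ->
  mbounded s A -> mbounded s B -> mbounded s (A + B).
Proof.
move=> s0 bA bB i j; have [C AC1] := bA i j; have [D BD1] := bB i j.
by exists (C + D); rewrite mxE; exact: bndD.
Qed.

Lemma mboundedN s p q (A : 'M[S]_(p, q)) : mbounded s A -> mbounded s (- A).
Proof.
by move=> bA i j; have [C AC1] := bA i j; exists C => N; rewrite mxE wsumN; exact: AC1.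
Qed.

Lemma mbounded_mwsum s p q (A : 'M[S]_(p, q)) : mbounded s A ->
  exists2 C, 0 <= C & forall N, mwsum s A N <= C.
Proof.
move=> bA; have /choice[C CP] (ij : 'I_p * 'I_q) : exists C, bnd s (A ij.1 ij.2) C by exact: bA.
exists (\sum_i \sum_j C (i, j)) => [|N].
  by apply: sumr_ge0 => i _; apply: sumr_ge0 => j _; exact: bnd_ge0 (CP (i, j)).
by apply: ler_sum => i _; apply: ler_sum => j _; exact: (CP (i, j)).
Qed.

Lemma one_seriesE : (1 : S) = const_series 1.
Proof. by apply/funext => w; rewrite -[LHS]/((w == [::])%:R) /const_series; case: eqP. Qed.

Lemma mwsum1 s n N : mwsum s (1%:M : 'M[S]_n) N <= n%:R.
Proof.
apply: (@le_trans _ _ (\sum_(i < n) 1)); last by rewrite sumr_const card_ord.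
apply: ler_sum => i _; rewrite (bigD1 i) //= big1 ?addr0 => [|j ji].
  by rewrite mxE eqxx mulr1n one_seriesE; have := bnd_cst d s (1 : R[i]) N; rewrite normc1.
by rewrite mxE eq_sym (negbTE ji) mulr0n wsum0.
Qed.

Lemma mbounded1 s n : mbounded s (1%:M : 'M[S]_n).
Proof.
move=> i j; rewrite mxE; case: (i == j); last by exists 0 => N; rewrite mulr0n wsum0.
by exists (normc (1 : R[i])); rewrite mulr1n one_seriesE; exact: bnd_cst.
Qed.

Lemma mbounded_le s t p q (A : 'M[S]_(p, q)) : 0 <= s -> s <= t ->
  mbounded t A -> mbounded s A.
Proof.
move=> s0 st bA i j; have [C AC1] := bA i j; exists C => N.
by apply: le_trans (AC1 N); exact: wsum_le_radius.
Qed.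

(* As U has no constant term, the iterates of [V |-> 1 + U V] stabilise
   degreewise, so that (1 - U)^-1 exists without any passage to the limit. *)
Section Neumann.
Variables (n : nat) (U : 'M[S]_n).
Hypothesis U_nil : forall i j, U i j [::] = 0.

Fixpoint neumann_iter N : 'M[S]_n := if N is N'.+1 then 1%:M + U *m neumann_iter N' else 1%:M.

(** A left factor without constant term raises the order of vanishing by one. *)
Lemma mul_vanish f g N : f [::] = 0 -> (forall w, (size w < N)%N -> g w = 0) ->
  forall w, (size w < N.+1)%N -> (f * g) w = 0.
Proof.
move=> f0 g0 w wN; rewrite mul_seriesE big1 // => -[[|i] /= iw] _.
  by rewrite take0 f0 mul0r.
rewrite g0 ?mulr0 // size_drop; move: iw; rewrite ltnS => iw.
by rewrite ltn_subLR // addSn ltnS; apply: leq_trans (leq_addl _ _); rewrite -ltnS.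
Qed.

Lemma neumann_stable N M : (N <= M)%N -> magree N (neumann_iter M) (neumann_iter N).
Proof.
(* Each difference of consecutive iterates is [U] times the preceding one, so its order of vanishing
   rises by one every time. *)
have step k i j w : (size w < k.+1)%N -> (neumann_iter k.+1 - neumann_iter k) i j w = 0.
  elim: k i j w => [|k IH] i j w wk.
    rewrite /= mulmx1 addrAC subrr add0r.
    by case: w wk => // _; exact: U_nil.
  have -> : neumann_iter k.+2 - neumann_iter k.+1 = U *m (neumann_iter k.+1 - neumann_iter k).
    by rewrite mulmxBr /= opprD addrACA subrr add0r.
  rewrite mxE sum_seriesE big1 // => l _; apply: (@mul_vanish _ _ k.+1) => // v vk.
  exact: IH.
move=> /subnKC <-; elim: (M - N)%N => [|p IH] i j w wN; first by rewrite addn0.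
have subE (A B : 'M[S]_n) : (A - B) i j w = A i j w - B i j w.
  by rewrite mxE [X in (_ + X) w]mxE.
rewrite -IH // addnS; have := step (N + p)%N i j w; rewrite ltnS subE.
by move=> /(_ (leq_trans wN (leq_addr _ _))) /eqP; rewrite subr_eq0 => /eqP.
Qed.

Definition neumann : 'M[S]_n := \matrix_(i, j) (fun w => neumann_iter (size w) i j w).

Lemma neumann_agree N : magree N neumann (neumann_iter N).
Proof. by move=> i j w wN; rewrite mxE; apply/esym/neumann_stable. Qed.

Lemma neumannE : neumann = 1%:M + U *m neumann.
Proof.
apply/matrixP => i j; apply/funext => w.
rewrite (@neumann_agree (size w).+1) // [neumann_iter _]/= [X in X w = _]mxE [X in _ = X w]mxE.
apply: agree_add (leqnn (size w)) => // v vw.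
by apply/esym; apply: magree_mul vw; exact: neumann_agree.
Qed.

Lemma neumann_nil i j : neumann i j [::] = (i == j)%:R.
Proof. by rewrite mxE /= mxE; case: (i == j). Qed.

Lemma neumann_bounded s : 0 <= s -> (forall N, mwsum s U N <= 2^-1) ->
  mbounded s neumann.
Proof.
(* The norms obey [a' <= n + a / 2], and [2 n] is the fixed point of this recursion. *)
move=> s0 Us; have it k N : mwsum s (neumann_iter k) N <= 2 * n%:R.
  have n0 : 0 <= n%:R :> R by exact: ler0n.
  elim: k => [|k IH] /=; first by have := @mwsum1 s n N; lra.
  apply: le_trans (mwsumD _ _ _ s0) _; have := @mwsum1 s n N.
  have := mwsumM U (neumann_iter k) N s0; have := Us N.
  have := mwsum_ge0 U N s0; have := mwsum_ge0 (neumann_iter k) N s0; nra.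
move=> i j; exists (2 * n%:R) => N; apply: le_trans (it N N).
apply: le_trans (mwsum_entry _ _ i j s0); case: N => [|N].
  by rewrite /wsum !big_ord0.
(* The sum up to [N.+1] reads only degrees at most [N], where [neumann] coincides with the
   iterate. *)
rewrite le_eqVlt; apply/orP; left; apply/eqP/wsum_agree => w wN.
by apply: (@neumann_agree N.+1); exact: leqW.
Qed.

End Neumann.
End SeriesMatrices.

(** * Solving in terms of the generators on a slightly smaller ball *)

Section Level.
Variables (R : realType) (d : nat) (rho : \bar R) (m : nat).
Local Notation S := (ncseries R d).
Local Notation norm2 := (hnorm (@l2dot R)).
Local Notation conv := (@conv_pred R d rho).
Variable g : 'I_m -> S.
Hypothesis g_conv : forall k, g k \in conv.

Definition gen_row : 'rV[S]_m := \row_k g k.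

Lemma comb_mx (h : 'cV[S]_m) : (gen_row *m h) ord0 ord0 = comb g (fun k => h k ord0).
Proof. by rewrite mxE; apply: eq_bigr => k _; rewrite mxE. Qed.

(** [B] is [H *m V]: [H] expresses approximations of the [th k] through the generators, and the
    Neumann inverse [V] removes the error exactly. The constant terms are recorded for
    [syzygy_trivial]; they are those of [H], since [V] has the identity as constant term. *)
Lemma level (r s : R) (n : nat) (tau : 'I_n -> 'I_m) :
  0 < s -> s < r -> (r%:E < rho)%E ->
  (forall c : 'I_n -> R[i], M0r rho g r (\sum_k c k *: enc r (g (tau k))) ->
    forall k, c k = 0) ->
  (forall k : 'I_m, exists c : 'I_n -> R[i],
    M0r rho g r (enc r (g k) - \sum_l c l *: enc r (g (tau l)))) ->
  exists B : 'M[S]_(m, n),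
  [/\ mbounded s B,
      forall l k, B l k [::] = (l == tau k)%:R &
      forall f, f \in conv -> Mr rho g r (enc r f) ->
        exists2 u : 'cV[S]_n, mbounded s u & f%:M = gen_row *m B *m u].
Proof.
move=> s0 sr rr indep spanning.
have r0 : 0 < r by apply: lt_trans sr.
have srho : (s%:E < rho)%E by apply: lt_trans rr; rewrite lte_fin.
have hl := l2_hilbert R; have ip := hilbert_ip hl.
have [th thP] := wandering_exists g_conv r0 rr tau.
have th_gam k : M0r rho g r (enc r (g (tau k)) - th k) by case: (thP k).
have th_perp k x : M0r rho g r x -> l2dot (th k) x = 0 by case: (thP k) => _; apply.
have sM0 := M0r_subspace g_conv r0 rr.
have Mth := theta_Mr g_conv r0 rr th_gam.
pose t : 'rV[S]_n := \row_k dec r (th k).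
pose K := Num.sqrt (\sum_k coef_bound th k ^+ 2).
have K0 : 0 <= K by exact: sqrtr_ge0.
have quot_bnd e k : Mr rho g r e -> bnd s (quotient_coef r th k e : S) (K * norm2 e / (1 - s / r)).
  move=> Me; apply: bnd_fock => //; first by rewrite mulr_ge0 ?hnorm_ge0.
  move=> N; rewrite exprMn sqr_sqrtr ?sumr_ge0 // => [|i _]; last exact: sqr_ge0.
  apply: le_trans _ (quotient_coef_sqw g_conv r0 rr indep spanning th_gam th_perp N Me).
  by rewrite (bigD1 k) //= lerDl sumr_ge0 // => i _; exact: sqw_ge0.
(* The [n * n] entries of [U] will each be at most [K (2 L)^-1 / (1 - s / r)]; their bounds sum to
   [(L - 1) / (2 L)], below one half. The final 1 keeps [L] positive. *)
pose L := (K / (1 - s / r)) * (n%:R * n%:R) + 1.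
have q0 : 0 < 1 - s / r by rewrite subr_gt0 ltr_pdivrMr ?mul1r.
have L0 : 0 < L by rewrite ltr_wpDl // mulr_ge0 ?divr_ge0 ?mulr_ge0 // ltW.
(* [th k] differs from its generator by an element of [M0r], so it is approximated by correcting the
   generator with coefficients free of constant terms. *)
have /choice[h hP] : forall k, exists h : 'I_m -> S,
    (forall l, h l \in conv /\ h l [::] = 0) /\
    norm2 (th k - enc r (g (tau k)) - enc r (comb g h)) < (2 * L)^-1.
  move=> k; have : M0r rho g r (th k - enc r (g (tau k))).
    by rewrite -opprB -scaleN1r; apply: (subspaceZ _ sM0); exact: th_gam.
  move=> /(_ (2 * L)^-1); rewrite invr_gt0 mulr_gt0 // => /(_ isT)[_ [_ [h hc ->] <-] hn].
  by exists h.
pose H : 'M[S]_(m, n) := \matrix_(l, k) ((l == tau k)%:R + h k l).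
pose x k := th k - enc r (g (tau k)) - enc r (comb g (h k)).
have Mx k : M0r rho g r (x k).
  apply: (subspaceB sM0).
    by rewrite -opprB -scaleN1r; apply: (subspaceZ _ sM0).
  by apply: M0r_enc; exists (h k) => // l; case: (hP k) => /(_ l).
pose U : 'M[S]_n := \matrix_(i, k) quotient_coef r th i (x k).
(* The errors [x j] lie in [M0r], on which [coef] vanishes; this is the condition under which the
   Neumann iteration stabilises. *)
have U_nil i j : U i j [::] = 0.
  by rewrite mxE /quotient_coef /=; apply: coef_M0r (Mx j).
(* Column [k] of the left side is [th k] minus the error [x k], and dividing [x k] by the [th i]
   yields column [k] of [t *m U]. *)
have gH : gen_row *m H = t *m (1%:M - U).
  apply/rowP => k; rewrite mulmxBr mulmx1 !mxE.
  under [X in _ = _ - X]eq_bigr do rewrite !mxE.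
  rewrite -(quotient_coefE g_conv r0 rr indep spanning th_gam th_perp (M0r_Mr (Mx k))).
  have fg : fock r (g (tau k)) := conv_fock r0 rr (g_conv _).
  have fh : fock r (comb g (h k)).
    apply: (conv_fock r0 rr); apply: combs_conv => //.
    by exists (h k); [move=> l; case: (hP k) => /(_ l)[]|reflexivity].
  rewrite /x !decB (dec_enc r0 fg) (dec_enc r0 fh).
  rewrite opprB opprB addrCA [dec _ _ + _]addrC subrK addrC /comb.
  under eq_bigr do rewrite !mxE mulrDr.
  rewrite big_split /= (bigD1 (tau k)) //= eqxx mulr1 big1 ?addr0 // => l lk.
  by rewrite (negbTE lk) mulr0.
have Us N : mwsum s U N <= 2^-1.
  apply: (@le_trans _ _ (\sum_(i < n) \sum_(j < n) (K * (2 * L)^-1 / (1 - s / r)))).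
    apply: ler_sum => i _; apply: ler_sum => j _; rewrite mxE.
    apply: le_trans (quot_bnd _ i (M0r_Mr (Mx j)) N) _.
    apply: ler_wpM2r; first by rewrite invr_ge0 ltW.
    by apply: ler_wpM2l => //; apply: ltW; case: (hP j).
  rewrite !sumr_const !card_ord -!mulrnA -[X in X <= _]mulr_natr natrM.
  rewrite (_ : _ * _ = (L - 1) / (2 * L)); last by rewrite /L addrK; ring.
  by rewrite ler_pdivrMr ?mulr_gt0 //; lra.
pose V := neumann U.
have tE : t = gen_row *m (H *m V).
  rewrite mulmxA gH -mulmxA mulmxBl mul1mx {1}/V (neumannE U_nil) -/V.
  by rewrite addrK mulmx1.
exists (H *m V); split.
- apply: mboundedM; [exact: ltW| |].
    move=> l k; rewrite mxE; apply: (proj1 (conv_bndP rho _)) => //.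
    by apply: convD; [exact: rpred_nat|case: (hP k) => /(_ l)[]].
  by apply: neumann_bounded => //; exact: ltW.
- move=> l k; rewrite mxE sum_seriesE (bigD1 k) //= big1 ?addr0 => [|i ik].
    rewrite mul_nil neumann_nil eqxx mulr1 mxE.
    rewrite -[LHS]/(((l == tau k)%:R : S) [::] + h k l [::]).
    have [/(_ l)[_ ->] _] := hP k; rewrite addr0.
    by case: (l == tau k).
  by rewrite mul_nil neumann_nil (negbTE ik) mulr0.
move=> f fc Mf; exists (\col_k quotient_coef r th k (enc r f)).
  by move=> k l; rewrite mxE; eexists; exact: quot_bnd.
rewrite -tE; apply/matrixP => i j; rewrite !ord1 !mxE eqxx mulr1n.
have fr : fock r f by apply: conv_fock fc.
rewrite -[LHS](dec_enc r0 fr).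
rewrite (quotient_coefE g_conv r0 rr indep spanning th_gam th_perp Mf).
by apply: eq_bigr => k _; rewrite !mxE.
Qed.

End Level.

(** * Gluing solutions on an exhaustion by balls *)

Lemma exhaustion (R : realType) (rho : \bar R) (r0 : R) : (r0%:E < rho)%E ->
  exists s : nat -> R, [/\ forall i, r0 < s i, forall i, s i < s i.+1,
    forall i, ((s i)%:E < rho)%E & forall t, (t%:E < rho)%E -> exists i, t <= s i].
Proof.
case: rho => [x| |//]; last first.
  move=> _; exists (fun i => r0 + i.+1%:R); split=> [i|i|i|t _].
  - by rewrite ltrDl ltr0n.
  - by rewrite ltrD2l ltr_nat.
  - exact: ltry.
  exists (Num.bound `|t - r0|); rewrite -lerBlDl; apply: le_trans (ler_norm _) _.
  apply: ltW; apply: lt_trans (archi_boundP (normr_ge0 _)) _; by rewrite ltr_nat.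
rewrite lte_fin => rx; have x0 : 0 < x - r0 by rewrite subr_gt0.
(* With [i.+2] even the first radius lies strictly beyond [r0]. *)
exists (fun i => x - (x - r0) / i.+2%:R); split=> [i|i|i|t].
- rewrite ltrBrDr -ltrBrDl ltr_pdivrMr ?ltr0n // -[ltLHS]mulr1 ltr_pM2l //.
  by rewrite ltr1n.
- by rewrite ltrD2l ltrN2 ltr_pM2l // ltf_pV2 ?posrE ?ltr0n // ltr_nat.
- by rewrite lte_fin ltrBlDr ltrDl divr_gt0 ?ltr0n.
rewrite lte_fin => tx; have t0 : 0 < x - t by rewrite subr_gt0.
exists (Num.bound ((x - r0) / (x - t))); rewrite lerBrDr -lerBrDl.
rewrite ler_pdivrMr ?ltr0n // mulrC -ler_pdivrMr //; apply: ltW.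
apply: lt_trans (archi_boundP _) _; first by rewrite divr_ge0 // ltW.
by rewrite ltr_nat; apply: leqW.
Qed.

(** * A basis valid on all large balls, and the absence of syzygies *)

Section KeyTheorem.
Variables (R : realType) (d : nat) (rho : \bar R) (m : nat).
Local Notation S := (ncseries R d).
Local Notation norm2 := (hnorm (@l2dot R)).
Local Notation conv := (@conv_pred R d rho).
Variable g : 'I_m -> S.
Hypothesis g_conv : forall k, g k \in conv.

(** Elements of [combs0] are series independent of the radius, and the Fock norm increases with it;
    approximants found at [t] therefore serve at [r]. *)
Lemma M0r_mono r t (f : S) : 0 < r -> r <= t -> (t%:E < rho)%E -> f \in conv ->
  M0r rho g t (enc t f) -> M0r rho g r (enc r f).
Proof.
move=> r0 rt tr fc Mf e e0; have [_ [f0 f0J <-] ff] := Mf e e0.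
exists (enc r f0); first by exists f0.
have t0 : 0 < t by apply: lt_le_trans rt.
have rr : (r%:E < rho)%E by apply: le_lt_trans tr; rewrite lee_fin.
have f0c : f0 \in conv := combs_conv g_conv (combs0_combs f0J).
have frt := conv_fock t0 tr fc; have f0t := conv_fock t0 tr f0c.
move: ff; rewrite (encB (ltW t0) frt f0t).
rewrite (encB (ltW r0) (conv_fock r0 rr fc) (conv_fock r0 rr f0c)).
apply: le_lt_trans; apply: enc_norm_le; [exact: ltW|exact: hnorm_ge0|] => N.
apply: le_trans (enc_sqw N t0 (fockD frt (fockN f0t))); apply: ler_sum => l _.
apply: ler_wpM2l; first exact: hom_sqnorm_ge0.
by apply: lerXn2r; rewrite ?nnegrE ?(ltW r0) ?(ltW t0).
Qed.

Definition indep r n (tau : 'I_n -> 'I_m) := forall c : 'I_n -> R[i],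
  M0r rho g r (\sum_k c k *: enc r (g (tau k))) -> forall k, c k = 0.

Definition spanning r n (tau : 'I_n -> 'I_m) := forall k : 'I_m,
  exists c : 'I_n -> R[i], M0r rho g r (enc r (g k) - \sum_l c l *: enc r (g (tau l))).

Lemma indep_mono r t n (tau : 'I_n -> 'I_m) : 0 < r -> r <= t -> (t%:E < rho)%E ->
  indep r tau -> indep t tau.
Proof.
move=> r0 rt tr ir c Mc; apply: ir; have gt_conv k : g (tau k) \in conv by exact: g_conv.
have t0 : 0 < t by apply: lt_le_trans rt.
have rr : (r%:E < rho)%E by apply: le_lt_trans tr; rewrite lee_fin.
move: Mc; rewrite -(enc_comb_cst gt_conv t0 tr) -(enc_comb_cst gt_conv r0 rr).
apply: M0r_mono => //; apply: rpred_sum => k _.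
exact: convM (gt_conv k) (@conv_cst R d rho (c k)).
Qed.

(** This bounds the length of an independent selection by [m], so that a maximal one exists. *)
Lemma indep_inj r n (tau : 'I_n -> 'I_m) : 0 < r -> (r%:E < rho)%E ->
  indep r tau -> injective tau.
Proof.
move=> r0 rr ir i j tij; apply: contrapT => /eqP ij.
have sM0 := M0r_subspace g_conv r0 rr.
pose c k : R[i] := (k == i)%:R - (k == j)%:R.
have : M0r rho g r (\sum_k c k *: enc r (g (tau k))).
  rewrite (_ : \sum_k _ = 0); first by case: sM0.
  rewrite /c; under eq_bigr do rewrite scalerBl.
  have pick (l : 'I_n) : \sum_k (k == l)%:R *: enc r (g (tau k)) = enc r (g (tau l)) :> l2 R.
    rewrite (bigD1 l) //= eqxx scale1r big1 ?addr0 // => k kl.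
    by rewrite (negbTE kl) scale0r.
  by rewrite sumrB !pick tij subrr.
move=> /ir /(_ i); rewrite /c eqxx (negbTE ij) subr0 => /eqP.
by rewrite oner_eq0.
Qed.

(* Independence modulo [M0r] is inherited by larger radii, so an independent
   selection of generators of maximal length is a basis on all larger balls. *)
Lemma maximal_basis : (0 < rho)%E -> exists n (tau : 'I_n -> 'I_m) r0,
  [/\ 0 < r0, (r0%:E < rho)%E &
      forall r, r0 <= r -> (r%:E < rho)%E -> indep r tau /\ spanning r tau].
Proof.
move=> rho0; pose P n := `[< exists (tau : 'I_n -> 'I_m) r,
  [/\ 0 < r, (r%:E < rho)%E & indep r tau] >].
have exP : exists n, P n.
  have [r r0 rr] := ereal_between rho0; exists 0%N; apply/asboolP.
  have tau0 : 'I_0 -> 'I_m by case.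
  by exists tau0, r; split=> // c _ [].
have leP n : P n -> (n <= m)%N.
  move=> /asboolP[tau [r [r0 rr ir]]].
  by have := leq_card tau (indep_inj r0 rr ir); rewrite !card_ord.
case: (ex_maxnP exP leP) => n /asboolP[tau [r0 [r00 rr0 ir0]]] nmax.
exists n, tau, r0; split; [exact: r00|exact: rr0|] => r r0r rr.
have rp : 0 < r by apply: lt_le_trans r0r.
have ir : indep r tau by apply: indep_mono ir0.
split; [exact: ir|] => k; apply: contrapT => notspan.
have sM0 := M0r_subspace g_conv rp rr.
pose tau' (i : 'I_n.+1) : 'I_m := oapp tau k (insub (i : nat)).
have tau'w i : tau' (widen_ord (leqnSn n) i) = tau i by rewrite /tau' /= valK.
have tau'm : tau' ord_max = k by rewrite /tau' /= insubF //= ltnn.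
suff : (n.+1 <= n)%N by rewrite ltnn.
apply: nmax; apply/asboolP; exists tau', r; split; [exact: rp|exact: rr|] => c.
rewrite big_ord_recr /= tau'm; under eq_bigr do rewrite tau'w.
(* A nonzero last coefficient would make [g k] a combination of the selected generators modulo
   [M0r], against [notspan]. *)
move=> Mc; have cm0 : c ord_max = 0.
  apply: contrapT => /eqP c0; apply: notspan.
  exists (fun l => - ((c ord_max)^-1 * c (widen_ord (leqnSn n) l))).
  have := subspaceZ (c ord_max)^-1 sM0 Mc; rewrite scalerDr scalerA (mulVf c0) scale1r.
  rewrite addrC scaler_sumr -sumrN; congr (M0r _ _ _ (_ + _)); apply: eq_bigr => l _.
  by rewrite scalerA scaleNr opprK.
move: Mc; rewrite cm0 scale0r addr0 => /ir cw i.
case: (unliftP ord_max i) => [j ->|-> //].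
rewrite (_ : lift ord_max j = widen_ord (leqnSn n) j) ?cw //.
by apply: val_inj; rewrite /= /bump leqNgt ltn_ord.
Qed.

(** The [b l] are controlled at radius [s] only, so they need not be admissible coefficients in
    [combs0]. Their truncations are, and the tails are small in the submultiplicative norm, hence in
    the Fock norm of the combination. *)
Lemma comb_M0r s (b : 'I_m -> S) : 0 < s -> (s%:E < rho)%E ->
  (forall l, exists C, bnd s (b l) C) -> (forall l, b l [::] = 0) ->
  M0r rho g s (enc s (comb g b)).
Proof.
move=> s0 sr bb b0 e e0; have s0' := ltW s0.
have /choice[Cg CgP] l : exists C, bnd s (g l) C by apply: (proj1 (conv_bndP rho _)).
have Cg0 l : 0 <= Cg l := bnd_ge0 (CgP l).
pose K := \sum_l Cg l + 1; have K0 : 0 < K by rewrite ltr_wpDl ?sumr_ge0.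
have /choice[Nb NbP] l : exists N, forall n, (N <= n)%N -> bnd s (b l - trunc n (b l)) (e / 2 / K).
  by have [C bC] := bb l; apply: bnd_tail bC _ => //; rewrite !divr_gt0.
pose N := \max_l Nb l; pose tb l := trunc N (b l).
have tbc l : tb l \in conv by exact: conv_trunc.
exists (enc s (comb g tb)).
  exists (comb g tb) => //; exists tb; last reflexivity.
  by move=> l; split; [exact: tbc|rewrite /tb /trunc; case: ifP].
have bcomb (h : 'I_m -> S) : (forall l, exists C, bnd s (h l) C) -> fock s (comb g h).
  move=> hb; have [C hC] : exists C, bnd s (comb g h) C.
    apply: bounded_sum => // l; have [C hC] := hb l; exists (Cg l * C); exact: bndM.
  exact: bnd_is_fock hC.
rewrite encB //; [|exact: bcomb|]; last first.
  by apply: bcomb => l; apply: (proj1 (conv_bndP rho _)).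
rewrite (_ : comb g b - comb g tb = comb g (fun l => b l - tb l)); last first.
  by rewrite /comb -sumrB; apply: eq_bigr => l _; rewrite mulrBr.
apply: (@le_lt_trans _ _ (e / 2)); last by lra.
apply: enc_norm_bnd => // M; apply: le_trans (wsum_sum _ _ _ _ s0') _.
apply: (@le_trans _ _ (\sum_l Cg l * (e / 2 / K))).
  apply: ler_sum => l _; apply: (bndM s0' (CgP l)); apply: NbP.
  exact: (leq_bigmax l).
rewrite -mulr_suml mulrA ler_pdivrMr // mulrC; apply: ler_wpM2l; last by rewrite /K lerDl.
by rewrite divr_ge0 // ltW.
Qed.

(** Independence is required at the radius [s] of the syzygy, while [B] comes from the larger radius
    [t]: this lets one matrix [B] serve on all smaller balls of the exhaustion. *)
Lemma syzygy_trivial s t n (tau : 'I_n -> 'I_m) (B : 'M[S]_(m, n)) :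
  0 < s -> s <= t -> (s%:E < rho)%E -> mbounded t B ->
  (forall l k, B l k [::] = (l == tau k)%:R) -> indep s tau ->
  forall v : 'cV[S]_n, mbounded s v -> gen_row g *m B *m v = 0 -> v = 0.
Proof.
move=> s0 st sr Bb B0 is_ v vb gBv.
have Bs : mbounded s B by apply: mbounded_le Bb => //; exact: ltW.
(* Subtracting the constant terms from [B *m u] leaves coefficients [b] to which [comb_M0r] applies.
   As [g B u = 0], this puts a combination of the selected generators with coefficients [- a k] into
   [M0r], and independence gives [a = 0]. *)
have nil_ (u : 'cV[S]_n) : mbounded s u -> gen_row g *m B *m u = 0 -> forall k, u k ord0 [::] = 0.
  move=> ub gBu; pose a k := u k ord0 [::].
  pose c l := \sum_k (l == tau k)%:R * a k.
  pose b l : S := (B *m u) l ord0 - const_series (c l).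
  have bb l : exists C, bnd s (b l) C.
    have [C uC] := mboundedM (ltW s0) Bs ub l ord0.
    exists (C + normc (c l)); apply: bndD => //; first exact: ltW.
    by move=> N; rewrite wsumN; exact: bnd_cst.
  have b0 l : b l [::] = 0.
    rewrite -[LHS]/((B *m u) l ord0 [::] - const_series (c l) [::]).
    rewrite mxE sum_seriesE /const_series /=.
    apply/eqP; rewrite subr_eq0; apply/eqP/eq_bigr => k _.
    by rewrite mul_nil B0.
  have := comb_M0r s0 sr bb b0.
  have gt_conv k : g (tau k) \in conv by exact: g_conv.
  have -> : comb g b = comb (fun k => g (tau k)) (fun k => const_series (- a k)).
    have gBu0 : comb g (fun l => (B *m u) l ord0) = 0.
      by rewrite -comb_mx mulmxA gBu mxE.
    rewrite /comb /b; under eq_bigr do rewrite mulrBr.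
    rewrite sumrB -/(comb g _) gBu0 sub0r; apply/funext => w.
    rewrite -[LHS]/(- (\sum_l g l * const_series (c l)) w) !sum_seriesE -sumrN.
    under eq_bigr do rewrite mul_cst mulr_sumr -sumrN.
    rewrite exchange_big; apply: eq_bigr => k _ /=; rewrite mul_cst.
    rewrite (bigD1 (tau k)) //= eqxx mul1r mulrN big1 ?addr0 // => l lk.
    by rewrite (negbTE lk) mul0r mulr0 oppr0.
  rewrite (enc_comb_cst gt_conv s0 sr) => /is_ a0 k.
  by have /eqP := a0 k; rewrite oppr_eq0 => /eqP.
apply/colP => k; rewrite [RHS]mxE; apply/funext => w.
(* With all constant terms gone, stripping the last letter commutes with multiplication by [g B], so
   [v'] is a syzygy as well. *)
elim/last_ind: w v vb gBv k => [|w j IH] v vb gBv k; first exact: nil_.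
pose v' : 'cV[S]_n := \col_k rstrip j (v k ord0).
have -> : v k ord0 (rcons w j) = v' k ord0 w by rewrite mxE.
apply: IH.
  by move=> i l; rewrite mxE; have [C vC] := vb i ord0; exists (C / s); exact: bnd_rstrip.
apply/matrixP => i l; rewrite !ord1 [RHS]mxE; apply/funext => x.
have := congr1 (fun A : 'M[S]_1 => A ord0 ord0 (rcons x j)) gBv.
rewrite mxE sum_seriesE [X in _ = X _ -> _]mxE => E.
rewrite mxE sum_seriesE -[RHS]E; apply: eq_bigr => q _.
by rewrite mul_rcons (nil_ v vb gBv) mulr0 addr0 [v' q ord0]mxE.
Qed.

End KeyTheorem.

(** * Approximation of syzygies and construction of a global solution *)

Section Gluing.
Variables (R : realType) (d : nat) (rho : \bar R) (m : nat).
Local Notation S := (ncseries R d).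
Local Notation conv := (@conv_pred R d rho).
Variable g : 'I_m -> S.
Hypothesis g_conv : forall k, g k \in conv.
Variables (n : nat) (tau : 'I_n -> 'I_m) (s : nat -> R).
Hypotheses (s_gt0 : forall i, 0 < s i) (s_inc : forall i, s i < s i.+1)
  (s_rho : forall i, ((s i)%:E < rho)%E)
  (s_cofinal : forall t, (t%:E < rho)%E -> exists i, t <= s i)
  (s_basis : forall i, indep rho g (s i) tau /\ spanning rho g (s i) tau).
Variable f : S.
Hypotheses (f_conv : f \in conv) (f_Mr : forall i, Mr rho g (s i) (enc (s i) f)).

Definition solution i (h : 'cV[S]_m) := mbounded (s i) h /\ gen_row g *m h = f%:M.

Lemma mbounded_trunc t p q N (A : 'M[S]_(p, q)) : 0 <= t ->
  mbounded t (\matrix_(i, j) trunc N (A i j)).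
Proof. by move=> t0 i j; rewrite mxE; exists (wsum t (A i j) N); exact: bnd_trunc. Qed.

Lemma mwsum_tail t p q (A : 'M[S]_(p, q)) e : 0 <= t -> mbounded t A -> 0 < e ->
  exists N, forall n, (N <= n)%N -> forall M,
    mwsum t (A - \matrix_(i, j) trunc n (A i j)) M <= e.
Proof.
move=> t0 At e0; pose K : R := p%:R * q%:R + 1.
have K0 : 0 < K by rewrite ltr_wpDl // mulr_ge0 ?ler0n.
have /choice[N NP] (ij : 'I_p * 'I_q) : exists N, forall n, (N <= n)%N ->
    bnd t (A ij.1 ij.2 - trunc n (A ij.1 ij.2)) (e / K).
  by have [C AC1] := At ij.1 ij.2; apply: bnd_tail AC1 _ => //; rewrite divr_gt0.
exists (\max_ij N ij) => k Nk M.
apply: (@le_trans _ _ (\sum_(i < p) \sum_(j < q) e / K)).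
  apply: ler_sum => i _; apply: ler_sum => j _; rewrite !mxE.
  by apply: (NP (i, j)); apply: leq_trans Nk; exact: leq_bigmax.
rewrite !sumr_const !card_ord -mulrnA -mulr_natr natrM mulrAC ler_pdivrMr //.
by apply: ler_wpM2l; [exact: ltW|rewrite /K mulrC lerDl].
Qed.

(** One step of the sequence of radii is spent: membership in the closure at [s i.+1] gives
    coefficients bounded at [s i]. *)
Lemma local_solution i : exists h, solution i h.
Proof.
have [indS spanS] := s_basis i.+1.
have [B [Bb B0 BP]] := level g_conv (s_gt0 i) (s_inc i) (s_rho i.+1) indS spanS.
have [u ub uf] := BP f f_conv (f_Mr i.+1).
exists (B *m u); split; last by rewrite mulmxA.
by apply: mboundedM => //; exact: ltW.
Qed.

(* The idempotent [E = 1 - B A] projects onto the syzygies of [g], on every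
   smaller ball on which [tau] still selects a basis. *)
Lemma syzygy_projection i j : (i <= j)%N -> exists E : 'M[S]_m,
  [/\ mbounded (s j) E, gen_row g *m E = 0 &
      forall h : 'cV[S]_m, mbounded (s i) h -> gen_row g *m h = 0 -> E *m h = h].
Proof.
move=> ij; have sij : s i <= s j.
  move: ij => /subnKC <-; elim: (j - i)%N => [|k IH]; rewrite ?addn0 //.
  by rewrite addnS (le_trans IH) // ltW.
have [indS spanS] := s_basis j.+1.
have [B [Bb B0 BP]] := level g_conv (s_gt0 j) (s_inc j) (s_rho j.+1) indS spanS.
have gMr k : Mr rho g (s j.+1) (enc (s j.+1) (g k)) by apply: Mr_enc; exact: combs_g.
have /choice[A AP] k : exists u : 'cV[S]_n, mbounded (s j) u /\ (g k)%:M = gen_row g *m B *m u.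
  have [u ub ug] := BP (g k) (g_conv k) (gMr k).
  by exists u.
pose Am : 'M[S]_(n, m) := \matrix_(l, k) A k l ord0.
have Amb : mbounded (s j) Am by move=> l k; rewrite mxE; case: (AP k) => /(_ l ord0).
have gBA : gen_row g *m B *m Am = gen_row g.
  apply/rowP => k; have [_ /matrixP/(_ ord0 ord0)] := AP k.
  rewrite [LHS]mxE eqxx mulr1n [RHS]mxE => E; rewrite [RHS]mxE E mxE.
  by apply: eq_bigr => l _; rewrite [Am l k]mxE.
have sj0 := ltW (s_gt0 j).
exists (1%:M - B *m Am); split.
- apply: mboundedD => //; first exact: mbounded1.
  by apply: mboundedN; exact: mboundedM.
- by rewrite mulmxBr mulmx1 mulmxA gBA subrr.
move=> h hb gh; have si0 := ltW (s_gt0 i).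
(* Since [g B A = g], the column [A h] is a syzygy of [g B], and it lives at radius [s i]. *)
have Ah : Am *m h = 0.
  apply: (syzygy_trivial g_conv (s_gt0 i) sij (s_rho i) Bb B0 (proj1 (s_basis i))).
    by apply: mboundedM => //; apply: mbounded_le Amb.
  by rewrite mulmxA gBA.
by rewrite mulmxBl mul1mx -mulmxA Ah mulmx0 subr0.
Qed.

(* The defect [h - h1] is a syzygy, hence [E (h - h1)]; truncating the argument of
   [E] makes it a syzygy on the larger ball and changes no low coefficient. *)
Lemma improve i h : solution i h -> exists h', [/\ solution i.+1 h', magree i h h' &
  forall N, mwsum (s i) (h' - h) N <= 2^-1 ^+ i].
Proof.
move=> [hb gh]; have [h1 [h1b gh1]] := local_solution i.+1.
have [E [Eb gE EP]] := syzygy_projection (leqnSn i).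
have si0 := ltW (s_gt0 i); have si1 := ltW (s_gt0 i.+1).
have sii := ltW (s_inc i).
pose del := h - h1.
have delb : mbounded (s i) del.
  by apply: mboundedD => //; apply: mboundedN; apply: mbounded_le h1b.
have Edel : E *m del = del by apply: EP => //; rewrite mulmxBr gh gh1 subrr.
have Ebi : mbounded (s i) E by apply: mbounded_le Eb.
have [C C0 EC] := mbounded_mwsum Ebi.
have C1 : 0 < C + 1 by rewrite ltr_wpDl.
have e0 : 0 < 2^-1 ^+ i / (C + 1) :> R by rewrite divr_gt0 ?exprn_gt0 ?invr_gt0.
have [N NP] := mwsum_tail si0 delb e0.
(* [N] makes the tail small enough against the norm [C] of [E]; [i.+1] leaves the coefficients of
   degree at most [i] untouched. *)
pose M := maxn N i.+1; pose p : 'cV[S]_m := \matrix_(k, l) trunc M (del k l).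
have hh : h - (h1 + E *m p) = E *m (del - p).
  by rewrite mulmxBr Edel opprD addrA.
exists (h1 + E *m p); split.
- split; last by rewrite mulmxDr mulmxA gE mul0mx addr0.
  by apply: mboundedD => //; apply: mboundedM => //; exact: mbounded_trunc.
- move=> k l w wi.
  have Edp : (E *m (del - p)) k l w = (E *m (0 : 'cV[S]_m)) k l w.
    apply: magree_mul wi => k' l' v vi.
    rewrite [X in X v = _]mxE [X in (_ + X) v]mxE [p _ _]mxE [X in _ = X v]mxE.
    rewrite -[LHS]/(del k' l' v - trunc M (del k' l') v) /trunc.
    by rewrite (leq_ltn_trans vi) ?subrr // leq_max ltnSn orbT.
  move: Edp; rewrite mulmx0 -hh [X in X w = _]mxE [X in _ = X w]mxE => /eqP.
  rewrite -[X in X == _]/(h k l w + (- (h1 + E *m p)) k l w).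
  by rewrite [X in _ + X w]mxE subr_eq0 => /eqP.
move=> K; rewrite -opprB hh.
have -> : mwsum (s i) (- (E *m (del - p))) K = mwsum (s i) (E *m (del - p)) K.
  by apply: eq_bigr => k _; apply: eq_bigr => l _; rewrite mxE wsumN.
apply: le_trans (mwsumM _ _ _ si0) _.
have /(_ K) := NP M (leq_maxl _ _); rewrite ler_pdivlMr // => NK.
have := EC K; have := mwsum_ge0 (del - p) K si0; have := mwsum_ge0 E K si0; nra.
Qed.

Lemma glue : combs rho g f.
Proof.
(* Dependent choice: [improve] becomes a map on pairs of an index and a solution, which is then
   iterated. *)
pose T := {ih : nat * 'cV[S]_m | solution ih.1 ih.2}.
have /choice[nx nxP] (x : T) : exists y : T, [/\ (sval y).1 = (sval x).1.+1,
    magree (sval x).1 (sval x).2 (sval y).2 &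
    forall N, mwsum (s (sval x).1) ((sval y).2 - (sval x).2) N <= 2^-1 ^+ (sval x).1].
  case: x => -[i h] /= hs; have [h' [hs' ag sm]] := improve hs.
  by exists (exist _ (i.+1, h') hs').
have [h0 h0s] := local_solution 0.
pose x i : T := iter i nx (exist _ (0%N, h0) h0s).
have xi i : (sval (x i)).1 = i by elim: i => //= i IH; case: (nxP (x i)) => -> _ _; rewrite IH.
pose H i := (sval (x i)).2.
have Hs i : solution i (H i) by rewrite -[X in solution X](xi i); exact: (svalP (x i)).
have Hag i : magree i (H i) (H i.+1) by have [_] := nxP (x i); rewrite xi.
have Hsm i N : mwsum (s i) (H i.+1 - H i) N <= 2^-1 ^+ i.
  by have [_ _] := nxP (x i); rewrite xi; apply.
have Hag_le i j : (i <= j)%N -> magree i (H i) (H j).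
  move=> /subnKC <-; elim: (j - i)%N => [|q IH] k l w wi; first by rewrite addn0.
  rewrite IH // addnS; apply: Hag; exact: leq_trans wi (leq_addr _ _).
have s_le i j : (i <= j)%N -> s i <= s j.
  by move=> /subnKC <-; elim: (j - i)%N => [|k IH]; rewrite ?addn0 // addnS (le_trans IH) // ltW.
(* From step [size w] on the coefficient at [w] no longer changes, so the limit is read off without
   a limit process. *)
pose h k : S := fun w => H (size w) k ord0 w.
have hH i k : agree i (h k) (H i k ord0) by move=> w wi; exact: Hag_le.
(* The corrections from step [i] to step [i + q] are at most [2^-1 ^+ p] for [p < q], and these sum
   to [2 - 2 * 2^-1 ^+ q]. *)
have wsumH i q k N : wsum (s i) (H (i + q)%N k ord0) N <=
    wsum (s i) (H i k ord0) N + 2 - 2 * 2^-1 ^+ q.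
  have si0 := ltW (s_gt0 i).
  elim: q => [|q IH]; first by rewrite addn0 expr0 mulr1 addrK.
  rewrite addnS -[H (i + q).+1](subrK (H (i + q)%N)) mxE.
  apply: le_trans (wsumD _ _ _ si0) _; move: IH.
  have : wsum (s i) ((H (i + q).+1 - H (i + q)%N) k ord0) N <= 2^-1 ^+ q.
    apply: le_trans (mwsum_entry _ _ _ _ si0) _.
    apply: (@le_trans _ _ (mwsum (s (i + q)%N) (H (i + q).+1 - H (i + q)%N) N)).
      apply: ler_sum => a _; apply: ler_sum => b _.
      by apply: wsum_le_radius => //; apply/s_le/leq_addr.
    apply: le_trans (Hsm _ _) _; rewrite exprD ler_piMl ?exprn_ge0 ?invr_ge0 //.
    by rewrite exprn_ile1 ?invr_ge0 // invf_le1 // ler1n.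
  rewrite exprS; move: (2^-1 ^+ q) => y; lra.
have hconv k : h k \in conv.
  apply/conv_bndP => t t0 /s_cofinal[i ti].
  have [C HC] := proj1 (Hs i) k ord0; exists (C + 2) => N.
  apply: le_trans (wsum_le_radius _ N (ltW t0) ti) _.
  apply: le_trans (wsum_le_nat _ (ltW (s_gt0 i)) (leqnSn N)) _.
  (* The sum up to [N.+1] sees only degrees at most [N], where [h k] equals step [i + N]. *)
  rewrite (@wsum_agree _ _ _ _ (H (i + N)%N k ord0)); last first.
    by move=> w wN; apply: hH; apply: leq_trans wN (leq_addl _ _).
  apply: le_trans (wsumH _ _ _ _) _; have := HC N.+1.
  have : 0 <= 2^-1 ^+ N :> R by rewrite exprn_ge0 ?invr_ge0.
  lra.
exists h => //; apply/funext => w.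
have /matrixP/(_ ord0 ord0) := proj2 (Hs (size w)).
rewrite comb_mx [RHS]mxE eqxx mulr1n => <-.
rewrite /comb !sum_seriesE; apply: eq_bigr => k _.
by apply: (@agree_mul _ _ (size w)) => //; apply: agree_sym; exact: hH.
Qed.

End Gluing.

(** The exhaustion starts beyond the radius [r0] from which a single selection [tau] is a basis, so
    that [glue] applies with fixed [n] and [tau]. *)
Theorem combs_of_closure (R : realType) (d : nat) (rho : \bar R) (m : nat)
  (g : 'I_m -> ncseries R d) (f : ncseries R d) : (0 < rho)%E ->
  (forall k, g k \in @conv_pred R d rho) -> f \in @conv_pred R d rho ->
  (forall r : R, 0 < r -> (r%:E < rho)%E -> Mr rho g r (enc r f)) ->
  combs rho g f.
Proof.
move=> rho0 gc fc fM; have [n [tau [r0 [r00 rr0 basis]]]] := maximal_basis gc rho0.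
have [s [sr0 sinc srho scof]] := exhaustion rr0.
have s0 i : 0 < s i := lt_trans r00 (sr0 i).
by apply: (@glue _ _ _ _ _ gc n tau s s0 sinc srho scof _ _ fc) => i;
  [apply: basis => //; exact: ltW|exact: fM].
Qed.

(** * Evaluation at operator tuples *)

Lemma cvge0P (R : realType) (u : nat -> \bar R) : (forall N, (0 <= u N)%E) ->
  u @ \oo --> 0%E <-> forall e : R, 0 < e -> exists N0, forall N, (N0 <= N)%N -> (u N <= e%:E)%E.
Proof.
move=> u0; split=> [|uP].
  move=> /fine_cvgP[[N1 _ ufin] /cvgrPdist_le uc] e e0; have [N2 _ uN] := uc e e0.
  exists (maxn N1 N2) => N; rewrite geq_max => /andP[NN1 NN2].
  have := uN N NN2; rewrite /= sub0r normrN ger0_norm ?fine_ge0 // -lee_fin fineK //.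
  exact: ufin.
apply/fine_cvgP; split.
  have [N0 N0P] := uP 1 ltr01; exists N0 => // N /= /N0P uN.
  by rewrite fin_real // (lt_le_trans ltNy0 (u0 N)) (le_lt_trans uN) // ltry.
apply/cvgrPdist_le => e e0; have [N0 N0P] := uP e e0; exists N0 => // N /= /N0P uN.
rewrite sub0r normrN ger0_norm ?fine_ge0 // -lee_fin fineK //.
by rewrite fin_real // (lt_le_trans ltNy0 (u0 N)) (le_lt_trans uN) // ltry.
Qed.

Section Evaluation.
Variables (R : realType) (H : lmodType R[i]) (dot : H -> H -> R[i]).
Hypothesis hl : hilbert dot.
Variables (d : nat) (X Y : 'I_d -> H -> H) (c : R).
Hypotheses (X_lin : forall j, linear (X j))
  (XY : forall j x y, dot (X j x) y = dot x (Y j y))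
  (c0 : 0 <= c)
  (row_le : forall u, \sum_(j < d) hnorm dot (Y j u) ^+ 2 <= c ^+ 2 * hnorm dot u ^+ 2).
Local Notation "`[ x ]" := (hnorm dot x).
Local Notation S := (ncseries R d).
Local Notation ev f := (nceval dot f X).
Let ip := hilbert_ip hl.
Implicit Types (f g h : S) (x y : H).

Lemma word_op_linear w : linear (word_op X w).
Proof. by elim: w => [|j w IH] a x y //=; rewrite IH X_lin. Qed.

Lemma word_op_rcons w j x : word_op X (rcons w j) x = word_op X w (X j x).
Proof. by elim: w => //= i w ->. Qed.

Definition word_adj w y := foldl (fun z j => Y j z) y w.

Lemma word_opP w x y : dot (word_op X w x) y = dot x (word_adj w y).
Proof. by elim: w y => //= j w IH y; rewrite XY IH. Qed.

Lemma word_adj_le l y :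
  \sum_(w : l.-tuple 'I_d) `[word_adj w y] ^+ 2 <= (c ^+ l) ^+ 2 * `[y] ^+ 2.
Proof.
elim: l y => [|l IH] y.
  rewrite (bigD1 [tuple]) //= big1 => [|w /negP[]]; last by apply/eqP; exact: tuple0.
  by rewrite addr0 expr0 expr1n mul1r.
rewrite (sum_tuple_cons l (fun w => `[word_adj w y] ^+ 2)) /=.
apply: (@le_trans _ _ (\sum_(j < d) (c ^+ l) ^+ 2 * `[Y j y] ^+ 2)).
  by apply: ler_sum => j _; exact: IH.
rewrite -mulr_sumr [c ^+ l.+1]exprSr exprMn -[leRHS]mulrA; apply: ler_wpM2l; first exact: sqr_ge0.
exact: row_le.
Qed.

Definition hom_eval f l x : H := \sum_(w : l.-tuple 'I_d) f w *: word_op X w x.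

(** Pairing with [z] itself moves the words to the adjoint side, where the squared norms add up to
    at most [c^(2 l) |z|^2]. Cauchy-Schwarz over the words then brings in the l^2 norm of the
    coefficients. *)
Lemma hom_eval_le f l x : `[hom_eval f l x] <= hom_norm f l * c ^+ l * `[x].
Proof.
set z := hom_eval f l x; have [->|z0] := pselect (z = 0).
  by rewrite (hnorm0 ip) !mulr_ge0 ?hom_norm_ge0 ?exprn_ge0 ?hnorm_ge0.
have zp := hnorm_gt0 ip z0; rewrite -(ler_pM2r zp) -expr2.
have -> : `[z] ^+ 2 = normc (dot z z).
  by rewrite (dotxx ip) normc_real ger0_norm ?sqr_ge0.
rewrite {1}/z /hom_eval (dot_suml ip).
apply: le_trans (normc_sum _ _ _) _.
apply: (@le_trans _ _ (\sum_(w : l.-tuple 'I_d) normc (f w) * `[word_adj w z] * `[x])).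
  apply: ler_sum => w _; rewrite (dotZl ip) normcM word_opP -mulrA.
  by apply: ler_wpM2l; [exact: normc_ge0|rewrite mulrC; exact: cauchy_schwarz].
rewrite -mulr_suml mulrAC; apply: ler_wpM2r; first exact: hnorm_ge0.
apply: le_trans (cauchy_schwarz_sum _ _) _.
- by move=> w; exact: normc_ge0.
- by move=> w; exact: hnorm_ge0.
rewrite -mulrA; apply: ler_wpM2l; first exact: sqrtr_ge0.
have -> : c ^+ l * `[z] = Num.sqrt ((c ^+ l) ^+ 2 * `[z] ^+ 2).
  by rewrite -exprMn sqrtr_sqr ger0_norm // mulr_ge0 ?exprn_ge0 ?hnorm_ge0.
by apply: ler_wsqrtr; exact: word_adj_le.
Qed.

Lemma partial_evalE f N x : partial_eval f X N x = \sum_(l < N) hom_eval f l x.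
Proof.
rewrite /partial_eval fct_sumE; apply: eq_bigr => l _.
by rewrite fct_sumE.
Qed.

Lemma partial_eval_le f N x : `[partial_eval f X N x] <= wsum c f N * `[x].
Proof.
rewrite partial_evalE; apply: le_trans (hnorm_sum ip _ _ _) _.
by rewrite /wsum mulr_suml; apply: ler_sum => l _; exact: hom_eval_le.
Qed.

Lemma hom_eval_linear f l : linear (hom_eval f l).
Proof.
move=> a x y; rewrite /hom_eval scaler_sumr -big_split /=; apply: eq_bigr => w _.
by rewrite word_op_linear scalerDr !scalerA mulrC.
Qed.

Lemma partial_eval_linear f N : linear (partial_eval f X N).
Proof.
move=> a x y; rewrite !partial_evalE scaler_sumr -big_split /=.
by apply: eq_bigr => l _; exact: hom_eval_linear.
Qed.

Lemma hom_evalD f g l x : hom_eval (f + g) l x = hom_eval f l x + hom_eval g l x.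
Proof. by rewrite /hom_eval -big_split /=; apply: eq_bigr => w _; rewrite -scalerDl. Qed.

Lemma partial_evalD f g N x :
  partial_eval (f + g) X N x = partial_eval f X N x + partial_eval g X N x.
Proof.
by rewrite !partial_evalE -big_split /=; apply: eq_bigr => l _; exact: hom_evalD.
Qed.

Lemma partial_eval_trunc f M N x : (M <= N)%N ->
  partial_eval (trunc M f) X N x = partial_eval f X M x.
Proof.
move=> MN; rewrite !partial_evalE (big_ord_widen N (fun l => hom_eval f l x) MN).
rewrite [RHS]big_mkcond /=; apply: eq_bigr => l _; rewrite /hom_eval.
case: ifP => lM; first by apply: eq_bigr => w _; rewrite /trunc size_tuple lM.
by rewrite big1 // => w _; rewrite /trunc size_tuple lM scale0r.
Qed.

Lemma partial_eval_tail f C e : bnd c f C -> 0 < e ->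
  exists N0, forall M N, (N0 <= M)%N -> (M <= N)%N -> forall x,
    `[partial_eval f X N x - partial_eval f X M x] <= e * `[x].
Proof.
move=> fC e0; have [N0 N0P] := bnd_tail c0 fC e0; exists N0 => M N NM MN x.
rewrite -(partial_eval_trunc f x MN) -{1}(subrK (trunc M f) f) partial_evalD addrK.
apply: le_trans (partial_eval_le _ _ _) _.
by apply: ler_wpM2r; [exact: hnorm_ge0|exact: N0P].
Qed.

Definition op_limit f (T : H -> H) := linear T /\ forall e : R, 0 < e ->
  exists N0, forall N, (N0 <= N)%N -> forall x, `[partial_eval f X N x - T x] <= e * `[x].

Lemma op_limit_exists f C : bnd c f C -> exists T, op_limit f T.
Proof.
move=> fC; have /choice[T TP] x : exists z, hcvg dot (fun N => partial_eval f X N x) z.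
  apply: (hilbert_complete hl) => e e0; have x1 : 0 < `[x] + 1 by rewrite ltr_wpDl ?hnorm_ge0.
  have [N0 N0P] := partial_eval_tail fC (divr_gt0 e0 x1).
  have small M N : (N0 <= M)%N -> (M <= N)%N -> `[partial_eval f X N x - partial_eval f X M x] < e.
    move=> NM MN; apply: le_lt_trans (N0P M N NM MN x) _.
    by rewrite mulrAC ltr_pdivrMr // ltr_pM2l // ltrDl.
  exists N0 => i j Ni Nj; have [ij|/ltnW ji] := leqP i j; last exact: small.
  by rewrite (hnormBC ip); exact: small.
have unif (e : R) : 0 < e -> exists N0, forall N, (N0 <= N)%N ->
    forall x, `[partial_eval f X N x - T x] <= e * `[x].
  move=> e0; have [N0 N0P] := partial_eval_tail fC e0; exists N0 => M NM x.
  apply/ler_addgt0Pl => e1 e10; have [N1 N1P] := TP x e1 e10.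
  rewrite -(subrKA (partial_eval f X (maxn M N1) x)).
  apply: le_trans (hnormD ip _ _) _; rewrite addrC; apply: lerD.
    by apply/ltW/N1P; exact: leq_maxr.
  by rewrite (hnormBC ip); apply: N0P => //; exact: leq_maxl.
exists T; split=> // a x y; apply/eqP; rewrite -subr_eq0; apply/eqP/(hnorm_eq0 ip)/eqP.
rewrite eq_le hnorm_ge0 andbT; pose K := `[a *: x + y] + normc a * `[x] + `[y] + 1.
have K0 : 0 < K by rewrite ltr_wpDl ?addr_ge0 ?mulr_ge0 ?hnorm_ge0 ?normc_ge0.
apply/ler_addgt0Pl => e e0; rewrite addr0.
have [N NP] := unif _ (divr_gt0 e0 K0); have := NP N (leqnn N).
move=> NP'; have -> : T (a *: x + y) - (a *: T x + T y) =
    - (partial_eval f X N (a *: x + y) - T (a *: x + y)) +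
    (a *: (partial_eval f X N x - T x) + (partial_eval f X N y - T y)).
  rewrite (partial_eval_linear f N a x y) opprB.
  have -> : a *: (partial_eval f X N x - T x) + (partial_eval f X N y - T y) =
    a *: partial_eval f X N x + partial_eval f X N y - (a *: T x + T y).
    by rewrite scalerBr [in RHS]opprD addrACA.
  by rewrite subrKA.
apply: le_trans (hnormD ip _ _) _; rewrite (hnormN ip).
apply: le_trans (lerD (lexx _) (hnormD ip _ _)) _; rewrite (hnormZ ip).
have := ler_wpM2l (normc_ge0 a) (NP' x); have := NP' y; have := NP' (a *: x + y).
have eK : e / K * K = e by rewrite divfK ?gt_eqF.
have e1 : 0 <= e / K by rewrite divr_ge0 ?ltW.
move: eK; set q := e / K; rewrite -/q in e1 * => eK; move: eK e1; rewrite /K; lra.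
Qed.

Lemma op_limit_bound f C T : bnd c f C -> op_limit f T -> forall x, `[T x] <= C * `[x].
Proof.
move=> fC [_ TP] x; have x1 : 0 < `[x] + 1 by rewrite ltr_wpDl ?hnorm_ge0.
apply/ler_addgt0Pl => e e0; have [N /(_ N (leqnn N) x) NP] := TP _ (divr_gt0 e0 x1).
rewrite -(subrK (partial_eval f X N x) (T x)); apply: le_trans (hnormD ip _ _) _.
apply: lerD.
  rewrite (hnormBC ip); apply: le_trans NP _; rewrite mulrAC ler_pdivrMr //.
  by rewrite ler_pM2l // lerDl.
apply: le_trans (partial_eval_le _ _ _) _; apply: ler_wpM2r; first exact: hnorm_ge0.
exact: fC.
Qed.

(** Translates the property selected by [xget] in [nceval], stated with extended reals and [opnorm],
    into estimates on vectors. *)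
Lemma op_limitP f C T : bnd c f C -> op_limit f T <->
  bounded_op dot T /\ opnorm dot (partial_eval f X N - T) @[N --> \oo] --> 0%E.
Proof.
move=> fC; have dl N T' : linear T' -> linear (partial_eval f X N - T').
  move=> lT a x y; rewrite -[LHS]/(partial_eval f X N (a *: x + y) - T' (a *: x + y)).
  rewrite -[RHS]/(a *: (partial_eval f X N x - T' x) + (partial_eval f X N y - T' y)).
  by rewrite lT (partial_eval_linear f N a x y) scalerBr opprD addrACA.
split=> [Tl|[/(bounded_opP hl)[lT _] /cvge0P cT]].
  have [lT TP] := Tl; split.
    by apply/(bounded_opP hl); split=> //; exists C; exact: op_limit_bound Tl.
  apply/cvge0P => [N|e e0]; first exact: opnorm_ge0.
  have [N0 N0P] := TP e e0; exists N0 => N NN; apply: bound_opnorm; first exact: ltW.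
  exact: N0P.
split=> // e e0; have [|N0 N0P] := cT _ e e0; first by move=> N; exact: opnorm_ge0.
exists N0 => N NN x; exact: (opnorm_bound hl (dl N T lT) (N0P N NN)).
Qed.

Lemma nceval_limit f C : bnd c f C -> op_limit f (ev f).
Proof.
move=> fC; apply/(op_limitP _ fC); rewrite /nceval; case: xgetP => [T _ []//|].
have [T /(op_limitP _ fC) Tl] := op_limit_exists fC; by move=> /(_ T).
Qed.

Lemma nceval_bound f C x : bnd c f C -> `[ev f x] <= C * `[x].
Proof. by move=> fC; apply: op_limit_bound fC (nceval_limit fC) x. Qed.

Lemma nceval_linear f C : bnd c f C -> linear (ev f).
Proof. by move=> /nceval_limit[]. Qed.

Lemma hcvg_unique (u : nat -> H) x y : hcvg dot u x -> hcvg dot u y -> x = y.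
Proof.
move=> ux uy; apply/eqP; rewrite -subr_eq0; apply/eqP/(hnorm_eq0 ip)/eqP.
rewrite eq_le hnorm_ge0 andbT; apply/ler_addgt0Pl => e e0; rewrite addr0.
have e2 : 0 < e / 2 by rewrite divr_gt0.
have [N1 P1] := ux _ e2; have [N2 P2] := uy _ e2.
have := P1 _ (leq_maxl N1 N2); have := P2 _ (leq_maxr N1 N2).
set z := u _ => zy zx; rewrite -(subrKA z); apply: le_trans (hnormD ip _ _) _.
by rewrite (hnormBC ip x); lra.
Qed.

Lemma nceval_cvg f C x : bnd c f C -> hcvg dot (fun N => partial_eval f X N x) (ev f x).
Proof.
move=> fC e e0; have [_ fP] := nceval_limit fC.
have x1 : 0 < `[x] + 1 by rewrite ltr_wpDl ?hnorm_ge0.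
have [N0 N0P] := fP _ (divr_gt0 e0 x1); exists N0 => N NN.
apply: le_lt_trans (N0P N NN x) _.
by rewrite mulrAC ltr_pdivrMr // ltr_pM2l // ltrDl.
Qed.

Lemma nceval_eq f C x z : bnd c f C -> hcvg dot (fun N => partial_eval f X N x) z ->
  ev f x = z.
Proof. by move=> fC fz; apply: hcvg_unique fz; exact: nceval_cvg fC. Qed.

Definition letter (j : 'I_d) : S := fun w => (w == [:: j])%:R.

Lemma mul_letter_nil f j : (f * letter j) [::] = 0.
Proof. by rewrite mul_nil mulr0. Qed.

Lemma mul_letter_rcons f j w i : (f * letter j) (rcons w i) = if i == j then f w else 0.
Proof.
rewrite mul_rcons mulr0 addr0.
have -> : rstrip i (letter j) = const_series (i == j)%:R.
  apply/funext => v; rewrite /rstrip /letter /const_series; case: v => [|k v] /=.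
    by rewrite eqseq_cons andbT.
  by rewrite eqseq_cons; case: v => [|a v]; rewrite andbF.
by rewrite mul_cst; case: (i == j); rewrite ?mulr1 ?mulr0.
Qed.

Lemma bnd_letter j : exists C, bnd c (letter j) C.
Proof.
exists (hom_norm (letter j) 1 * c) => N.
have E l : l != 1%N -> hom_norm (letter j) l = 0.
  move=> l1; rewrite (@eq_hom_norm _ _ _ 0) ?hom_norm0 // => w wl.
  rewrite /letter; case: eqP wl => // -> /= l2.
  by rewrite -l2 in l1.
have p0 : 0 <= hom_norm (letter j) 1 * c by rewrite mulr_ge0 ?hom_norm_ge0.
apply: (@le_trans _ _ (\sum_(l < N | l == 1%N :> nat) hom_norm (letter j) 1 * c)).
  rewrite /wsum [leRHS]big_mkcond /=; apply: ler_sum => l _.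
  by case: eqP => [->|/eqP/E ->]; rewrite ?expr1 ?mul0r.
have [N1|N1] := ltnP 1 N.
  rewrite (bigD1 (Ordinal N1)) //= big1 ?addr0 // => l /andP[/eqP l1 /eqP[]].
  exact: val_inj.
by rewrite big1 // => l /eqP l1; have := ltn_ord l; rewrite l1 ltnNge N1.
Qed.

Lemma partial_eval_letter f j N x :
  partial_eval (f * letter j) X N.+1 x = partial_eval f X N (X j x).
Proof.
rewrite !partial_evalE big_ord_recl {1}/hom_eval big1 ?add0r => [|w _]; last first.
  by rewrite tuple0 mul_letter_nil scale0r.
apply: eq_bigr => l _; rewrite /hom_eval lift0.
rewrite (sum_tuple_rcons l (fun w => (f * letter j) w *: word_op X w x)) (bigD1 j) //=.
rewrite [X in _ + X]big1 ?addr0 => [|i ij].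
  by apply: eq_bigr => u _; rewrite mul_letter_rcons eqxx word_op_rcons.
by rewrite big1 // => u _; rewrite mul_letter_rcons (negbTE ij) scale0r.
Qed.

(** Partial sums match after a shift by one degree. This case of multiplicativity suffices to carry
    orthogonality from the vacuum to all word vectors in [Mr_of_perp]. *)
Lemma nceval_letter f C j x : bnd c f C -> ev (f * letter j) x = ev f (X j x).
Proof.
move=> fC; have [D jD] := bnd_letter j.
apply: (nceval_eq (bndM c0 fC jD)) => e e0; have [N0 N0P] := nceval_cvg (X j x) fC e0.
exists N0.+1 => -[//|N] NN; rewrite partial_eval_letter; exact: N0P.
Qed.

End Evaluation.

(** * The left shift and its truncations *)

Section RowBound.
Variables (R : realType) (H : lmodType R[i]) (dot : H -> H -> R[i]).
Hypothesis hl : hilbert dot.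
Variables (d : nat) (X Y : 'I_d -> H -> H) (c : R).
Hypotheses (XY : forall j x y, dot (X j x) y = dot x (Y j y)) (c0 : 0 <= c)
  (T_le : forall u, hnorm dot (\sum_(j < d) X j (Y j u)) <= c ^+ 2 * hnorm dot u).
Let ip := hilbert_ip hl.

Lemma row_bound u : \sum_(j < d) hnorm dot (Y j u) ^+ 2 <= c ^+ 2 * hnorm dot u ^+ 2.
Proof.
have -> : \sum_(j < d) hnorm dot (Y j u) ^+ 2 = Re (dot (\sum_(j < d) X j (Y j u)) u).
  rewrite (dot_suml ip) raddf_sum; apply: eq_bigr => j _ /=.
  by rewrite XY (hnorm_sqr ip).
apply: le_trans (ler_norm _) _; apply: le_trans (normc_Re _) _.
apply: le_trans (cauchy_schwarz ip _ _) _; rewrite [in leRHS]expr2 mulrA.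
by apply: ler_wpM2r; [exact: hnorm_ge0|exact: T_le].
Qed.

Lemma row_norm_le : (row_norm dot X <= c%:E)%E.
Proof.
have -> : c%:E = sqrte (c ^+ 2)%:E by rewrite /sqrte sqrtr_sqr ger0_norm.
rewrite /row_norm lee_sqrt ?lee_fin ?sqr_ge0 //; apply: (bound_opnorm (sqr_ge0 _)) => u.
rewrite fct_sumE (eq_bigr (fun j => X j (Y j u))); first exact: T_le.
by move=> j _ /=; rewrite (adjointP hl (XY j)).
Qed.

End RowBound.

Section Shift.
Variables (R : realType) (d : nat) (r : R).
Hypothesis r0 : 0 < r.
Local Notation S := (ncseries R d).
Local Notation norm2 := (hnorm (@l2dot R)).
Let hl := l2_hilbert R.
Let ip := hilbert_ip hl.
Let r0' := ltW r0.
Implicit Types (f : S) (x y : l2 R) (w : seq 'I_d).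

Fact unit_vec_subproof k : (fun i => (i == k)%:R : R[i]) \in @square_summable R.
Proof.
apply: (@l2_bounded _ _ 1) => N; rewrite /sqs big_mkord.
have [kN|Nk] := ltnP k N.
  rewrite (bigD1 (Ordinal kN)) //= eqxx normc1 expr1n big1 ?addr0 // => i ik.
  rewrite (_ : (i == k :> nat) = false); first by rewrite [normc _]normc0 expr0n.
  by apply: contraNF ik => /eqP ik; apply/eqP/val_inj.
rewrite big1 // => i _; rewrite (_ : (i == k :> nat) = false) ?[normc _]normc0 ?expr0n //.
by apply/negP => /eqP ik; move: Nk; rewrite -ik leqNgt ltn_ord.
Qed.

Definition unit_vec k : l2 R := L2 (unit_vec_subproof k).

Lemma dot_unit_vec x k : l2dot x (unit_vec k) = x k.
Proof.
have cv := l2dot_cvg x (unit_vec k).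
have E N : (k < N)%N -> series (fun i => x i * conjc (unit_vec k i)) N = x k.
  move=> kN; rewrite /series /= big_mkord (bigD1 (Ordinal kN)) //= eqxx.
  rewrite [conjc _]conjc1 mulr1 big1 ?addr0 // => i ik.
  rewrite (_ : (i == k :> nat) = false); first by rewrite [conjc _]conjc0 mulr0.
  by apply: contraNF ik => /eqP ik; apply/eqP/val_inj.
apply: ccvg_unique cv _; split.
  by apply: cvg_near_cst; exists k.+1 => // N /= kN; rewrite E.
by apply: cvg_near_cst; exists k.+1 => // N /= kN; rewrite E.
Qed.

Lemma unit_vec_dot y k : l2dot (unit_vec k) y = (y k)^*.
Proof. by rewrite (dotC ip) dot_unit_vec. Qed.

Definition lshift (j : 'I_d) f : S :=
  fun w => if w is i :: v then (if i == j then f v else 0) else 0.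

Lemma sqw_lshift j f N : sqw r (lshift j f) N <= r ^+ 2 * sqw r f N.
Proof.
case: N => [|N]; first by rewrite /sqw !big_ord0 mulr0.
rewrite /sqw big_ord_recl big_ord_recr /= mulrDr ler_wpDr //.
  by rewrite !mulr_ge0 ?sqr_ge0 ?hom_sqnorm_ge0 // mulnC exprM sqr_ge0.
rewrite [X in X * _](_ : _ = 0) ?mul0r ?add0r; last first.
  rewrite /hom_sqnorm big1 // => w _; rewrite tuple0.
  by rewrite -[lshift _ _ _]/(0 : R[i]) normc0 expr0n.
rewrite mulr_sumr; apply: ler_sum => l _; rewrite /bump /= add1n.
rewrite mulnS exprD mulrCA ler_pM2l ?exprn_gt0 //; apply: ler_wpM2r.
  by rewrite mulnC exprM sqr_ge0.
rewrite /hom_sqnorm (sum_tuple_cons l (fun w => normc (lshift j f w) ^+ 2)).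
rewrite (bigD1 j) //= eqxx [X in _ + X]big1 ?addr0 // => i ij.
by rewrite big1 // => w _; rewrite (negbTE ij) [normc _]normc0 expr0n.
Qed.

Lemma fock_lshift j f : fock r f -> fock r (lshift j f).
Proof.
move=> [C fC]; exists (r ^+ 2 * C) => N; apply: le_trans (sqw_lshift j f N) _.
by rewrite ler_pM2l ?exprn_gt0.
Qed.

(** On the Fock space, [r] times the isometric left creation operator of the letter [j]; it
    annihilates the coordinates that code no word ([shift_junk]). *)
Definition shift (j : 'I_d) x : l2 R := enc r (lshift j (dec r x)).

Lemma shift_le j x : norm2 (shift j x) <= r * norm2 x.
Proof.
apply: enc_norm_le => //; first by rewrite mulr_ge0 ?hnorm_ge0.
move=> N; apply: le_trans (sqw_lshift _ _ _) _; rewrite exprMn ler_pM2l ?exprn_gt0 //.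
exact: dec_sqw.
Qed.

Lemma shift_cons i j x w :
  shift j x (pickle (i :: w)) = if i == j then x (pickle w) * r%:C else 0.
Proof.
rewrite /shift enc_pickle //; last exact/fock_lshift/fock_dec.
rewrite /lshift; case: eqP => [_|]; last by rewrite mul0r.
rewrite /dec -mulrA -real_complexM /= exprS mulrCA mulVf ?mulr1 //.
by rewrite expf_eq0 gt_eqF // andbF.
Qed.

Lemma shift_nil j x : shift j x (pickle ([::] : seq 'I_d)) = 0.
Proof. by rewrite /shift enc_pickle ?mul0r //; exact/fock_lshift/fock_dec. Qed.

Lemma shift_fock_vec j x : fock_vec d (shift j x).
Proof. exact: fock_vec_enc. Qed.

Lemma shift_linear j : linear (shift j).
Proof.
move=> a x y; apply: (@fock_vecP _ d); first exact: shift_fock_vec.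
  move=> k kN; rewrite -[LHS]/(a * shift j x k + shift j y k).
  by rewrite !shift_fock_vec // mulr0 addr0.
move=> [|i w]; rewrite -[RHS]/(a * shift j x _ + shift j y _).
  by rewrite !shift_nil mulr0 addr0.
rewrite !shift_cons; case: eqP => _; last by rewrite mulr0 addr0.
by rewrite -[X in X * _]/(a * x (pickle w) + y (pickle w)) mulrDl mulrA.
Qed.

Lemma fock_unit_vec w : fock_vec d (unit_vec (pickle w)).
Proof.
move=> k kN; rewrite /= (_ : (k == pickle w) = false) //.
by apply: contra_eqF kN => /eqP ->; rewrite /word_of pickleK_inv.
Qed.

Lemma unit_vec_pickle w v : unit_vec (pickle w) (pickle v) = (v == w)%:R.
Proof. by rewrite /= (inj_eq (pcan_inj pickleK)). Qed.

Lemma shift_unit_vec j w :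
  shift j (unit_vec (pickle w)) = r%:C *: unit_vec (pickle (j :: w)).
Proof.
apply: (@fock_vecP _ d); first exact: shift_fock_vec.
  by apply: (subspaceZ _ (fock_vec_subspace _ _)); exact: fock_unit_vec.
move=> [|i v]; rewrite -[RHS]/(r%:C * unit_vec _ _) unit_vec_pickle.
  by rewrite shift_nil mulr0.
rewrite shift_cons unit_vec_pickle eqseq_cons; case: (i == j); last by rewrite mulr0.
by rewrite mulrC.
Qed.

Lemma shift_junk j k : word_of d k = None -> shift j (unit_vec k) = 0.
Proof.
move=> kN; apply: (@fock_vecP _ d); [exact: shift_fock_vec|by []|].
move=> [|i v]; first by rewrite shift_nil.
rewrite shift_cons; case: eqP => // _; rewrite /= (_ : (_ == k) = false) ?mul0r //.
by apply: contra_eqF kN => /eqP <-; rewrite /word_of pickleK_inv.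
Qed.

Lemma shift_adjoint : exists Y : 'I_d -> l2 R -> l2 R,
  (forall j x y, l2dot (shift j x) y = l2dot x (Y j y)) /\
  forall j y w, Y j y (pickle w) = r%:C * y (pickle (j :: w)).
Proof.
have /choice[Y YP] j : exists Yj, forall x y, l2dot (shift j x) y = l2dot x (Yj y).
  exact: (adjoint_exists hl (@shift_linear j) (@shift_le j)).
exists Y; split=> // j y w; rewrite -[LHS]conjcK -unit_vec_dot -YP shift_unit_vec.
by rewrite (dotZl ip) unit_vec_dot rmorphM /= conjcK oppr0.
Qed.

(** The operator on the left is [r ^+ 2] times the projection onto the coordinates of nonempty
    words, so the bound holds in each coordinate. *)
Lemma shift_row_bound (Y : 'I_d -> l2 R -> l2 R) :
  (forall j y w, Y j y (pickle w) = r%:C * y (pickle (j :: w))) ->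
  forall u, norm2 (\sum_(j < d) shift j (Y j u)) <= r ^+ 2 * norm2 u.
Proof.
move=> YE u; apply: l2_norm_le => [|N]; first by rewrite mulr_ge0 ?sqr_ge0 ?hnorm_ge0.
rewrite exprMn; apply: (@le_trans _ _ ((r ^+ 2) ^+ 2 * sqs u N)); last first.
  by apply: ler_wpM2l; [exact: sqr_ge0|exact: l2_sqs_le].
rewrite /sqs mulr_sumr; apply: ler_sum => k _.
rewrite l2_sumE -exprMn; apply: lerXn2r.
- by rewrite nnegrE normc_ge0.
- by rewrite nnegrE mulr_ge0 ?sqr_ge0 ?normc_ge0.
case E : (word_of d k) => [w|]; last first.
  rewrite big1 ?[normc _]normc0 ?mulr_ge0 ?sqr_ge0 ?normc_ge0 // => j _.
  by rewrite shift_fock_vec.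
have <- : pickle w = k by have : oapp pickle k (word_of d k) = k := pickle_invK k; rewrite E.
case: w {E} => [|i w].
  rewrite big1 ?[normc _]normc0 ?mulr_ge0 ?sqr_ge0 ?normc_ge0 // => j _.
  by rewrite shift_nil.
rewrite (bigD1 i) //= shift_cons eqxx big1 ?addr0 => [|j ji]; last first.
  by rewrite shift_cons eq_sym (negbTE ji).
by rewrite YE !normcM normc_real ger0_norm // mulrAC expr2.
Qed.

Lemma word_op_shift w v :
  word_op shift w (unit_vec (pickle v)) = (r ^+ size w)%:C *: unit_vec (pickle (w ++ v)).
Proof.
elim: w => [|j w IH] /=; first by rewrite expr0 scale1r.
rewrite IH (linear_scale _ _ (@shift_linear j)) shift_unit_vec scalerA.
by rewrite -real_complexM exprS mulrC.
Qed.

Lemma partial_eval_shift f N :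
  partial_eval f shift N (unit_vec (pickle ([::] : seq 'I_d))) = enc r (trunc N f).
Proof.
have ftr : fock r (trunc N f) by apply: bnd_is_fock (bnd_trunc N f r0').
apply: (@fock_vecP _ d).
- rewrite partial_evalE; apply: (subspace_sum _ (fock_vec_subspace _ _)) => l _.
  apply: (subspace_sum _ (fock_vec_subspace _ _)) => w _.
  rewrite word_op_shift scalerA; apply: (subspaceZ _ (fock_vec_subspace _ _)).
  exact: fock_unit_vec.
- exact: fock_vec_enc.
move=> v; rewrite enc_pickle // partial_evalE l2_sumE.
have E l : hom_eval shift f l (unit_vec (pickle ([::] : seq 'I_d))) (pickle v) =
    if size v == l then f v * (r ^+ size v)%:C else 0.
  rewrite /hom_eval l2_sumE.
  rewrite (eq_bigr (fun w : l.-tuple 'I_d =>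
    f w * ((r ^+ size w)%:C * (v == w :> seq 'I_d)%:R))); last first.
    move=> w _; rewrite word_op_shift cats0.
    rewrite -[LHS]/(f w * ((r ^+ size w)%:C * unit_vec (pickle (val w)) (pickle v))).
    by rewrite unit_vec_pickle.
  case: eqP => [vl|vl].
    have vt : size v == l by apply/eqP.
    rewrite (bigD1 (Tuple vt)) //= eqxx mulr1 big1 ?addr0 // => w wv.
    rewrite (_ : v == w = false) ?mulr0 //; apply: contraNF wv => /eqP vw.
    by apply/eqP/val_inj.
  rewrite big1 // => w _; rewrite (_ : v == w = false) ?mulr0 //.
  by apply/negP => /eqP vw; apply: vl; rewrite vw size_tuple.
under eq_bigr do rewrite E.
rewrite /trunc; case: ltnP => vN.
  rewrite (bigD1 (Ordinal vN)) //= eqxx big1 ?addr0 // => l lv.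
  by rewrite (_ : (size v == l) = false) //; apply: contraNF lv => /eqP vl; apply/eqP/val_inj.
rewrite big1 ?mul0r // => l _; rewrite (_ : (size v == l) = false) //.
by apply/negP => /eqP vl; move: vN; rewrite vl leqNgt ltn_ord.
Qed.

End Shift.

Lemma conv_letter (R : realType) d (rho : \bar R) j :
  (letter R j : ncseries R d) \in @conv_pred R d rho.
Proof. by apply/conv_bndP => s s0 _; apply: bnd_letter; exact: ltW. Qed.

(** * Separation by the left shift on l^2 *)

Section Separation.
Variables (R : realType) (d : nat) (rho : \bar R) (m : nat).
Local Notation S := (ncseries R d).
Local Notation norm2 := (hnorm (@l2dot R)).
Local Notation conv := (@conv_pred R d rho).
Variable g : 'I_m -> S.
Hypothesis g_conv : forall k, g k \in conv.

Lemma Mr_of_perp (r : R) (f : S) : 0 < r -> (r%:E < rho)%E -> f \in conv ->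
  (forall X y, (forall j, bounded_op (@l2dot R) (X j)) ->
    (row_norm (@l2dot R) X < rho)%E -> y <> 0 ->
    (forall f', combs rho g f' -> perp_range (@l2dot R) (nceval (@l2dot R) f' X) y) ->
    perp_range (@l2dot R) (nceval (@l2dot R) f X) y) ->
  Mr rho g r (enc r f).
Proof.
move=> r0 rr fc sep; have r0' := ltW r0.
have hl := l2_hilbert R; have ip := hilbert_ip hl.
have [Y [XY YE]] := @shift_adjoint R d r r0.
have X_lin := @shift_linear R d r r0.
have T_le := shift_row_bound r0 YE.
have row_le := row_bound hl XY T_le.
pose e0 : l2 R := unit_vec R (pickle ([::] : seq 'I_d)).
have bndP (f' : S) : f' \in conv -> exists C, bnd r f' C.
  by move=> f'c; apply: (proj1 (conv_bndP rho _) f'c).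
have ev0 (f' : S) : f' \in conv -> nceval (@l2dot R) f' (shift r) e0 = enc r f'.
  move=> /bndP[C fC]; apply: (nceval_eq hl X_lin XY r0' row_le fC) => ep ep0.
  have ep2 : 0 < ep / 2 by rewrite divr_gt0.
  have [N NP] := bnd_tail r0' fC ep2; exists N => M NM.
  rewrite (partial_eval_shift r0) (hnormBC ip).
  have ff := bnd_is_fock r0' fC; have ft := bnd_is_fock r0' (bnd_trunc M f' r0').
  rewrite (encB r0' ff ft); apply: (@le_lt_trans _ _ (ep / 2)); last by lra.
  by apply: enc_norm_bnd => //; exact: NP.
apply: contrapT => notM.
have [p Mp pP] := projection hl (enc r f) (Mr_subspace g_conv r0 rr) (@hclosureK _ _ _ hl _).
pose y := enc r f - p.
have yF : fock_vec d y.
  apply: (subspaceB (fock_vec_subspace _ _)); first exact: fock_vec_enc.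
  exact: (Mr_fock_vec r0 Mp).
have y0 : y <> 0 by move=> /subr0_eq yE; apply: notM; rewrite yE.
have yM f' : combs rho g f' -> l2dot (enc r f') y = 0.
  move=> f'J; have Mf : Mr rho g r (enc r f') by apply: Mr_enc; exact: f'J.
  by rewrite (dotC ip) (pP _ Mf) raddf0.
(* Evaluating [f'] after the operator of a letter amounts to evaluating [f'] times that letter,
   which is again in the right ideal; hence the induction is over all [f'] at once and ends at the
   vacuum. *)
have perpw (w : seq 'I_d) f' : combs rho g f' ->
    l2dot (nceval (@l2dot R) f' (shift r) (word_op (shift r) w e0)) y = 0.
  elim: w f' => [|j w IH] f' f'J /=; first by rewrite (ev0 _ (combs_conv g_conv f'J)); exact: yM.
  have [C fC] := bndP f' (combs_conv g_conv f'J).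
  have E := nceval_letter hl X_lin XY r0' row_le j (word_op (shift r) w e0) fC.
  rewrite -[X in l2dot X _]E; apply: IH.
  exact: combs_mul f'J (@conv_letter R d rho j).
have perpJ f' : combs rho g f' -> perp_range (@l2dot R) (nceval (@l2dot R) f' (shift r)) y.
  move=> f'J; have [C fC] := bndP f' (combs_conv g_conv f'J).
  set T := nceval _ _ _.
  have T_lin : linear T by exact: (nceval_linear hl X_lin XY r0' row_le fC).
  have T_bd x : norm2 (T x) <= C * norm2 x by exact: (nceval_bound hl X_lin XY r0' row_le x fC).
  (* Orthogonality is within reach on unit vectors only. Through the adjoint it says that every
     coordinate of [Ts y] vanishes, which gives it for all [x]. *)
  have [Ts TsP] := adjoint_exists hl T_lin T_bd.
  suff Tsy : Ts y = 0 by move=> x; rewrite TsP Tsy (dot0r ip).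
  apply: l2P => k; rewrite -[LHS]conjcK -unit_vec_dot -TsP.
  suff -> : l2dot (T (unit_vec R k)) y = 0 by rewrite conjc0.
  case E : (word_of d k) => [w|].
    have <- : pickle w = k by have : oapp pickle k (word_of d k) = k := pickle_invK k; rewrite E.
    have := perpw w f' f'J; rewrite -/T (word_op_shift r0) cats0 (linear_scale _ _ T_lin).
    have rw : (r ^+ size w)%:C != 0.
      by apply: real_complex_neq0; apply: expf_neq0; rewrite gt_eqF.
    by rewrite (dotZl ip) => /eqP; rewrite mulf_eq0 (negbTE rw) => /eqP.
  (* At an index coding no word only the constant term acts, and [y] vanishes there as a Fock
     vector. *)
  have -> : T (unit_vec R k) = f' [::] *: unit_vec R k.
    apply: (nceval_eq hl X_lin XY r0' row_le fC) => ep ep0; exists 1%N => -[//|N] _.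
    suff -> : partial_eval f' (shift r) N.+1 (unit_vec R k) = f' [::] *: unit_vec R k.
      by rewrite subrr (hnorm0 ip).
    rewrite partial_evalE big_ord_recl big1 ?addr0 => [|l _].
      rewrite /hom_eval (bigD1 [tuple] isT) big1; first exact: addr0.
      by move=> w /negP[]; apply/eqP; exact: tuple0.
    rewrite /hom_eval big1; first by [].
    move=> w _; suff -> : word_op (shift r) w (unit_vec R k) = 0 by rewrite scaler0.
    have : size w = l.+1 by rewrite size_tuple lift0.
    case/lastP: (val w) => [//|v i] _.
    by rewrite word_op_rcons (shift_junk r0 _ E); exact: linear_zero (word_op_linear X_lin v).
  by rewrite (dotZl ip) unit_vec_dot (yF _ E) conjc0 mulr0.
have : perp_range (@l2dot R) (nceval (@l2dot R) f (shift r)) y.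
  apply: sep; [|exact: le_lt_trans (row_norm_le hl XY r0' T_le) rr|exact: y0|exact: perpJ].
  move=> j; apply/(bounded_opP hl); split; first exact: X_lin.
  by exists r; exact: (shift_le r0 j).
move=> /(_ e0); rewrite (ev0 _ fc) => fy; apply: y0; apply: (hnorm_eq0 ip).
apply/eqP; rewrite -sqrf_eq0 (hnorm_sqr ip) {1}/y (dotBl ip) fy.
by rewrite (dotC ip) (pP _ Mp) raddf0 subrr.
Qed.

End Separation.

Section TruncatedShift.
Variables (R : realType) (d : nat) (r : R) (N : nat).
Hypothesis r0 : 0 < r.
Local Notation S := (ncseries R d).
Local Notation n := #|{: N.-bseq 'I_d}|.
Local Notation V := 'cV[R[i]]_n.
Let hl := @cdot_hilbert R n.
Let ip := hilbert_ip hl.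
Let r0' := ltW r0.
Implicit Types (u v : V) (w : seq 'I_d).

Definition index_word (a : 'I_n) : seq 'I_d := val (enum_val a : N.-bseq 'I_d).

Lemma index_word_inj : injective index_word.
Proof. by move=> a b /val_inj /enum_val_inj. Qed.

Lemma size_index_word a : (size (index_word a) <= N)%N.
Proof. exact: size_bseq. Qed.

Lemma index_word_onto w : (size w <= N)%N -> exists a, index_word a = w.
Proof.
by move=> wN; exists (enum_rank (Bseq wN)); rewrite /index_word enum_rankK.
Qed.

(** Compression of the left shift to words of length at most [N]: words that would become too long
    are sent to 0. *)
Definition tshift (j : 'I_d) : 'M[R[i]]_n :=
  \matrix_(a, b) (if index_word a == j :: index_word b then r%:C else 0).

(** The plain transpose is the adjoint because the entries are real. *)
Definition tshift_adj (j : 'I_d) u : V := (tshift j)^T *m u.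

Lemma tshift_adjoint j u v :
  cdot (mxops tshift j u) v = cdot u (tshift_adj j v).
Proof.
rewrite /cdot; under eq_bigr do rewrite mxE mulr_suml.
rewrite exchange_big; apply: eq_bigr => b _ /=; rewrite mxE rmorph_sum mulr_sumr.
apply: eq_bigr => a _ /=; rewrite rmorphM /= !mxE mulrAC mulrA mulrC -mulrA.
by case: ifP => _; simpc; rewrite ?conjc_real //= mulrCA mulrA.
Qed.

Lemma tshift_adjE j u b :
  tshift_adj j u b ord0 = \sum_(a | index_word a == j :: index_word b) r%:C * u a ord0.
Proof.
rewrite mxE [RHS]big_mkcond; apply: eq_bigr => a _; rewrite !mxE.
by case: ifP => // _; rewrite mul0r.
Qed.

Lemma tshiftE j u a :
  mxops tshift j u a ord0 = \sum_(b | index_word a == j :: index_word b) r%:C * u b ord0.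
Proof.
rewrite mxE [RHS]big_mkcond; apply: eq_bigr => b _; rewrite mxE.
by case: ifP => // _; rewrite mul0r.
Qed.

Lemma tshift_row_bound u :
  hnorm (@cdot R n) (\sum_(j < d) mxops tshift j (tshift_adj j u)) <=
  r ^+ 2 * hnorm (@cdot R n) u.
Proof.
rewrite -(@ler_pXn2r _ 2) ?nnegrE ?mulr_ge0 ?hnorm_ge0 ?sqr_ge0 //.
rewrite exprMn !hnorm_cdot mulr_sumr; apply: ler_sum => a _.
rewrite -exprMn; apply: lerXn2r; rewrite ?nnegrE ?normc_ge0 ?mulr_ge0 ?sqr_ge0 ?normc_ge0 //.
rewrite summxE; case E : (index_word a) => [|i w].
  rewrite big1 ?[normc _]normc0 ?mulr_ge0 ?sqr_ge0 ?normc_ge0 // => j _.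
  by rewrite tshiftE big1 // => b; rewrite E.
have wN : (size w <= N)%N by have := size_index_word a; rewrite E; exact: ltnW.
have [b bw] := index_word_onto wN.
rewrite (bigD1 i) //= [X in _ + X]big1 ?addr0 => [|j ji]; last first.
  by rewrite tshiftE big1 // => b'; rewrite E eqseq_cons eq_sym (negbTE ji).
rewrite tshiftE (bigD1 b) /=; last by rewrite E bw.
rewrite [X in _ + X]big1 ?addr0 => [|b' /andP[]]; last first.
  by rewrite E eqseq_cons eqxx -bw => /eqP /index_word_inj -> /negP[].
rewrite tshift_adjE (bigD1 a) /=; last by rewrite E bw.
rewrite [X in _ + X]big1 ?addr0 => [|a' /andP[]]; last first.
  by rewrite bw -E => /eqP /index_word_inj -> /negP[].
by rewrite !normcM normc_real ger0_norm // mulrA expr2.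
Qed.

Definition word_vec w : V := \col_a (index_word a == w)%:R.

Lemma tshift_word_vec j w : mxops tshift j (word_vec w) = r%:C *: word_vec (j :: w).
Proof.
apply/colP => a; rewrite tshiftE !mxE.
have [wN|Nw] := leqP (size w) N; last first.
  rewrite (_ : index_word a == j :: w = false) ?mulr0; last first.
    apply/negP => /eqP aw; have := size_index_word a; rewrite aw /= ltnNge.
    by rewrite ltnW.
  rewrite big1 // => b _; rewrite mxE (_ : index_word b == w = false) ?mulr0 //.
  by apply/negP => /eqP bw; have := size_index_word b; rewrite bw leqNgt Nw.
have [b bw] := index_word_onto wN; rewrite -bw; case: eqP => aE.
  rewrite (bigD1 b) /= ?aE ?eqxx // mxE eqxx big1 ?addr0 // => b' /andP[].
  by rewrite eqseq_cons eqxx => /eqP /index_word_inj <- /negP[].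
rewrite mulr0 big1 // => b' /eqP ab'; rewrite mxE; case: eqP => b'b; last by rewrite mulr0.
by case: aE; rewrite ab' b'b.
Qed.

Lemma word_op_tshift w :
  word_op (mxops tshift) w (word_vec [::]) = (r ^+ size w)%:C *: word_vec w.
Proof.
elim: w => [|j w IH] /=; first by rewrite scale1r.
rewrite IH /mxops -scalemxAr -/(mxops tshift j (word_vec w)) tshift_word_vec scalerA.
by rewrite -real_complexM exprS mulrC.
Qed.

Lemma hnorm_word_vec : hnorm (@cdot R n) (word_vec [::]) = 1.
Proof.
have [a aE] := @index_word_onto [::] isT.
rewrite -[LHS]ger0_norm ?hnorm_ge0 // -sqrtr_sqr hnorm_cdot (bigD1 a) //= mxE aE eqxx.
rewrite normc1 expr1n big1 ?addr0 ?sqrtr1 // => b ba; rewrite mxE.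
rewrite (_ : index_word b == [::] = false); first by rewrite [normc _]normc0 expr0n.
by apply: contraNF ba; rewrite -aE => /eqP /index_word_inj ->.
Qed.

Lemma sum_index_word (F : seq 'I_d -> R) :
  \sum_a F (index_word a) = \sum_(w <- words d N.+1) F w.
Proof.
rewrite -(big_map index_word xpredT F); apply: perm_big; apply: uniq_perm.
- by rewrite map_inj_uniq ?index_enum_uniq //; exact: index_word_inj.
- exact: uniq_words.
move=> w; rewrite mem_words ltnS; apply/mapP/idP => [[a _ ->]|].
  exact: size_index_word.
by move=> /index_word_onto[a <-]; exists a => //; rewrite mem_index_enum.
Qed.

(** The truncated shift is an admissible test tuple of row norm at most [r], and evaluating [f]
    there on the unit vacuum vector lists the weighted coefficients of [f] up to degree [N]. *)
Lemma seminorm_ge (f : S) C (e : R) : bnd r f C -> (seminorm r f < e%:E)%E ->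
  sqw r f N.+1 <= e ^+ 2.
Proof.
move=> fC fe; have row_le := row_bound hl tshift_adjoint tshift_row_bound.
have X_lin j : linear (mxops tshift j).
  by move=> a x y; rewrite /mxops mulmxDr scalemxAr.
pose v : V := \col_a (f (index_word a) * (r ^+ size (index_word a))%:C).
have ev : nceval (@cdot R n) f (mxops tshift) (word_vec [::]) = v.
  apply: (nceval_eq hl X_lin tshift_adjoint r0' row_le fC) => ep ep0; exists N.+1 => M NM.
  rewrite (_ : partial_eval _ _ _ _ = v) ?subrr ?(hnorm0 ip) //.
  apply/colP => a; rewrite partial_evalE summxE mxE.
  have aM : (size (index_word a) < M)%N by apply: leq_ltn_trans (size_index_word a) NM.
  rewrite (bigD1 (Ordinal aM)) //= [X in _ + X]big1 ?addr0 => [|l la]; last first.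
    rewrite /hom_eval summxE big1 // => w _; rewrite word_op_tshift !mxE.
    rewrite (_ : index_word a == w = false) ?mulr0 //; apply: contraNF la => /eqP aw.
    by apply/eqP/val_inj; rewrite /= aw size_tuple.
  rewrite /hom_eval summxE (bigD1 (in_tuple (index_word a))) //= word_op_tshift !mxE eqxx mulr1.
  rewrite [X in _ + X]big1 ?addr0 // => w wa; rewrite word_op_tshift !mxE.
  rewrite (_ : index_word a == w = false) ?mulr0 //; apply: contraNF wa => /eqP aw.
  by apply/eqP/val_inj.
have vE : hnorm (@cdot R n) v ^+ 2 = sqw r f N.+1.
  rewrite hnorm_cdot sqw_words -sum_index_word; apply: eq_bigr => a _.
  by rewrite mxE normcM normc_real ger0_norm ?exprn_ge0.
have ve : ((hnorm (@cdot R n) v)%:E <= e%:E)%E.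
  apply: le_trans (ltW fe).
  apply: (@le_trans _ _ (opnorm (@cdot R n) (nceval (@cdot R n) f (mxops tshift)))).
    by rewrite -ev; apply: ereal_sup_ubound; exists (word_vec [::]) => //=; rewrite hnorm_word_vec.
  apply: ereal_sup_ubound; exists n, tshift; split=> //.
  exact: (row_norm_le hl tshift_adjoint r0' tshift_row_bound).
rewrite lee_fin in ve; rewrite -vE lerXn2r ?nnegrE ?hnorm_ge0 //.
exact: le_trans (hnorm_ge0 _ _) ve.
Qed.

End TruncatedShift.

(** * Closedness and the Nullstellensatz for finitely generated right ideals *)

Section FinitelyGenerated.
Variables (R : realType) (d : nat) (rho : \bar R) (m : nat).
Local Notation O := (conv_series d rho).
Variable g : 'I_m -> O.

Let gs k := series_of (g k).

Fact gs_conv k : gs k \in @conv_pred R d rho.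
Proof. exact: valP (g k). Qed.

Lemma series_of_sum (I : Type) (r : seq I) (P : pred I) (F : I -> O) :
  series_of (\sum_(i <- r | P i) F i) = \sum_(i <- r | P i) series_of (F i).
Proof. exact: (raddf_sum (val : O -> ncseries R d)). Qed.

Lemma series_of_combs (f : O) :
  (exists h : 'I_m -> O, f = \sum_(k < m) g k * h k) <-> combs rho gs (series_of f).
Proof.
split=> [[h ->]|[h hc fE]].
  exists (fun k => series_of (h k)); first by move=> k; exact: valP (h k).
  by rewrite series_of_sum.
exists (fun k => ConvSeries (hc k)); apply: val_inj.
by rewrite /= fE series_of_sum.
Qed.

End FinitelyGenerated.

Section RightIdeals.
Variables (R : realType) (d : nat) (rho : \bar R) (J : set (conv_series d rho)).
Hypotheses (rho_gt0 : (0 < rho)%E) (J_fg : finitely_generated J).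

Lemma fg_ideal_combs : exists m (g : 'I_m -> ncseries R d),
  [/\ forall k, g k \in @conv_pred R d rho,
      forall f, J f <-> combs rho g (series_of f) &
      forall f, (forall r : R, 0 < r -> (r%:E < rho)%E -> Mr rho g r (enc r (series_of f))) -> J f].
Proof.
have [m [g JE]] := J_fg; exists m, (fun k => series_of (g k)).
have gc := gs_conv g; have JP f : J f <-> combs rho (fun k => series_of (g k)) (series_of f).
  by rewrite JE; exact: series_of_combs.
split=> // f fM; apply/JP; exact: combs_of_closure rho_gt0 gc (valP f) fM.
Qed.

Lemma fg_ideal_dideal : J = dideal (dvariety J).
Proof.
have [m [g [gc JP JM]]] := fg_ideal_combs.
apply/seteqP; split=> [f Jf p [_]|f fI]; first exact.
apply: JM => r r0 rr; apply: (Mr_of_perp gc r0 rr (valP f)) => X y bX rX y0 perp.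
(* Points at the level aleph_0 suffice, as the separating tuple is the shift on l^2. *)
apply: (fI (OpPoint X y)); split=> // h /JP; exact: perp.
Qed.

(** A series outside [J] has, at some radius [r], a positive Fock distance [e] from [J]; as
    [seminorm r] dominates the Fock norm, a ball of this one seminorm avoids [J]. *)
Lemma fg_ideal_closed : closed J.
Proof.
have [m [g [gc JP JM]]] := fg_ideal_combs.
rewrite -openC -[open _]/(conv_open (~` J)) => f nJf.
have [r [r0 [rr nM]]] : exists r : R, 0 < r /\ (r%:E < rho)%E /\
    ~ Mr rho g r (enc r (series_of f)).
  apply: contrapT => /forallNP none; apply: nJf; apply: JM => r r0 rr.
  by apply: contrapT => nM; apply: (none r).
have [e e0 eP] : exists2 e : R, 0 < e & forall h, combs rho g h ->
    e <= hnorm (@l2dot R) (enc r (series_of f) - enc r h).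
  apply: contrapT => /forall2NP none; apply: nM => e e0.
  have [//|] := none e; move=> /existsNP[h /not_implyP[hJ /negP]]; rewrite -ltNge => ?.
  by exists (enc r h) => //; exists h.
(* Half the distance, because the bound on all partial sums yields only a non-strict inequality in
   the limit. *)
exists [:: r], (e / 2); split.
- by move=> _ /[!inE] /eqP ->.
- by rewrite divr_gt0.
move=> h sem /JP hJ; have se := sem r (mem_head _ _).
have r0' := ltW r0.
have ff := conv_fock r0 rr (valP f); have fh := conv_fock r0 rr (combs_conv gc hJ).
have [C bC] : exists C, bnd r (series_of (h - f)) C.
  by apply: (proj1 (conv_bndP rho _) (valP (h - f))).
have := eP _ hJ; rewrite (hnormBC (l2dot_ip R)) (encB r0' fh ff).
have e2 : 0 <= e / 2 by rewrite divr_ge0 ?ltW.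
have : hnorm (@l2dot R) (enc r (series_of h - series_of f)) <= e / 2.
  apply: enc_norm_le => // -[|N]; first by rewrite /sqw big_ord0 sqr_ge0.
  exact: (seminorm_ge N r0 bC se).
by move=> le1 le2; have := le_trans le2 le1; lra.
Qed.

End RightIdeals.

Local Open Scope ereal_scope.

Theorem theorem4p5 (R : realType) (d : nat) (rho : \bar R)
    (J : set (conv_series d rho)) :
  0 < rho -> right_ideal J -> finitely_generated J ->
  closed J /\ J = dideal (dvariety J).
Proof.
by move=> rho0 _ Jfg; split; [exact: fg_ideal_closed|exact: fg_ideal_dideal].
Qed.
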